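(* Let $d\ge 1$, $k\in\{0,1,\ldots,d-1\}$, and consider a great hypersphere tessellation of $\mathbb{S}^d$ with non-degenerate directional distribution $\kappa$ and intensity $n\ge d-k$. For $\kappa_k$-almost all $S\in\mathbb{G}_s(d,k)$ and all Borel sets $A\subset\mathbb{K}_s(d)$ one has $$\mathbf{P}(Z_{n,d}^{(k)}\in A\,|\,D(Z_{n,d}^{(k)})=S)=\mathbf{P}(Z(T_{n-d+k,S})\in A),$$ where $Z(T_{n-d+k,S})$ is the typical cell of $T_{n-d+k,S}$.
   Context: $\mathbb{S}^d$ is the unit sphere of $\mathbb{R}^{d+1}$. For $k\in\{0,\ldots,d\}$, $\mathbb{G}_s(d,k)$ is the set of $k$-dimensional great subspheres of $\mathbb{S}^d$ (intersections of $\mathbb{S}^d$ with $(k+1)$-dimensional linear subspaces); elements of $\mathbb{G}_s(d,d-1)$ are great hyperspheres. $\mathbb{K}_s(d)$ is the set of all $C\cap\mathbb{S}^d$ with $C\subset\mathbb{R}^{d+1}$ a closed convex cone different from $\{0\}$, with the topology of the spherical Hausdorff distance (a Polish space). A spherical polytope is $P=C\cap\mathbb{S}^d$ with $C\ne\{0\}$ a polyhedral cone; its $\ell$-dimensional faces are the intersections of $\mathbb{S}^d$ with the $(\ell+1)$-dimensional faces of $C$; $\mathcal{F}_\ell(P)$ is the set of these. Tessellation: let $\kappa^\circ$ be an even Borel probability measure on $\mathbb{S}^d$ with $\kappa^\circ(S)=0$ for every $S\in\mathbb{G}_s(d,d-1)$, and let $\kappa$ be its image under $u\mapsto u^\perp\cap\mathbb{S}^d$;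 such a $\kappa$ is what is meant here by a non-degenerate directional distribution. For $n\ge1$ let $S_1,\ldots,S_n$ be independent random great hyperspheres with distribution $\kappa$. The great hypersphere tessellation $T_{n,d}=T_d(S_1,\ldots,S_n)$ of intensity $n$ and directional distribution $\kappa$ is the random finite collection of spherical polytopes (cells) that are the closures of the connected components of $\mathbb{S}^d\setminus(S_1\cup\cdots\cup S_n)$; $T_{0,d}=\{\mathbb{S}^d\}$. Put $\mathcal{F}_k(T_{n,d})=\bigcup_{P\in T_{n,d}}\mathcal{F}_k(P)$. Typical spherical $k$-face: given $T_{n,d}$, $Z_{n,d}^{(k)}$ is chosen uniformly at random from the almost surely finite set $\mathcal{F}_k(T_{n,d})$. For fixed $S\in\mathbb{G}_s(d,k)$ and $m\ge0$, $T_{m,S}=T_{m,d}\cap S$ is the collection of cells $P\cap S$, $P\in T_{m,d}$ with interior meeting $S$ (where $T_{m,d}$ has directional distribution $\kappa$); its typical cell $Z(T_{m,S})$ is chosen uniformly at random among its cells. The direction of $K\in\mathbb{K}_s(d)$ with $\dim\mathrm{lin}(K)=k+1$ is $D(K)=\mathrm{lin}(K)\cap\mathbb{S}^d\in\mathbb{G}_s(d,k)$. $\kappa_k$ is the distribution of $S_1\cap\cdots\cap S_{d-k}$ where $S_1,\ldots,S_{d-k}$ are independent with distribution $\kappa$; the distribution of $D(Z_{n,d}^{(k)})$ is $\kappa_k$. $\mathbf{P}(Z_{n,d}^{(k)}\in A\,|\,D(Z_{n,d}^{(k)})=S)$ denotes the regular conditional distribution of $Z_{n,d}^{(k)}$ given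 $D(Z_{n,d}^{(k)})=S$. *)

(* Defs.v *)
From HB Require Import structures.
From mathcomp Require Import all_boot all_order all_algebra finmap.
From mathcomp Require Import all_classical all_reals all_analysis.

Set Implicit Arguments.
Unset Strict Implicit.
Unset Printing Implicit Defensive.

Import Order.TTheory GRing.Theory Num.Theory.
Import numFieldNormedType.Exports.

Local Open Scope classical_set_scope.
Local Open Scope ring_scope.

(* The ambient space of the sphere of dimension d.  The norm that the library
   puts on matrices is the sup norm; it induces the Euclidean topology, and all
   metric notions below go through the scalar product. *)
Notation euclid R d := 'rV[R]_(d.+1).

Section Geometry.
Variables (R : realType) (d : nat).
Notation E := (euclid R d).
Implicit Types (u v x y : E) (A C F K L P S : set E).

Definition dot u v : R := (u *m v^T) 0 0.

Definition sphere : set E := [set u | dot u u = 1].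

Definition closed_convex_cone C : Prop :=
  [/\ closed C, convex_set C, C 0 &
      forall (t : R) x, 0 <= t -> C x -> C (t *: x)].

Definition sph_convex K : Prop :=
  exists C, [/\ closed_convex_cone C, C <> [set 0] & K = C `&` sphere].

Definition linear_hull K : set E :=
  smallest [set A | exists U : {vspace E}, A = [set x | x \in U]] K.

Definition lin_dim K (m : nat) : Prop :=
  exists U : {vspace E}, linear_hull K = [set x | x \in U] /\ \dim U = m.

Definition great_subsphere (k : nat) : set (set E) :=
  [set S | exists U : {vspace E},
             \dim U = k.+1 /\ S = [set x | x \in U] `&` sphere].

Definition orth_sphere u : set E := [set x | dot u x = 0] `&` sphere.

Definition geodesic_dist u v : R := acos (dot u v).

Definition parallel_set K (e : R) : set E :=
  [set x | sphere x /\ exists2 y, K y & geodesic_dist x y <= e].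

Definition hausdorff_dist K L : R :=
  inf [set e | [/\ 0 <= e, K `<=` parallel_set L e & L `<=` parallel_set K e]].

Definition polyhedral_cone C : Prop :=
  exists (m : nat) (v : 'I_m -> E), C = [set x | forall i, 0 <= dot (v i) x].

(* The choice v = 0 makes C a face of itself. *)
Definition cone_face C F : Prop :=
  exists v, C `<=` [set x | 0 <= dot v x] /\ F = C `&` [set x | dot v x = 0].

Definition sph_faces (l : nat) P : set (set E) :=
  [set K | exists C F,
      [/\ polyhedral_cone C, C <> [set 0] & P = C `&` sphere] /\
      [/\ cone_face C F, lin_dim F l.+1 & K = F `&` sphere]].

Definition tessellation (n : nat) (H : 'I_n -> set E) : set (set E) :=
  [set P | exists2 x, (sphere `\` \bigcup_i H i) x &
             P = closure (connected_component (sphere `\` \bigcup_i H i) x)].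

Definition tess_faces (k : nat) (T : set (set E)) : set (set E) :=
  \bigcup_(P in T) sph_faces k P.

(* Interior relative to the sphere. *)
Definition sph_interior P : set E :=
  [set x | sphere x /\ within sphere (nbhs x) P].

Definition tess_section S (T : set (set E)) : set (set E) :=
  [set K | exists P, [/\ T P, sph_interior P `&` S !=set0 & K = P `&` S]].

Lemma vspace_closed (U : {vspace E}) : closed [set x : E | x \in U].
Proof.
pose g := (\1 - projv U)%VF : 'End(E).
have gE x : (x \in U) = (g x == 0).
  apply/idP/eqP => [xU|]; rewrite /g lfunE /= opp_lfunE id_lfunE.
    by rewrite projv_id// subrr.
  by move=> /eqP; rewrite subr_eq0 => /eqP ->; exact: memv_proj.
have gs x : g x = \sum_(j < d.+1) x 0 j *: g (delta_mx 0 j).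
  by rewrite {1}(row_sum_delta x) linear_sum; apply: eq_bigr => j _; rewrite linearZ.
have gc : continuous (g : E -> E).
  have -> : (g : E -> E) = fun x => \sum_(j < d.+1) x 0 j *: g (delta_mx 0 j).
    by apply/funext.
  apply: continuous_big => [|j _ x]; first exact: add_continuous.
  by apply: cvgZr_tmp; [exact: nbhs_filter|exact: (@coord_continuous R 1 d.+1 0 j x)].
have -> : [set x : E | x \in U] = g @^-1` [set 0].
  apply/seteqP; split => x /=; first by rewrite gE => /eqP.
  by move=> gx0; rewrite gE gx0.
apply: closed_comp; first by move=> x _; exact: gc.
exact: accessible_closed_set1 (hausdorff_accessible (@norm_hausdorff _ _)) _.
Qed.

Lemma linear_hull_sub K (U : {vspace E}) :
  K `<=` [set x | x \in U] -> linear_hull K `<=` [set x | x \in U].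
Proof. by move=> KU x; apply; split => //; exists U. Qed.

Lemma sph_convexT : sph_convex sphere.
Proof.
exists setT; split; last by rewrite setTI.
- by split=> //; move=> x y l _ _; rewrite inE.
- move=> /seteqP[/(_ (const_mx 1) I) /= /rowP/(_ ord0)].
  by rewrite !mxE => /eqP; rewrite oner_eq0.
Qed.

Lemma linear_hull_cone K : closed_convex_cone (linear_hull K).
Proof.
split.
- by apply: closed_bigI => A [[U ->] _]; exact: vspace_closed.
- move=> x y l; rewrite !inE => xK yK A [[U ->] KU] /=.
  rewrite rpredD// rpredZ//.
  + by have /= := xK _ (conj (ex_intro _ U erefl) KU).
  + by have /= := yK _ (conj (ex_intro _ U erefl) KU).
- by move=> A [[U ->] _] /=; exact: mem0v.
- move=> t x _ xK A [[U ->] KU] /=; rewrite rpredZ//.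
  by have /= := xK _ (conj (ex_intro _ U erefl) KU).
Qed.

Lemma dotZ (t : R) x : dot (t *: x) (t *: x) = t ^+ 2 * dot x x.
Proof.
by rewrite /dot linearZ /= -scalemxAl -scalemxAr scalerA mxE expr2.
Qed.

Lemma dot_gt0 x : x != 0 -> 0 < dot x x.
Proof.
move=> x0; rewrite /dot mxE lt_neqAle; apply/andP; split; last first.
  by apply: sumr_ge0 => i _; rewrite mxE -expr2 sqr_ge0.
rewrite eq_sym psumr_neq0; last by move=> i _; rewrite mxE -expr2 sqr_ge0.
case/rV0Pn : x0 => i xi; apply/hasP; exists i; first exact: mem_index_enum.
by rewrite /= mxE -expr2 lt_neqAle sqr_ge0 eq_sym sqrf_eq0 xi.
Qed.

Lemma sph_convex_nonempty K : sph_convex K -> K !=set0.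
Proof.
move=> [C [[_ _ C0 CZ] Cneq ->]].
have [x [Cx x0]] : exists x, C x /\ x != 0.
  apply: contrapT => nex; apply: Cneq; apply/seteqP; split => [x Cx|x -> //].
  by apply: contrapT => /eqP x0; apply: nex; exists x.
have d0 := dot_gt0 x0.
exists ((Num.sqrt (dot x x))^-1 *: x); split.
  by apply: CZ => //; rewrite invr_ge0 sqrtr_ge0.
by rewrite /sphere /= dotZ exprVn sqr_sqrtr ?ltW// mulVf// gt_eqF.
Qed.

Lemma sph_convex_direction K : sph_convex K ->
  sph_convex (linear_hull K `&` sphere).
Proof.
move=> scK; have [x Kx] := sph_convex_nonempty scK.
exists (linear_hull K); split => //; first exact: linear_hull_cone.
move=> hK0; have : linear_hull K x by move=> A [_ KA]; exact: KA.
rewrite hK0 => /= x0; case: scK Kx => C [_ _ ->] [_].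
by rewrite /sphere /= x0 /dot mul0mx mxE => /esym/eqP; rewrite oner_eq0.
Qed.

End Geometry.

(* The space of spherically convex sets, with the topology of the spherical
   Hausdorff distance. *)
Record sconvex (R : realType) (d : nat) := SConvex {
  body :> set (euclid R d);
  _ : sph_convex body }.

Lemma bodyP (R : realType) (d : nat) (K : sconvex R d) : sph_convex K.
Proof. by case: K. Qed.

HB.instance Definition _ (R : realType) (d : nat) :=
  gen_eqMixin (sconvex R d).
HB.instance Definition _ (R : realType) (d : nat) :=
  gen_choiceMixin (sconvex R d).
HB.instance Definition _ (R : realType) (d : nat) :=
  isPointed.Build (sconvex R d) (SConvex (sph_convexT R d)).

Definition hausdorff_open (R : realType) (d : nat) : set (set (sconvex R d)) :=
  [set U : set (sconvex R d) | forall K, U K -> exists2 e : R, 0 < e &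
             forall L : sconvex R d, hausdorff_dist K L < e -> U L].

Section Topology.
Variables (R : realType) (d : nat).

Let openT : hausdorff_open [set: sconvex R d].
Proof. by move=> K _; exists 1. Qed.

Let openI : setI_closed (@hausdorff_open R d).
Proof.
move=> A B oA oB K [/oA [a a0 aA] /oB [b b0 bB]].
exists (Num.min a b); first by rewrite lt_min a0.
by move=> L; rewrite lt_min => /andP[/aA ? /bB].
Qed.

Let open_bigU (I : Type) (f : I -> set (sconvex R d)) :
  (forall i, hausdorff_open (f i)) -> hausdorff_open (\bigcup_i f i).
Proof.
move=> of_ K [i _ /of_ [e e0 eA]].
by exists e => // L /eA ?; exists i.
Qed.

HB.instance Definition _ :=
  isOpenTopological.Build (sconvex R d) openT openI open_bigU.

End Topology.

(* Borel sigma-algebras; great subspheres form a subset of [sconvex R d] and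
   inherit its Borel structure. *)
Notation borel_euclid R d := (g_sigma_algebraType (@open (euclid R d))).
Notation borel_sconvex R d := (g_sigma_algebraType (@open (sconvex R d))).

Definition direction (R : realType) (d : nat) (K : sconvex R d) : sconvex R d :=
  SConvex (sph_convex_direction (bodyP K)).

Local Open Scope ereal_scope.

(* The set [body @` A] lists the members of A as plain sets of points, so
   [(body @` A) X] says that the set of points X belongs to A. *)
Definition nondegenerate_directional (R : realType) (d : nat)
    (kappa : probability (borel_sconvex R d) R) : Prop :=
  exists kappa0 : probability (borel_euclid R d) R,
    [/\ kappa0 (@sphere R d) = 1,
        forall B : set (borel_euclid R d), measurable B ->
          kappa0 [set u | B (- (u : euclid R d))%R] = kappa0 B,
        forall S : set (borel_euclid R d), great_subsphere d.-1 S ->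
          kappa0 S = 0 &
        forall A : set (borel_sconvex R d), measurable A ->
          kappa A = kappa0 [set u | (@body R d @` A) (orth_sphere u)]].

Section RandomElements.
Context d0 (Omega : measurableType d0) (R : realType) (P : probability Omega R).

Definition mutually_independent (n : nat) d1 (T : measurableType d1)
    (X : 'I_n -> Omega -> T) : Prop :=
  forall A : 'I_n -> set T, (forall i, measurable (A i)) ->
    P (\bigcap_i (X i @^-1` A i)) = \prod_(i < n) P (X i @^-1` A i).

Definition has_law d1 (T : measurableType d1) (X : Omega -> T)
    (mu : set T -> \bar R) : Prop :=
  measurable_fun setT X /\
  forall A, measurable A -> P (X @^-1` A) = mu A.

Definition iid_great_hyperspheres (d : nat)
    (kappa : probability (borel_sconvex R d) R) (n : nat)
    (S : 'I_n -> Omega -> borel_sconvex R d) : Prop :=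
  [/\ forall i w, great_subsphere d.-1 (S i w : sconvex R d),
      forall i, has_law (S i) kappa &
      mutually_independent S].

Definition random_tessellation (d n : nat)
    (S : 'I_n -> Omega -> borel_sconvex R d) (w : Omega) : set (set (euclid R d)) :=
  tessellation (fun i => S i w : sconvex R d).

Definition proportion (d : nat) (F : set (set (euclid R d)))
    (A : set (sconvex R d)) : R :=
  (#|` fset_set (F `&` (@body R d @` A)) |%:R / #|` fset_set F |%:R)%R.

(* Given the random collection T, the random set Z is chosen uniformly from the
   finite collection F(T).  The events [T @^-1` G] are those determined by T. *)
Definition uniform_given (d : nat) (T : Omega -> set (set (euclid R d)))
    (F : set (set (euclid R d)) -> set (set (euclid R d)))
    (Z : Omega -> borel_sconvex R d) : Prop :=
  measurable_fun setT Z /\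
  forall (A : set (borel_sconvex R d)) (G : set (set (set (euclid R d)))),
    measurable A -> measurable (T @^-1` G) ->
    P (Z @^-1` A `&` T @^-1` G) =
      \int[P]_(w in T @^-1` G) (proportion (F (T w)) A)%:E.

Definition typical_face (d k n : nat)
    (S : 'I_n -> Omega -> borel_sconvex R d) (Z : Omega -> borel_sconvex R d) :=
  uniform_given (random_tessellation S) (tess_faces k) Z.

Definition typical_section_cell (d m : nat) (L : sconvex R d)
    (S : 'I_m -> Omega -> borel_sconvex R d) (Z : Omega -> borel_sconvex R d) :=
  uniform_given (fun w => tess_section L (random_tessellation S w)) id Z.

Definition regular_conditional_distribution d1 d2 (T1 : measurableType d1)
    (T2 : measurableType d2) (X : Omega -> T1) (Y : Omega -> T2)
    (Q : R.-pker T2 ~> T1) : Prop :=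
  [/\ measurable_fun setT X, measurable_fun setT Y &
      forall A B, measurable A -> measurable B ->
        P (X @^-1` A `&` Y @^-1` B) = \int[P]_(w in Y @^-1` B) Q (Y w) A].

End RandomElements.

Definition intersection_distribution (R : realType) (d : nat)
    (kappa : probability (borel_sconvex R d) R) (k : nat)
    (kappak : probability (borel_sconvex R d) R) : Prop :=
  exists d0 (Omega : measurableType d0) (P : probability Omega R)
    (S : 'I_(d - k) -> Omega -> borel_sconvex R d),
    iid_great_hyperspheres P kappa S /\
    forall A : set (borel_sconvex R d), measurable A ->
      kappak A =
        P [set w | (@body R d @` A) (\bigcap_i (S i w : sconvex R d))].

(* Main.v *)
(* Choose a unit normal of each hypersphere.  Almost surely the normals are in
   general position; then the k-faces of the tessellation by n hyperspheres are,
   for the index sets I with d - k elements, the cells of the section of the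
   tessellation by the hyperspheres outside I with the k-sphere L_I cut out by
   the hyperspheres in I, each such cell spanning L_I.  By deletion-restriction
   the number of cells of a section in general position depends only on k and on
   the number of hyperspheres, so the total number of k-faces is constant.  L_I
   has law kappa_k and is independent of the other hyperspheres, whence
     P(Z in A, D(Z) in B) = int_B P(Z(T_{n-d+k,L}) in A) kappa_k(dL)
   by Fubini.  The Borel sets of K_s(d) are generated by the countably many events
   that K meets a given rational ball, so the exceptional null set can be chosen
   independently of A. *)
Require Import Defs.
From HB Require Import structures.
From mathcomp Require Import all_boot all_order all_algebra finmap.
From mathcomp Require Import all_classical all_reals all_analysis.
From mathcomp Require Import measurable_realfun.
From mathcomp Require Import ring lra.

Set Implicit Arguments.
Unset Strict Implicit.
Unset Printing Implicit Defensive.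

Import Order.TTheory GRing.Theory Num.Theory.
Import numFieldNormedType.Exports.

Local Open Scope classical_set_scope.
Local Open Scope ring_scope.

(** * Scalar product *)

(** Two obstacles shape the proof. The first is measurability. Every event needed (a cell belongs to
    [A], a cell exists, the normals are degenerate) is reduced to the existence of a point [y] of
    the sphere that satisfies finitely many inequalities, continuous in [y] and measurable in the
    random parameter. Compactness turns such an existence statement into a countable test over
    rational points, so no measurable selection is required. The second is that the hyperspheres of
    the tessellation, of the section and of [kappak] live on unrelated probability spaces. They are
    compared through the law of the tuple of their unit normals, on product spaces where two
    families are glued. Gluing is used twice: to resample one hypersphere, which yields general
    position from the single assumption that great hyperspheres are null sets, and to separate the
    hyperspheres through a face from the others. General position is always taken relative to a
    subspace: the full space for faces, the span of the fixed subsphere for sections. *)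

Section Dot.
Variables (R : realType) (d : nat).
Notation E := 'rV[R]_(d.+1).
Implicit Types (u v x y : E).

Lemma dotE u v : dot u v = \sum_(j < d.+1) u 0 j * v 0 j.
Proof. by rewrite /dot mxE; apply: eq_bigr => j _; rewrite mxE. Qed.

Lemma dotC u v : dot u v = dot v u.
Proof. by rewrite !dotE; apply: eq_bigr => j _; rewrite mulrC. Qed.

Lemma dotDr u x y : dot u (x + y) = dot u x + dot u y.
Proof. by rewrite /dot linearD /= mulmxDr mxE. Qed.

Lemma dotZr u (t : R) x : dot u (t *: x) = t * dot u x.
Proof. by rewrite /dot linearZ /= -scalemxAr mxE. Qed.

Lemma dotDl u x y : dot (x + y) u = dot x u + dot y u.
Proof. by rewrite dotC dotDr !(dotC u). Qed.

Lemma dotZl u (t : R) x : dot (t *: x) u = t * dot x u.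
Proof. by rewrite dotC dotZr dotC. Qed.

Lemma dotNr u x : dot u (- x) = - dot u x.
Proof. by rewrite -scaleN1r dotZr mulN1r. Qed.

Lemma dotNl u x : dot (- x) u = - dot x u.
Proof. by rewrite dotC dotNr dotC. Qed.

Lemma dotBr u x y : dot u (x - y) = dot u x - dot u y.
Proof. by rewrite dotDr dotNr. Qed.

Lemma dotBl u x y : dot (x - y) u = dot x u - dot y u.
Proof. by rewrite dotDl dotNl. Qed.

Lemma dot0r u : dot u 0 = 0.
Proof. by rewrite -(scale0r 0) dotZr mul0r. Qed.

Lemma dot0l u : dot 0 u = 0.
Proof. by rewrite dotC dot0r. Qed.

Lemma dot_sumr (I : finType) (P : pred I) (F : I -> E) u :
  dot u (\sum_(i | P i) F i) = \sum_(i | P i) dot u (F i).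
Proof.
apply: (big_morph (dot u)); [exact: dotDr|exact: dot0r].
Qed.

Lemma dot_suml (I : finType) (P : pred I) (F : I -> E) u :
  dot (\sum_(i | P i) F i) u = \sum_(i | P i) dot (F i) u.
Proof. by rewrite dotC dot_sumr; apply: eq_bigr => i _; rewrite dotC. Qed.

Lemma dot_ge0 x : 0 <= dot x x.
Proof. by have [->|/dot_gt0/ltW//] := eqVneq x 0; rewrite dot0r. Qed.

Lemma dot_eq0 x : (dot x x == 0) = (x == 0).
Proof.
have [->|/dot_gt0] := eqVneq x 0; first by rewrite dot0r eqxx.
by move/gt_eqF.
Qed.

Lemma coord_norm x j : `|x 0 j| <= `|x|.
Proof. by rewrite [leRHS]/Num.Def.normr /= mx_normrE; apply/bigmax_geP; right => /=; exists (0, j). Qed.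

Lemma norm_coordP x (e : R) : 0 <= e -> (forall j, `|x 0 j| <= e) -> `|x| <= e.
Proof.
move=> e0 xe; rewrite [leLHS]/Num.Def.normr /= mx_normrE.
by apply/bigmax_leP; split => // -[i j] _ /=; rewrite (ord1 i).
Qed.

Lemma norm_coord_lt x (e : R) : 0 < e -> (forall j, `|x 0 j| < e) -> `|x| < e.
Proof.
move=> e0 xe; rewrite [ltLHS]/Num.Def.normr /= mx_normrE.
by apply/bigmax_ltP; split => // -[i j] _ /=; rewrite (ord1 i).
Qed.

Lemma norm2_dot x : `|x| ^+ 2 <= dot x x.
Proof.
have h j : `|x 0 j| ^+ 2 <= dot x x.
  rewrite dotE (bigD1 j)//= real_normK ?num_real// expr2 lerDl.
  by apply: sumr_ge0 => i _; rewrite -expr2 sqr_ge0.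
have : `|x| <= Num.sqrt (dot x x).
  apply: norm_coordP => [|j]; first exact: sqrtr_ge0.
  by rewrite -(@ler_pXn2r _ 2)// ?nnegrE ?sqrtr_ge0// sqr_sqrtr ?dot_ge0.
by move=> /(lerXn2r 2); rewrite sqr_sqrtr ?dot_ge0//; apply; rewrite nnegrE// sqrtr_ge0.
Qed.

(** The norm is the sup norm, so a termwise bound takes the place of Cauchy-Schwarz; the dimension
    factor is harmless because only comparability of the two norms matters. *)
Lemma dot_le_norm u v : `|dot u v| <= d.+1%:R * `|u| * `|v|.
Proof.
rewrite dotE; apply: le_trans (ler_norm_sum _ _ _) _.
apply: (@le_trans _ _ (\sum_(j < d.+1) `|u| * `|v|)).
  by apply: ler_sum => j _; rewrite normrM ler_pM// coord_norm.
by rewrite sumr_const card_ord -[leLHS]mulr_natl mulrA.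
Qed.

Lemma sphere_norm x : @sphere R d x -> `|x| <= 1.
Proof.
move=> /= sx; have := norm2_dot x; rewrite sx => h.
by rewrite -(@ler_pXn2r _ 2)// ?nnegrE// expr1n.
Qed.

Lemma sphere_neq0 x : @sphere R d x -> x != 0.
Proof.
by move=> /= sx; rewrite -dot_eq0 sx oner_eq0.
Qed.

Lemma sphereN x : @sphere R d x -> @sphere R d (- x).
Proof. by rewrite /sphere /= dotNl dotNr opprK. Qed.

Lemma dot_continuous2 (T : topologicalType) (f g : T -> E) :
  continuous f -> continuous g -> continuous (fun t => dot (f t) (g t)).
Proof.
move=> cf cg.
have -> : (fun t => dot (f t) (g t)) = fun t => \sum_(j < d.+1) f t 0 j * g t 0 j.
  by apply/funext => t; rewrite dotE.
apply: continuous_big => [|j _ t]; first exact: add_continuous.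
rewrite /continuous_at; apply: (@cvgM R _ _ _ (fun t => f t 0 j) (fun t => g t 0 j)).
- exact: (@continuous_comp _ _ _ f (fun y : E => y 0 j : R^o) t (cf t) (@coord_continuous R 1 d.+1 0 j (f t))).
- exact: (@continuous_comp _ _ _ g (fun y : E => y 0 j : R^o) t (cg t) (@coord_continuous R 1 d.+1 0 j (g t))).
Qed.

Lemma dot_continuous u : continuous (dot u).
Proof. by apply: (@dot_continuous2 E (fun=> u) id) => x; [exact: cst_continuous|exact: cvg_id]. Qed.

Lemma dot_diag_continuous : continuous (fun x : E => dot x x).
Proof. by apply: (@dot_continuous2 E id id) => x; exact: cvg_id. Qed.

Lemma sphere_closed : closed (@sphere R d).
Proof.
rewrite (_ : @sphere R d = (fun x => dot x x) @^-1` [set 1])//.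
apply: closed_comp; first by move=> x _; exact: dot_diag_continuous.
exact: accessible_closed_set1 (hausdorff_accessible (@norm_hausdorff _ R^o)) _.
Qed.

Lemma sphere_compact : compact (@sphere R d).
Proof.
apply: bounded_closed_compact; last exact: sphere_closed.
exists 1; split; first exact: num_real.
by move=> y y1 x /sphere_norm /le_trans; apply; exact: ltW.
Qed.

Lemma compact_box (r : R) : compact [set x : E | `|x| <= r].
Proof.
apply: bounded_closed_compact.
  exists r; split; first exact: num_real.
  by move=> y y1 x /= /le_trans; apply; exact: ltW.
rewrite (_ : [set x | _] = (fun x => `|x|) @^-1` [set y | y <= r])//.
apply: closed_comp; last exact: closed_le.
by move=> x _; exact: norm_continuous.
Qed.

Definition normalize x : E := (Num.sqrt (dot x x))^-1 *: x.

Lemma normalize_sphere x : x != 0 -> @sphere R d (normalize x).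
Proof.
move=> /dot_gt0 x0; rewrite /sphere /= dotZ exprVn sqr_sqrtr ?ltW// mulVf//.
by rewrite gt_eqF.
Qed.

Lemma normalize_gt0 x : x != 0 -> 0 < (Num.sqrt (dot x x))^-1.
Proof. by move=> /dot_gt0 x0; rewrite invr_gt0 sqrtr_gt0. Qed.

Lemma normalize_id x : @sphere R d x -> normalize x = x.
Proof. by rewrite /sphere /normalize /= => ->; rewrite sqrtr1 invr1 scale1r. Qed.

Lemma normalize_continuous x : x != 0 -> {for x, continuous normalize}.
Proof.
move=> x0.
have c : {for x, continuous (fun y : E => (Num.sqrt (dot y y))^-1 : R^o)}.
  apply: (@continuous_comp _ _ _ (fun y : E => Num.sqrt (dot y y)) (@GRing.inv R)).
    apply: (@continuous_comp _ _ _ (fun y : E => dot y y) (@Num.sqrt R)).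
      exact: dot_diag_continuous.
    exact: sqrt_continuous.
  by apply: inv_continuous; rewrite gt_eqF// sqrtr_gt0 dot_gt0.
exact: (@cvgZ R E E (nbhs x) (nbhs_filter x) (fun y : E => (Num.sqrt (dot y y))^-1) id _ _ c cvg_id).
Qed.

End Dot.

(** * The Borel sets of the space of spherically convex sets *)

Section Geodesic.
Variables (R : realType) (d : nat).
Notation E := 'rV[R]_(d.+1).
Implicit Types (u v x y : E).

Lemma dot_sphereB x y : sphere x -> sphere y -> dot (x - y) (x - y) = 2 - 2 * dot x y.
Proof.
rewrite /sphere /= => sx sy; rewrite dotBl !dotBr sx sy (dotC y x); ring.
Qed.

Lemma dot_sphere_itv x y : sphere x -> sphere y -> -1 <= dot x y <= 1.
Proof.
move=> sx sy; have := dot_ge0 (x - y); rewrite dot_sphereB// => h1.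
have := dot_ge0 (x - (- y)); rewrite dot_sphereB//; last exact: sphereN.
rewrite dotNr => h2; lra.
Qed.

Lemma geodesic_lt_cos x y (e : R) : 0 <= e <= pi -> sphere x -> sphere y ->
  (geodesic_dist x y < e) = (cos e < dot x y).
Proof.
move=> he sx sy; have i := dot_sphere_itv sx sy.
rewrite /geodesic_dist -{2}(acosK (x := dot x y)) ?in_itv//=.
by rewrite ltr_cos// in_itv//= acos_ge0//= acos_lepi.
Qed.

Lemma norm_lt_geodesic (e : R) : 0 < e ->
  exists2 r : R, 0 < r & forall x y, sphere x -> sphere y -> `|x - y| < r ->
    geodesic_dist x y < e.
Proof.
move=> e0; pose e' := Num.min e pi.
have e'0 : 0 < e' by rewrite lt_min e0 pi_gt0.
have e'pi : e' <= pi by rewrite ge_min lexx orbT.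
have he' : 0 <= e' <= pi by rewrite ltW.
have c1 : cos e' < 1 by rewrite -(@cos0 R) ltr_cos// in_itv/= ?lexx ?pi_ge0.
have D0 : 0 < d.+1%:R :> R by [].
(* On the sphere [2 - 2 * dot x y] is the squared Euclidean distance, at most [d.+1] times the
   squared sup distance. The bound 1 allows one factor of that square to be dropped. *)
exists (Num.min 1 (2 * (1 - cos e') / d.+1%:R)).
  by rewrite lt_min ltr01 divr_gt0// mulr_gt0// subr_gt0.
move=> x y sx sy; rewrite lt_min => /andP[xy1 xyd].
apply: (@lt_le_trans _ _ e'); last by rewrite ge_min lexx.
rewrite geodesic_lt_cos//.
have := dot_le_norm (x - y) (x - y); rewrite ger0_norm ?dot_ge0// dot_sphereB// => h.
have : d.+1%:R * `|x - y| * `|x - y| < 2 * (1 - cos e').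
  rewrite ltr_pdivlMr// in xyd; apply: le_lt_trans xyd.
  rewrite (mulrC `|x - y|) -mulrA ler_wpM2l// -[leRHS]mulr1.
  by rewrite ler_wpM2l// ltW.
lra.
Qed.

Lemma geodesic_lt_norm (r : R) : 0 < r ->
  exists2 e : R, 0 < e & forall x y, sphere x -> sphere y ->
    geodesic_dist x y < e -> `|x - y| < r.
Proof.
(* The angle subtending a chord of length [r] has cosine [1 - r ^+ 2 / 2]; the maximum with 0 keeps
   [c] in the domain of [acos]. *)
move=> r0; pose c := Num.max 0 (1 - r ^+ 2 / 2).
have r20 : 0 < r ^+ 2 by rewrite exprn_gt0.
have c1 : -1 <= c < 1.
  have h : 1 - r ^+ 2 / 2 < 1 by rewrite ltrBlDr ltrDl divr_gt0.
  by rewrite le_max gt_max ltr01 h lerN10.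
have c1' : -1 <= c <= 1 by case/andP: c1 => -> /ltW.
exists (acos c); first exact: acos_gt0.
move=> x y sx sy; rewrite geodesic_lt_cos//; last by rewrite acos_ge0//= acos_lepi.
rewrite acosK ?in_itv// gt_max => /andP[_ h].
have := norm2_dot (x - y); rewrite dot_sphereB// => h'.
have r0' : 0 <= r by exact: ltW.
rewrite -(@ltr_pXn2r _ 2)// ?nnegrE//; lra.
Qed.

End Geodesic.

Section CountableUnions.
Context d0 (T : measurableType d0) (I : countType).

Lemma countable_bigcup_measurable (P : set I) (F : I -> set T) :
  (forall i, P i -> measurable (F i)) -> measurable (\bigcup_(i in P) F i).
Proof.
move=> mF; rewrite bigcup_mkcond; apply: countable_bigcupT_measurable => // i.
by case: ifPn => // /set_mem; exact: mF.
Qed.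

Lemma countable_bigcap_measurable (P : set I) (F : I -> set T) :
  (forall i, P i -> measurable (F i)) -> measurable (\bigcap_(i in P) F i).
Proof.
move=> mF; rewrite -[X in measurable X]setCK setC_bigcap; apply: measurableC.
by apply: countable_bigcup_measurable => i Pi; apply: measurableC; exact: mF.
Qed.

End CountableUnions.

Section Hitting.
Variables (R : realType) (d : nat).
Notation E := 'rV[R]_(d.+1).
Implicit Types (K L : sconvex R d) (O : set E).

(** The generating events of the Effros sigma-algebra, which is shown below to coincide with the
    Borel sigma-algebra of the Hausdorff distance. *)
Definition hits O : set (sconvex R d) := [set K | body K `&` O !=set0].

Lemma body_sphere K : body K `<=` @sphere R d.
Proof. by have [C [_ _ ->]] := bodyP K; move=> x []. Qed.

Lemma body_nonempty K : body K !=set0.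
Proof. exact: sph_convex_nonempty (bodyP K). Qed.

Lemma body_closed K : closed (body K).
Proof.
have [C [[Ccl _ _ _] _ ->]] := bodyP K.
by apply: closedI => //; exact: sphere_closed.
Qed.

Lemma sconvexP K L : body K = body L -> K = L.
Proof.
case: K L => [K hK] [L hL] /= KL; subst L.
by rewrite (Prop_irrelevance hK hL).
Qed.

Lemma hausdorff_lt K L (e : R) : hausdorff_dist K L < e ->
  exists2 r : R, 0 <= r < e &
   body K `<=` parallel_set L r /\ body L `<=` parallel_set K r.
Proof.
move=> h; pose A := [set e : R | [/\ 0 <= e, body K `<=` parallel_set L e &
  body L `<=` parallel_set K e]].
(* The value [pi], the diameter of the sphere, is always admissible, so the infimum is taken over a
   nonempty set. *)
have A0 : A !=set0.
  exists pi; split; first exact: pi_ge0.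
  - move=> x Kx; split; first exact: body_sphere Kx.
    have [y Ly] := body_nonempty L; exists y => //.
    by rewrite acos_lepi// dot_sphere_itv//; [exact: body_sphere Kx|exact: body_sphere Ly].
  - move=> x Lx; split; first exact: body_sphere Lx.
    have [y Ky] := body_nonempty K; exists y => //.
    by rewrite acos_lepi// dot_sphere_itv//; [exact: body_sphere Lx|exact: body_sphere Ky].
have [r [r0 ? ?] re] : exists2 r, A r & r < e by apply: inf_lt.
by exists r => //; rewrite r0.
Qed.

Lemma hausdorff_le K L (r : R) : 0 <= r ->
  body K `<=` parallel_set L r -> body L `<=` parallel_set K r ->
  hausdorff_dist K L <= r.
Proof.
move=> r0 KL LK; apply: ge_inf; last by [].
by exists 0 => e [].
Qed.

Lemma hausdorff_near K (r : R) : 0 < r -> exists2 e : R, 0 < e &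
  forall L, hausdorff_dist K L < e -> forall x, body K x -> exists2 y, body L y & `|x - y| < r.
Proof.
move=> r0; have [e e0 he] := geodesic_lt_norm d r0.
exists e => // L /hausdorff_lt[s /andP[s0 se] [KL _]] x Kx.
have [_ [y Ly xy]] := KL _ Kx.
exists y => //; apply: he (le_lt_trans xy se); [exact: body_sphere Kx|exact: body_sphere Ly].
Qed.

Lemma hausdorff_openE : @open (sconvex R d) = @hausdorff_open R d.
Proof. by []. Qed.

Lemma hits_open O : open O -> open (hits O).
Proof.
move=> oO; rewrite hausdorff_openE => K [x [Kx Ox]].
have /nbhs_ballP[r /= r0 hr] : nbhs x O by exact: open_nbhs_nbhs.
have [e e0 he] := hausdorff_near K r0.
exists e => // L /he/(_ _ Kx)[y Ly xy]; exists y; split => //; apply: hr.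
by rewrite -ball_normE.
Qed.

Definition ratpt (q : 'rV[rat]_(d.+1)) : E := map_mx ratr q.

Lemma ratpt_dense (x : E) (r : R) : 0 < r -> exists q, `|x - ratpt q| < r.
Proof.
move=> r0.
have h j : exists q : rat, `|x 0 j - ratr q| < r.
  have /rat_in_itvoo[q] : x 0 j - r < x 0 j + r by lra.
  by rewrite in_itv/= => /andP[q1 q2]; exists q; rewrite ltr_norml; apply/andP; split; lra.
have [f hf] := choice h.
exists (\row_j f j); apply: norm_coord_lt => // j.
by rewrite !mxE.
Qed.


Definition ratball (p : 'rV[rat]_(d.+1) * nat) : set E :=
  [set y | `|y - ratpt p.1| < p.2.+1%:R^-1].

Lemma ratball_open p : open (ratball p).
Proof.
rewrite (_ : ratball p = ball (ratpt p.1) (p.2.+1%:R^-1 : R)); first exact: ball_open.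
by apply/seteqP; split => y; rewrite -ball_normE /ratball /ball_ /= distrC.
Qed.

Lemma sphere_net (i : nat) : exists N : seq 'rV[rat]_(d.+1),
  forall x : E, sphere x -> exists2 q, q \in N & ratball (q, i) x.
Proof.
have := @sphere_compact R d; rewrite compact_cover => cs.
have [||N _ hN] := cs _ setT (fun q => ratball (q, i)).
- by move=> q _; exact: ratball_open.
- move=> x _; have [|q xq] := @ratpt_dense x (i.+1%:R^-1); first by rewrite invr_gt0.
  by exists q.
- by exists (finmap.enum_fset N) => x /hN [q /= qN xq]; exists q.
Qed.

Definition hits_ball (p : 'rV[rat]_(d.+1) * nat) := hits (ratball p).

Lemma small_ratio (r : R) : 0 < r -> exists i : nat, i.+1%:R^-1 < r.
Proof.
move=> r0; exists (Num.truncn r^-1).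
rewrite -[ltRHS]invrK ltf_pV2 ?posrE ?invr_gt0//; exact: truncnS_gt.
Qed.

(* Two bodies that hit the same balls of a finite net of the sphere are close, so
   an open set is a countable union of such equivalence classes. *)
Lemma open_sconvex_generated (U : set (sconvex R d)) : open U ->
  <<s range hits_ball >> U.
Proof.
rewrite hausdorff_openE => oU.
have [N hN] := choice sphere_net.
(* A class is coded by the level of the net and the list of yes/no answers on its balls; there are
   only countably many codes. *)
pose cls (p : nat * seq bool) := \bigcap_(j in [set j | (j < size (N p.1))%N])
  (if nth false p.2 j then hits_ball (nth 0 (N p.1) j, p.1)
   else ~` hits_ball (nth 0 (N p.1) j, p.1)).
have mcls p : measurable (cls p : set (g_sigma_algebraType (range hits_ball))).
  apply: bigcap_measurableType => j _; case: ifP => _; last apply: measurableC.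
    by apply: sub_sigma_algebra; exists (nth 0 (N p.1) j, p.1).
  by apply: sub_sigma_algebra; exists (nth 0 (N p.1) j, p.1).
suff -> : U = \bigcup_(p in [set p | cls p `<=` U]) cls p.
  exact: (@countable_bigcup_measurable _ (g_sigma_algebraType (range hits_ball))).
apply/seteqP; split => [K UK|K [p pU /pU]//].
have [e e0 eU] := oU _ UK.
have e20 : 0 < e / 2 by rewrite divr_gt0.
have [r r0 hr] := norm_lt_geodesic d e20.
have [i ir] := small_ratio (divr_gt0 r0 (ltr0n R 2)).
pose c := [seq `[< hits_ball (q, i) K >] | q <- N i].
exists (i, c); last first.
  move=> j /= jN; rewrite (nth_map 0)//; case: ifPn => /asboolP //.
move=> L Lc; apply: eU; apply: (@le_lt_trans _ _ (e / 2)); last lra.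
have tr q : q \in N i -> hits_ball (q, i) K <-> hits_ball (q, i) L.
  move=> qN; have := Lc (index q (N i)); rewrite /= index_mem => /(_ qN).
  rewrite (nth_map 0) ?index_mem// nth_index//.
  by case: ifPn => /asboolP.
have near_ x y q : ratball (q, i) x -> ratball (q, i) y -> `|x - y| < r.
  move=> h1 h2; move: h1 h2 ir; rewrite /ratball /= => h1 h2 h3.
  rewrite -(subrKA (ratpt q)); apply: le_lt_trans (ler_normD _ _) _.
  by rewrite (distrC (ratpt q)) (splitr r) ltrD// (lt_trans _ h3).
apply: hausdorff_le; first exact: ltW.
- move=> x Kx; have sx := body_sphere Kx; split => //.
  have [q qN qx] := hN i x sx.
  have [|y [Ly qy]] := (tr q qN).1; first by exists x.
  exists y => //; apply/ltW/hr => //; first exact: body_sphere Ly.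
  exact: near_ qx qy.
- move=> x Lx; have sx := body_sphere Lx; split => //.
  have [q qN qx] := hN i x sx.
  have [|y [Ky qy]] := (tr q qN).2; first by exists x.
  exists y => //; apply/ltW/hr => //; first exact: body_sphere Ky.
  exact: near_ qx qy.
Qed.

Lemma borel_sconvexE :
  <<s @open (sconvex R d) >> = <<s range hits_ball >>.
Proof.
apply/seteqP; split; apply: smallest_sub.
- exact: smallest_sigma_algebra.
- exact: open_sconvex_generated.
- exact: smallest_sigma_algebra.
- move=> _ [p _ <-]; apply: sub_sigma_algebra; apply: hits_open; exact: ratball_open.
Qed.

Lemma measurable_hits O : open O -> measurable (hits O : set (borel_sconvex R d)).
Proof. by move=> oO; apply: sub_sigma_algebra; exact: hits_open. Qed.

Lemma measurable_to_sconvex d0 (T : measurableType d0) (D : set T)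
    (f : T -> borel_sconvex R d) : measurable D ->
  (forall p, measurable (D `&` [set t | hits_ball p (f t)])) ->
  measurable_fun D f.
Proof.
move=> mD hf; have h := (@measurability _ _ T (borel_sconvex R d) D f (range (@hits_ball))). apply: h.
  exact: borel_sconvexE.
by move=> _ [_ [p _ <-] <-]; exact: hf.
Qed.

End Hitting.

(** * Measurability of the direction map *)

Section Direction.
Variables (R : realType) (d : nat).
Notation E := 'rV[R]_(d.+1).
Implicit Types (A : set E) (U : {vspace E}).

(** Among the finite lists of points of [A], one with a span of maximal dimension works: a point of
    [A] outside its span would enlarge it. *)
Lemma linear_hull_span A : exists ys : seq E,
  (forall y, y \in ys -> A y) /\ linear_hull A = [set x | x \in <<ys>>%VS].
Proof.
pose P m := `[< exists ys : seq E, (forall y, y \in ys -> A y) /\ \dim <<ys>> = m >].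
have P0 : exists m, P m by exists 0%N; apply/asboolP; exists [::]; rewrite span_nil dimv0.
have Pb m : P m -> (m <= \dim {:E})%N.
  by move=> /asboolP[ys [_ <-]]; apply: dimvS; exact: subvf.
case: (ex_maxnP P0 Pb) => m /asboolP[ys [ysA dys]] mmax.
exists ys; split => //.
have AU : A `<=` [set x | x \in <<ys>>%VS].
  move=> x Ax; apply: contrapT => /negP xys.
  have : (\dim <<x :: ys>> <= m)%N.
    apply: mmax; apply/asboolP; exists (x :: ys); split => // y.
    by rewrite inE => /predU1P[->|/ysA].
  rewrite -dys leqNgt => /negP; apply.
  have sub : (<<ys>> <= <<x :: ys>>)%VS by rewrite span_cons addvSr.
  rewrite ltnNge; have [le eq] := dimv_leqif_sup sub.
  apply/negP => ge; move: eq; rewrite eqn_leq le ge => /esym /subvP /(_ x).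
  by rewrite memv_span ?mem_head// (negbTE xys) => /(_ isT).
apply/seteqP; split => [x|x xys B [[U ->] AU']] /=; first exact: linear_hull_sub AU x.
by apply: subvP xys; apply/span_subvP => y /ysA /AU'.
Qed.

Lemma linear_hullZ A (t : R) x : linear_hull A x -> linear_hull A (t *: x).
Proof.
by move=> Ax B [[U ->] AU] /=; apply: memvZ; exact: (Ax _ (conj (ex_intro _ U erefl) AU)).
Qed.

Lemma linear_hull_sum A (I : finType) (c : I -> R) (y : I -> E) :
  (forall i, A (y i)) -> linear_hull A (\sum_i c i *: y i).
Proof.
move=> Ay B [[U ->] AU] /=; apply: memv_suml => i _; apply: memvZ; exact: AU.
Qed.

Lemma nbhs_neq0 (x : E) : x != 0 -> nbhs x [set y | y != 0].
Proof.
move=> x0; apply: open_nbhs_nbhs; split => //.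
rewrite (_ : [set y | _] = ~` [set 0]); last first.
  by apply/seteqP; split => y /eqP.
rewrite openC.
exact: accessible_closed_set1 (hausdorff_accessible (@norm_hausdorff _ _)) _.
Qed.

(** A point of the hull of [K] is a linear combination of finitely many points of [K]. A nearby body
    has points close to each of them, and the same coefficients give a nearby point of its hull. The
    hull may jump up in the limit of such approximations but not down, so hitting an open set is a
    stable property. *)
Lemma direction_lower_semicontinuous (O : set E) : open O ->
  open [set K : sconvex R d | hits O (direction K)].
Proof.
move=> oO; rewrite hausdorff_openE => K [z [[/= Kz sz] Oz]].
have [ys [ysK hullE]] := linear_hull_span (body K).
pose X := in_tuple ys; pose c i := coord X i z.
have zE : z = \sum_(i < size ys) c i *: X`_i.
  by apply: coord_span; move: Kz; rewrite hullE.
(* The perturbed combination leaves the sphere and has to be normalized, so [O] is replaced by a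
   neighbourhood of [z] in the whole space. *)
pose O' := [set x : E | x != 0 /\ O (normalize x)].
have nO' : nbhs z O'.
  have z0 := sphere_neq0 sz.
  apply: filterI.
    exact: nbhs_neq0.
  apply: normalize_continuous => //; apply: open_nbhs_nbhs; split => //.
  by rewrite normalize_id.
have /nbhs_ballP[eta /= eta0 zO'] := nO'.
(* Errors below [eta / C] at the chosen points add up to less than [eta]; the summand 1 keeps [C]
   positive. *)
pose C := 1 + \sum_i `|c i|.
have C0 : 0 < C by rewrite ltr_wpDr// sumr_ge0.
have [e e0 he] := hausdorff_near K (divr_gt0 eta0 C0).
exists e => // L KL.
have hy (i : 'I_(size ys)) : exists y, body L y /\ `|X`_i - y| < eta / C.
  have [|y Ly Xy] := he L KL (X`_i); first by apply: ysK; exact: mem_nth.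
  by exists y.
have [y hLy] := choice hy.
have : O' (\sum_i c i *: y i).
  apply: zO'; rewrite -ball_normE /ball_ /= zE -sumrB.
  apply: le_lt_trans (ler_norm_sum _ _ _) _.
  apply: (@le_lt_trans _ _ (\sum_i `|c i| * (eta / C))).
    apply: ler_sum => i _; rewrite -scalerBr normrZ ler_wpM2l//.
    by apply: ltW; case: (hLy i).
  by rewrite -mulr_suml mulrCA -[ltRHS]mulr1 ltr_pM2l// ltr_pdivrMr// mul1r /C ltrDr.
case=> y0 Oy; exists (normalize (\sum_i c i *: y i)); split => //; split.
  by apply: linear_hullZ; apply: linear_hull_sum => i; case: (hLy i).
exact: normalize_sphere.
Qed.

Lemma measurable_direction :
  measurable_fun setT (@direction R d : borel_sconvex R d -> borel_sconvex R d).
Proof.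
apply: measurable_to_sconvex => // p; rewrite setTI.
apply: sub_sigma_algebra; apply: direction_lower_semicontinuous; exact: ratball_open.
Qed.

End Direction.

Lemma measurable_ltr_cst d0 (T : measurableType d0) (R : realType) (f : T -> R) c :
  measurable_fun setT f -> measurable [set t | f t < c].
Proof.
move=> mf; rewrite -[X in measurable X]setTI.
rewrite (_ : [set t | _] = f @^-1` `]-oo, c[%classic); first exact: mf.
by apply/seteqP; split => t /=; rewrite in_itv.
Qed.

(** * Measurability of existence statements through Caratheodory functions *)

Section Caratheodory.
Context d0 (T : measurableType d0) (R : realType) (d : nat).
Notation E := 'rV[R]_(d.+1).
Implicit Types (g h : T -> E -> R) (O : set E).

Definition caratheodory g : Prop :=
  (forall t, continuous (g t : E -> R^o)) /\
  (forall y, measurable_fun setT (g ^~ y)).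

Lemma caratheodory_add g h : caratheodory g -> caratheodory h ->
  caratheodory (fun t y => g t y + h t y).
Proof.
move=> [gc gm] [hc hm]; split => [t y|y]; last exact: measurable_funD.
exact: (@cvgD R R^o E (nbhs y) _ (g t) (h t) _ _ (gc t y) (hc t y)).
Qed.

Lemma caratheodory_sum (I : Type) (s : seq I) (g_ : I -> T -> E -> R) :
  (forall i, caratheodory (g_ i)) ->
  caratheodory (fun t y => \sum_(i <- s) g_ i t y).
Proof.
move=> gC; elim: s => [|i s IH].
  have -> : (fun t y => \sum_(i <- [::]) g_ i t y) = fun _ _ => 0.
    by apply/funext => t; apply/funext => y; rewrite big_nil.
  by split => [t y|y] //; exact: cst_continuous.
have -> : (fun t y => \sum_(i <- i :: s) g_ i t y) =
    fun t y => g_ i t y + \sum_(i <- s) g_ i t y.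
  by apply/funext => t; apply/funext => y; rewrite big_cons.
exact: caratheodory_add.
Qed.

Lemma caratheodory_comp g (f : R -> R) : continuous (f : R^o -> R^o) ->
  caratheodory g -> caratheodory (fun t y => f (g t y)).
Proof.
move=> fc [gc gm]; split => [t y|y].
  exact: (@continuous_comp _ _ _ (g t : E -> R^o) (f : R^o -> R^o) y (gc t y) (fc _)).
apply: (measurableT_comp (f := f)) => //.
exact: continuous_measurable_fun.
Qed.

Lemma caratheodory_cst (f : E -> R) : continuous (f : E -> R^o) ->
  caratheodory (fun=> f).
Proof. by move=> fc; split. Qed.

Lemma max0D_continuous (c : R) : continuous (fun x : R^o => Num.max 0 (c + x) : R^o).
Proof.
move=> x; apply: (@continuous_max _ R^o (fun=> 0) (fun x => c + x)).
  exact: cst_continuous.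
exact: (@cvgD R R^o R^o (nbhs x) _ (fun=> c) id _ _ (cvg_cst c) cvg_id).
Qed.

(* Rational points with small values of [g t] accumulate at a zero of [g t], by
   compactness: the bound on [g] keeps them near the sphere. *)
Let exists_zero_measurableT g : caratheodory g ->
  (forall t y, `|dot y y - 1| <= g t y) ->
  measurable [set t | exists y, g t y = 0].
Proof.
move=> [gc gm] gs.
have -> : [set t | exists y, g t y = 0] =
    \bigcap_i \bigcup_q [set t | g t (@ratpt R d q) < i.+1%:R^-1].
  apply/seteqP; split => t /=.
  - move=> [y gy] i _.
    have /nbhs_ballP[r /= r0 hr] : nbhs y [set z | g t z < i.+1%:R^-1].
      apply: (gc t y [set x : R | x < i.+1%:R^-1]).
      by apply: lt_nbhsl; rewrite gy invr_gt0.
    have [q qy] := ratpt_dense y r0.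
    by exists q => //; apply: hr; rewrite -ball_normE.
  - move=> h; have {}h i : exists q, g t (@ratpt R d q) < i.+1%:R^-1.
      by have [q _] := h i I; exists q.
    have [q hq] := choice h.
    have bq i : `|ratpt R (q i)| <= 2.
      have h1 := le_lt_trans (gs t _) (hq i).
      have h2 : (i.+1%:R^-1 : R) <= 1 by rewrite invf_le1// ler1n.
      have := norm2_dot (@ratpt R d (q i)).
      have := lt_le_trans h1 h2; rewrite ltr_norml => /andP[_ {}h1] h3; clear h2.
      rewrite -(@ler_pXn2r _ 2)// ?nnegrE//; lra.
    have [y [_ cy]] := @compact_box R d 2 (fun A => \forall i \near \oo, A (ratpt R (q i)))
      (fmap_proper_filter _ _) (filterE _ bq).
    exists y; apply/eqP; rewrite eq_le (le_trans _ (gs t y))// andbT.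
    rewrite leNgt; apply/negP => g0.
    have nB : nbhs y [set z | g t y / 2 < g t z].
      apply: (gc t y [set x : R | g t y / 2 < x]).
      by apply: lt_nbhsr; lra.
    have nA : \forall i \near \oo, g t (ratpt R (q i)) < g t y / 2.
      have [i hi] := small_ratio (divr_gt0 g0 (ltr0n R 2)).
      exists i => // j /= ij; apply: lt_trans (hq j) _.
      by apply: le_lt_trans hi; rewrite lef_pV2 ?posrE// ler_nat ltnS.
    have [z [/= z1 z2]] := cy [set z | g t z < g t y / 2] _ nA nB.
    by have := lt_trans z1 z2; rewrite ltxx.
apply: bigcapT_measurable => i; apply: countable_bigcup_measurable => q _.
exact: measurable_ltr_cst.
Qed.

(** The open set [O] is the union of the closed rational balls inside it, and membership in a closed
    ball is the vanishing of a continuous nonnegative penalty [h p]. Added to [g], it reduces the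
    claim to zeros without location constraint. *)
Lemma exists_zero_measurable g O : caratheodory g ->
  (forall t y, `|dot y y - 1| <= g t y) -> open O ->
  measurable [set t | exists y, O y /\ g t y = 0].
Proof.
move=> gC gs oO.
pose cb (p : 'rV[rat]_(d.+1) * nat) := [set y : E | `|y - ratpt R p.1| <= p.2.+1%:R^-1].
pose h (p : 'rV[rat]_(d.+1) * nat) (y : E) : R :=
  Num.max 0 (- p.2.+1%:R^-1 + `|y - ratpt R p.1|).
have h0 p y : 0 <= h p y by rewrite le_max lexx.
have hcb p y : cb p y <-> h p y = 0.
  rewrite /cb /h /=; split => [yp|/eqP].
    by apply/max_l; rewrite addrC subr_le0.
  by rewrite eq_maxl addrC subr_le0.
have hc p : continuous (h p : E -> R^o).
  move=> y; apply: (@continuous_comp _ R^o R^o (fun y : E => `|y - ratpt R p.1|)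
    (fun x : R => Num.max 0 (- p.2.+1%:R^-1 + x))); last exact: max0D_continuous.
  apply: (@continuous_comp _ E R^o (fun y : E => y - ratpt R p.1) (fun y => `|y|)).
    exact: (@cvgB R E E (nbhs y) _ id (fun=> ratpt R p.1) _ _ cvg_id (cvg_cst _)).
  exact: norm_continuous.
have -> : [set t | exists y, O y /\ g t y = 0] =
    \bigcup_(p in [set p | cb p `<=` O]) [set t | exists y, g t y + h p y = 0].
  apply/seteqP; split => t /=.
  - move=> [y [Oy gy]].
    have /nbhs_ballP[r /= r0 hr] : nbhs y O by exact: open_nbhs_nbhs.
    have [i ir] := small_ratio (divr_gt0 r0 (ltr0n R 2)).
    have i0 : (0 : R) < i.+1%:R^-1 by rewrite invr_gt0.
    have [q qy] := ratpt_dense y i0.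
    exists (q, i) => /=.
      move=> z qz; apply: hr; rewrite -ball_normE /ball_ /=.
      rewrite -(subrKA (ratpt R q)); apply: le_lt_trans (ler_normD _ _) _.
      rewrite (splitr r) ltrD//; first exact: lt_trans ir.
      by rewrite distrC; apply: le_lt_trans ir.
    by exists y; rewrite gy add0r; apply/hcb/ltW.
  - move=> [p pO [y /eqP]].
    rewrite paddr_eq0//; last exact: le_trans (gs t y).
    by move=> /andP[/eqP gy /eqP hy]; exists y; split => //; apply/pO/hcb.
apply: countable_bigcup_measurable => p _; apply: exists_zero_measurableT.
  by apply: caratheodory_add => //; exact: caratheodory_cst.
by move=> t y; apply: le_trans (gs t y) _; rewrite lerDl.
Qed.

End Caratheodory.

Section InfimumOverBody.
Variables (R : realType) (d : nat).
Notation E := 'rV[R]_(d.+1).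
Variable q : E -> E -> R.
Hypothesis q_continuous : forall y, continuous (q ^~ y : E -> R^o).
Variables (C : R) (B : E -> R).
Hypothesis q_lipschitz : forall z x y, sphere z -> q z x <= q z y + C * `|x - y|.
Hypothesis q_bounded : forall z y, sphere z -> B y <= q z y.

Definition body_inf (K : sconvex R d) (y : E) : R := inf [set q z y | z in body K].

Let has_inf_q (K : sconvex R d) y : has_inf [set q z y | z in body K].
Proof.
split; first by have [z Kz] := body_nonempty K; exists (q z y), z.
by exists (B y) => _ [z /body_sphere sz <-]; exact: q_bounded.
Qed.

Lemma body_inf_lt K y c : body_inf K y < c <-> exists2 z, body K z & q z y < c.
Proof.
split => [|[z Kz]]; first by case/(inf_lt (has_inf_q K y).1) => _ [z Kz <-]; exists z.
by apply: le_lt_trans; apply: ge_inf; [exact: (has_inf_q K y).2|exists z].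
Qed.

Lemma body_inf_le K y z : body K z -> body_inf K y <= q z y.
Proof. by move=> Kz; apply: ge_inf; [exact: (has_inf_q K y).2|exists z]. Qed.

Lemma le_body_inf K y c : (forall z, body K z -> c <= q z y) -> c <= body_inf K y.
Proof.
move=> h; apply: lb_le_inf; first exact: (has_inf_q K y).1.
by move=> _ [z Kz <-]; exact: h.
Qed.

Lemma body_inf_lipschitz K x y : body_inf K x <= body_inf K y + C * `|x - y|.
Proof.
rewrite -lerBlDr; apply: lb_le_inf; first exact: (has_inf_q K y).1.
move=> _ [z Kz <-]; rewrite lerBlDr; apply: le_trans (q_lipschitz _ _ (body_sphere Kz)).
by apply: ge_inf; [exact: (has_inf_q K x).2|exists z].
Qed.

(** The Lipschitz bound in [y] is uniform over the body and passes to the infimum. For fixed [y],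
    the infimum is below [c] exactly when the body hits the open set of [z] with [q z y < c], a
    Borel event. *)
Lemma body_inf_caratheodory :
  caratheodory (body_inf : borel_sconvex R d -> E -> R).
Proof.
split => [K y|y].
  move=> A /nbhs_ballP[e /= e0 eA].
  have C0 : 0 < `|C| + 1 by rewrite ltr_wpDl.
  apply/nbhs_ballP; exists (e / (`|C| + 1)) => /=; first by rewrite divr_gt0.
  move=> x; rewrite -ball_normE /ball_ /= ltr_pdivlMr// => yx.
  apply: eA; rewrite -ball_normE /ball_ /=.
  apply: le_lt_trans yx; rewrite mulrC.
  have CC : C * `|y - x| <= (`|C| + 1) * `|y - x|.
    by rewrite ler_wpM2r// (le_trans (ler_norm _))// lerDl.
  have h1 := body_inf_lipschitz K y x.
  have h2 := body_inf_lipschitz K x y; rewrite (distrC x) in h2.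
  rewrite ler_norml; apply/andP; split; lra.
move=> mT; apply: (measurability _ (RGenInftyO.measurableE R)) => //.
move=> _ [_ [c ->] <-]; rewrite setTI.
rewrite (_ : _ @^-1` _ = hits [set z | q z y < c]).
  apply: measurable_hits.
  have h : continuous (q ^~ y : E -> R^o) by exact: q_continuous.
  by apply: (@open_comp E R^o (q ^~ y) [set x : R | x < c]) => [z _|]; [exact: h|exact: (@open_lt R c)].
apply/seteqP; split => K /=; rewrite in_itv /=.
  by move=> /body_inf_lt[z Kz zc]; exists z.
by move=> [z [Kz zc]]; apply/body_inf_lt; exists z.
Qed.

End InfimumOverBody.

Section BodyFunctions.
Variables (R : realType) (d : nat).
Notation E := 'rV[R]_(d.+1).
Implicit Types (K L : sconvex R d) (O : set E).

Definition body_dist : sconvex R d -> E -> R := body_inf (fun z y : E => `|y - z|).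

(** This is the supremum of [|dot z u|] over the body, written as an infimum so that
    [body_inf_caratheodory] applies; it vanishes exactly when [u] is orthogonal to [K]. *)
Definition body_perp K (u : E) : R := - body_inf (fun z u : E => - `|dot z u|) K u.

Lemma body_dist_caratheodory :
  caratheodory (body_dist : borel_sconvex R d -> E -> R).
Proof.
apply: (@body_inf_caratheodory R d _ _ 1 (fun=> 0)) => //.
- move=> y z; apply: (@continuous_comp _ E R^o (fun z : E => y - z) (fun y => `|y|)).
    exact: (@cvgB R E E (nbhs z) _ (fun=> y) id _ _ (cvg_cst _) cvg_id).
  exact: norm_continuous.
- by move=> z x y _; rewrite mul1r; have := ler_normD (x - y) (y - z); rewrite subrKA [leRHS]addrC.
Qed.

Lemma body_dist_ge0 K y : 0 <= body_dist K y.
Proof. by apply: (le_body_inf (B := fun=> 0)). Qed.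

Lemma body_dist_eq0 K y : body_dist K y = 0 <-> body K y.
Proof.
split => [y0|Ky].
  have /closure_id -> := @body_closed _ _ K.
  move=> A /nbhs_ballP[r /= r0 rA].
  have [z Kz yz] : exists2 z, body K z & `|y - z| < r.
    apply/(@body_inf_lt R d (fun z y : E => `|y - z|) (fun=> 0)) => //.
    by rewrite -/(body_dist K y) y0.
  by exists z; split => //; apply: rA; rewrite -ball_normE.
apply/eqP; rewrite eq_le body_dist_ge0 andbT.
have := @body_inf_le R d (fun z y : E => `|y - z|) (fun=> 0) _ K y y Ky.
by rewrite subrr normr0; apply.
Qed.

Let perp_bound z y : @sphere R d z -> - (d.+1%:R * `|y|) <= - `|dot z y|.
Proof.
move=> /sphere_norm z1; rewrite lerN2; apply: le_trans (dot_le_norm _ _) _.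
by rewrite ler_wpM2r// -[leRHS]mulr1 ler_wpM2l.
Qed.

Lemma body_perp_caratheodory :
  caratheodory (body_perp : borel_sconvex R d -> E -> R).
Proof.
apply: (@caratheodory_comp _ _ _ _ _ (-%R)); first exact: opp_continuous.
apply: (@body_inf_caratheodory R d _ _ d.+1%:R (fun y => - (d.+1%:R * `|y|))) => //.
- move=> y z; have -> : (fun z => - `|dot z y|) = (fun z => - `|dot y z|).
    by apply/funext => ?; rewrite dotC.
  apply: (@continuous_comp _ R^o R^o (dot y) (fun x => - `|x|)); first exact: dot_continuous.
  apply: (@continuous_comp _ R^o R^o (fun x => `|x|) -%R); first exact: norm_continuous.
  exact: opp_continuous.
- move=> z x y sz; rewrite -lerBlDl opprK.
  have h1 := ler_normD (dot z x) (dot z (y - x)).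
  rewrite -dotDr subrKC in h1.
  have := le_trans (dot_le_norm z (y - x)) (ler_wpM2r (normr_ge0 _) (ler_wpM2l (ler0n _ _) (sphere_norm sz))).
  rewrite mulr1 (distrC y) => h2; lra.
Qed.

Lemma body_perp_ge0 K u : 0 <= body_perp K u.
Proof.
rewrite oppr_ge0; have [z Kz] := body_nonempty K.
apply: le_trans (body_inf_le (B := (fun y => - (d.+1%:R * `|y|))) perp_bound u Kz) _.
by rewrite oppr_le0.
Qed.

Lemma body_perp_eq0 K u : body_perp K u = 0 <-> forall z, body K z -> dot z u = 0.
Proof.
split => [/eqP u0 z Kz|h]; apply/eqP.
  move: u0; rewrite oppr_eq0 => /eqP u0.
  have := body_inf_le (B := (fun y => - (d.+1%:R * `|y|))) perp_bound u Kz.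
  by rewrite u0 oppr_ge0 normr_le0.
rewrite eq_le body_perp_ge0 andbT oppr_le0.
apply: (le_body_inf (B := fun y => - (d.+1%:R * `|y|))) => // z Kz.
by rewrite h// normr0 oppr0.
Qed.

End BodyFunctions.

Section SetValued.
Context d0 (T : measurableType d0) (R : realType) (d : nat).
Notation E := 'rV[R]_(d.+1).
Variable F : T -> set E.
Hypothesis F_convex : forall t, sph_convex (F t) \/ F t = set0.
Hypothesis F_hits : forall O : set E, open O -> measurable [set t | F t `&` O !=set0].

Let F0 t : F t !=set0 -> sph_convex (F t).
Proof. by case: (F_convex t) => // -> [? []]. Qed.

(** Empty values of [F] are not bodies; they are replaced by the default [point], which is the whole
    sphere. *)
Definition body_of (t : T) : borel_sconvex R d :=
  match pselect (F t !=set0) with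
  | left h => SConvex (F0 h)
  | right _ => point
  end.

Lemma body_ofE t : F t !=set0 -> body (body_of t) = F t.
Proof. by rewrite /body_of; case: pselect. Qed.

Lemma measurable_nonempty : measurable [set t | F t !=set0].
Proof.
rewrite (_ : [set t | _] = [set t | F t `&` setT !=set0]); first exact/F_hits/openT.
by apply/seteqP; split => t /=; rewrite setIT.
Qed.

Lemma measurable_body_of : measurable_fun setT body_of.
Proof.
apply: measurable_to_sconvex => // p; rewrite setTI.
have -> : [set t | hits_ball p (body_of t)] =
    ([set t | F t `&` ratball p !=set0]) `|`
    (~` [set t | F t !=set0] `&` [set t | hits_ball p (point : sconvex R d)]).
  apply/seteqP; split => t; rewrite /setU /setI /setC /=.
    rewrite /body_of; case: pselect => [h|h] /= hp; first by left.
    by right.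
  case=> [[x [Fx px]]|[h]].
    have Fn : F t !=set0 by exists x.
    by exists x; split => //; rewrite body_ofE.
  by rewrite /body_of; case: pselect.
apply: measurableU; first exact/F_hits/ratball_open.
apply: measurableI; first exact/measurableC/measurable_nonempty.
case: (pselect (hits_ball p (point : sconvex R d))) => h.
  by rewrite (_ : [set t | _] = setT)//; apply/seteqP; split.
by rewrite (_ : [set t | _] = set0)//; apply/seteqP; split.
Qed.

(** Members of [A] are nonempty, so the event lies inside the measurable set where [F t] is
    nonempty, and there [body_of] carries the same points as [F]. *)
Lemma measurable_body_in (A : set (borel_sconvex R d)) : measurable A ->
  measurable [set t | (@body R d @` A) (F t)].
Proof.
move=> mA.
have -> : [set t | (@body R d @` A) (F t)] = [set t | F t !=set0] `&` (body_of @^-1` A).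
  apply/seteqP; split => t /=.
    move=> [K AK KF]; have Fn : F t !=set0 by rewrite -KF; exact: body_nonempty.
    split => //; rewrite (_ : body_of t = K)//.
    by apply: sconvexP; rewrite body_ofE.
  by move=> [Fn At]; exists (body_of t) => //; rewrite body_ofE.
apply: measurableI; first exact: measurable_nonempty.
by rewrite -[X in measurable X]setTI; exact: measurable_body_of.
Qed.

End SetValued.

(** * Cells of an arrangement *)

Section Cones.
Variables (R : realType) (d : nat).
Notation E := 'rV[R]_(d.+1).
Implicit Types (C L : set E) (u v : E).

Lemma cone_section C : closed_convex_cone C ->
  sph_convex (C `&` @sphere R d) \/ C `&` @sphere R d = set0.
Proof.
move=> cC; have [C0|Cn0] := pselect (C = [set 0]); last by left; exists C.
right; apply/seteqP; split => // x [] ; rewrite C0 => -> /sphere_neq0.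
by rewrite eqxx.
Qed.

Lemma closed_convex_coneI (I : Type) (P : I -> set E) :
  (forall i, closed_convex_cone (P i)) -> closed_convex_cone (\bigcap_i P i).
Proof.
move=> cP; split.
- by apply: closed_bigI => i _; case: (cP i).
- move=> x y l; rewrite !inE => xP yP i _.
  case: (cP i) => _ cv _ _; apply/set_mem/cv; apply/mem_set; [exact: xP|exact: yP].
- by move=> i _; case: (cP i).
- by move=> t x t0 xP i _; case: (cP i) => _ _ _; apply => //; exact: xP.
Qed.

Lemma halfspace_cone u : closed_convex_cone [set y : E | 0 <= dot u y].
Proof.
split.
- apply: (@closed_comp E R^o (dot u) [set x : R | 0 <= x]); last exact: closed_ge.
  by move=> x _; exact: dot_continuous.
- move=> x y l; rewrite !inE /= => x0 y0.
  have := dotDr u (l%:num *: x) ((1 - l%:num) *: y); rewrite !dotZr => h.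
  by rewrite [X in 0 <= X]h addr_ge0// mulr_ge0// ?subr_ge0.
- by rewrite /= dot0r.
- by move=> t x t0 /= x0; rewrite dotZr mulr_ge0.
Qed.

Lemma closed_convex_coneI2 C D : closed_convex_cone C -> closed_convex_cone D ->
  closed_convex_cone (C `&` D).
Proof.
move=> cC cD.
rewrite (_ : C `&` D = \bigcap_b (if b then C else D)).
  by apply: closed_convex_coneI => -[].
apply/seteqP; split => [x [Cx Dx] []//|x h].
by split; [exact: (h true)|exact: (h false)].
Qed.

Lemma hyperplane_cone u : closed_convex_cone [set y : E | dot u y = 0].
Proof.
rewrite (_ : [set y | _] = [set y | 0 <= dot u y] `&` [set y | 0 <= dot (- u) y]).
  by apply: closed_convex_coneI2; exact: halfspace_cone.
apply/seteqP; split => y /=; rewrite dotNl oppr_ge0; first by move=> ->.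
by move=> [h1 h2]; apply/eqP; rewrite eq_le h1 h2.
Qed.

(** The value [true] of [s j] selects the negative side of the hyperplane of [v j]. *)
Definition halfspaces (m : nat) (v : 'I_m -> E) (s : {ffun 'I_m -> bool}) : set E :=
  [set y | forall j, 0 <= (-1) ^+ s j * dot (v j) y].

Definition open_halfspaces (m : nat) (v : 'I_m -> E) (s : {ffun 'I_m -> bool}) : set E :=
  [set y | forall j, 0 < (-1) ^+ s j * dot (v j) y].

Lemma halfspaces_cone m (v : 'I_m -> E) s : closed_convex_cone (halfspaces v s).
Proof.
rewrite (_ : halfspaces v s = \bigcap_j [set y | 0 <= dot ((-1) ^+ s j *: v j) y]).
  by apply: closed_convex_coneI => j; exact: halfspace_cone.
by apply/seteqP; split => [y h j _|y h j]; have := h j; rewrite /= dotZl// => /(_ I).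
Qed.

Definition cell L (m : nat) (v : 'I_m -> E) s : set E := L `&` halfspaces v s.

Definition realizable L (m : nat) (v : 'I_m -> E) s : Prop :=
  L `&` open_halfspaces v s !=set0.

Lemma cell_convex (K : sconvex R d) m (v : 'I_m -> E) s :
  sph_convex (cell (body K) v s) \/ cell (body K) v s = set0.
Proof.
have [C [cC _ ->]] := bodyP K.
rewrite /cell setIAC; apply: cone_section; apply: closed_convex_coneI2 => //.
exact: halfspaces_cone.
Qed.

Definition perp_set (I : Type) (u : I -> E) : set E := [set y | forall i, dot (u i) y = 0].

Lemma perp_convex (I : Type) (u : I -> E) :
  sph_convex (perp_set u `&` @sphere R d) \/ perp_set u `&` @sphere R d = set0.
Proof.
apply: cone_section.
rewrite (_ : perp_set u = \bigcap_i [set y | dot (u i) y = 0]).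
  by apply: closed_convex_coneI => i; exact: hyperplane_cone.
by apply/seteqP; split => [y h i _|y h i]; [exact: h|exact: (h i Logic.I)].
Qed.

(** Sign vectors are counted instead of sets, so that the number is a finite sum of indicators;
    [cell_inj] shows that this counts each cell once. *)
Definition numcells L (m : nat) (v : 'I_m -> E) (A : set (sconvex R d)) : nat :=
  #|[pred s | `[< realizable L v s /\ (@body R d @` A) (cell L v s) >]]|.

Lemma measurable_dot (y : E) :
  measurable_fun setT (fun u : borel_euclid R d => dot (u : E) y).
Proof.
move=> mT; apply: (measurability _ (RGenInftyO.measurableE R)) => //.
move=> _ [_ [c ->] <-]; rewrite setTI; apply: sub_sigma_algebra.
rewrite (_ : _ @^-1` _ = dot y @^-1` [set x | x < c]); last first.
  by apply/seteqP; split => u /=; rewrite in_itv /= dotC.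
by apply: (@open_comp E R^o (dot y)); [move=> x _; exact: dot_continuous|exact: (@open_lt R c)].
Qed.

End Cones.

Section CellMeasurability.
Context d0 (T : measurableType d0) (R : realType) (d : nat).
Notation E := 'rV[R]_(d.+1).
Implicit Types (O : set E).

Lemma dot_caratheodory (v : T -> borel_euclid R d) : measurable_fun setT v ->
  caratheodory (fun t (y : E) => dot (v t : E) y).
Proof.
move=> mv; split => [t|y]; first exact: dot_continuous.
exact: (measurableT_comp (measurable_dot y) mv).
Qed.

Lemma caratheodory_compT d1 (T1 : measurableType d1) (f : T -> T1) (g : T1 -> E -> R) :
  measurable_fun setT f -> caratheodory g -> caratheodory (fun t => g (f t)).
Proof.
move=> mf [gc gm]; split => [t|y]; first exact: gc.
exact: (measurableT_comp (gm y) mf).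
Qed.

(** All constraints are packed into one penalty: [|dot y y - 1|] plus the negative parts of the
    [h i]. Its zeros are the solutions, and its first summand confines them as
    [exists_zero_measurable] demands. *)
Lemma measurable_exists_sphere (J : finType) (h : J -> T -> E -> R) O :
  (forall i, caratheodory (h i)) -> open O ->
  measurable [set t | exists y, [/\ O y, sphere y & forall i, 0 <= h i t y]].
Proof.
move=> hC oO.
pose g t (y : E) := `|dot y y - 1| + \sum_i Num.max 0 (0 + - h i t y).
have -> : [set t | exists y, [/\ O y, sphere y & forall i, 0 <= h i t y]] =
    [set t | exists y, O y /\ g t y = 0].
  have s0 t y : 0 <= \sum_i Num.max 0 (0 + - h i t y).
    by apply: sumr_ge0 => i _; rewrite le_max lexx.
  apply/seteqP; split => t /= [y].
    move=> [Oy sy hy]; exists y; split => //.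
    rewrite /g sy subrr normr0 add0r big1// => i _.
    by apply/max_l; rewrite add0r oppr_le0.
  move=> [Oy /eqP]; rewrite paddr_eq0// => /andP[/eqP/normr0P].
  rewrite subr_eq0 => /eqP sy; rewrite psumr_eq0; last by move=> i _; rewrite le_max lexx.
  move=> /allP hy; exists y; split => // i.
  by have := hy i (mem_index_enum _); rewrite eq_maxl add0r oppr_le0.
apply: exists_zero_measurable => //; last first.
  by move=> t y; rewrite lerDl sumr_ge0// => i _; rewrite le_max lexx.
apply: caratheodory_add.
  apply: (@caratheodory_cst _ _ _ _ (fun y : E => `|dot y y - 1|)).
  move=> y; apply: (@continuous_comp _ R^o R^o (fun y : E => dot y y - 1) (fun x => `|x|)).
    apply: (@cvgB R R^o E (nbhs y) _ (fun y : E => dot y y) (fun=> 1) _ _ _ (cvg_cst _)).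
    exact: dot_diag_continuous.
  exact: norm_continuous.
apply: caratheodory_sum => i.
apply: (@caratheodory_comp _ _ _ _ _ (fun x => Num.max 0 (0 + x))).
  exact: max0D_continuous.
apply: (@caratheodory_comp _ _ _ _ _ (-%R)); first exact: opp_continuous.
exact: hC.
Qed.

(** Membership in the random body becomes one more inequality, [0 <= - body_dist (L t) y], indexed
    by [None]. *)
Lemma measurable_exists_body (L : T -> borel_sconvex R d) (J : finType)
    (h : J -> T -> E -> R) O : measurable_fun setT L ->
  (forall i, caratheodory (h i)) -> open O ->
  measurable [set t | exists y, [/\ O y, body (L t) y & forall i, 0 <= h i t y]].
Proof.
move=> mL hC oO.
pose h' (i : option J) t y := if i is Some i then h i t y else - body_dist (L t) y.
have := @measurable_exists_sphere (option J) h' O.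
have -> : [set t | exists y, [/\ O y, sphere y & forall i, 0 <= h' i t y]] =
    [set t | exists y, [/\ O y, body (L t) y & forall i, 0 <= h i t y]].
  apply/seteqP; split => t /= [y [Oy Ly hy]]; exists y; split => //.
  - apply/body_dist_eq0/eqP; rewrite eq_le body_dist_ge0 andbT -oppr_ge0.
    exact: (hy None).
  - by move=> i; exact: (hy (Some i)).
  - exact: body_sphere Ly.
  - by case=> [i|] /=; [exact: hy|have /body_dist_eq0 -> := Ly; rewrite oppr0].
apply => // -[i|] //=; first exact: hC.
apply: (@caratheodory_comp _ _ _ _ _ (-%R)); first exact: opp_continuous.
exact: (caratheodory_compT mL (@body_dist_caratheodory R d)).
Qed.

Section Cells.
Variables (L : T -> borel_sconvex R d) (m : nat) (v : T -> 'I_m -> borel_euclid R d).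
Hypothesis mL : measurable_fun setT L.
Hypothesis mv : forall j, measurable_fun setT (fun t => v t j).

Lemma signed_dot_caratheodory (b : bool) (c : R) j :
  caratheodory (fun t (y : E) => (-1) ^+ b * dot (v t j : E) y - c).
Proof.
apply: (@caratheodory_comp _ _ _ _ _ (fun x => (-1) ^+ b * x - c)).
  move=> x; apply: (@cvgB R R^o R^o (nbhs x) _ (fun x => (-1) ^+ b * x) (fun=> c) _ _ _ (cvg_cst _)).
  exact: mulrl_continuous.
exact: dot_caratheodory.
Qed.

Lemma measurable_exists_cell (c : R) (s : {ffun 'I_m -> bool}) O : open O ->
  measurable [set t | exists y, [/\ O y, body (L t) y &
     forall j, c <= (-1) ^+ s j * dot (v t j : E) y]].
Proof.
move=> oO.
have := @measurable_exists_body L 'I_m (fun j t y => (-1) ^+ s j * dot (v t j : E) y - c) O mL.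
have -> : [set t | exists y : E, [/\ O y, body (L t) y &
      forall j, 0 <= (-1) ^+ s j * dot (v t j : E) y - c]] =
    [set t | exists y, [/\ O y, body (L t) y &
     forall j, c <= (-1) ^+ s j * dot (v t j : E) y]].
  apply/seteqP; split => t /= [y [Oy Ly hy]]; exists y; split => // j.
    by rewrite -subr_ge0.
  by rewrite subr_ge0.
by apply => // j; exact: signed_dot_caratheodory.
Qed.

Lemma measurable_cell_in s (A : set (borel_sconvex R d)) : measurable A ->
  measurable [set t | (@body R d @` A) (cell (body (L t)) (v t) s)].
Proof.
apply: measurable_body_in => [t|O oO]; first exact: cell_convex.
rewrite (_ : [set t | _] = [set t | exists y, [/\ O y, body (L t) y &
     forall j, 0 <= (-1) ^+ s j * dot (v t j : E) y]]).
  exact: measurable_exists_cell.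
by apply/seteqP; split => t /= [y]; [move=> [[Ly hy] Oy]|move=> [Oy Ly hy]]; exists y.
Qed.

(** Finitely many strict inequalities hold with a common margin of the form [1 / (i + 1)], so the
    event is a countable union of events with closed constraints. *)
Lemma measurable_realizable s : measurable [set t | realizable (body (L t)) (v t) s].
Proof.
rewrite (_ : [set t | _] = \bigcup_i [set t | exists y, [/\ setT y, body (L t) y &
     forall j, i.+1%:R^-1 <= (-1) ^+ s j * dot (v t j : E) y]]).
  by apply: bigcupT_measurable => i; apply: measurable_exists_cell; exact: openT.
apply/seteqP; split => t /=; last first.
  move=> [i _ [y [_ Ly hy]]]; exists y; split => // j.
  by apply: lt_le_trans (hy j); rewrite invr_gt0.
move=> [y [Ly hy]].
have h j : exists i : nat, i.+1%:R^-1 < (-1) ^+ s j * dot (v t j : E) y.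
  exact: small_ratio.
have [f hf] := choice h.
exists (\max_j f j)%N => //; exists y; split => // j.
apply: le_trans (ltW (hf j)).
by rewrite lef_pV2 ?posrE// ler_nat ltnS leq_bigmax.
Qed.

Lemma measurable_numcells (A : set (borel_sconvex R d)) : measurable A ->
  measurable_fun setT (fun t => (numcells (body (L t)) (v t) A)%:R : R).
Proof.
move=> mA.
pose B s := [set t | realizable (body (L t)) (v t) s] `&`
            [set t | (@body R d @` A) (cell (body (L t)) (v t) s)].
have -> : (fun t => (numcells (body (L t)) (v t) A)%:R : R) =
    (fun t => \sum_s \1_(B s) t).
  apply/funext => t; rewrite /numcells -sum1_card natr_sum.
  rewrite (big_mkcond (fun s => s \in _))/=; apply: eq_bigr => s _.
  rewrite indicE inE; case: ifPn; last first.
    by move=> /asboolPn h; rewrite memNset//; move=> [h1 h2]; apply: h.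
  by move=> /asboolP h; rewrite mem_set.
apply: measurable_sum => s; apply: measurable_indic; apply: measurableI.
  exact: measurable_realizable.
exact: measurable_cell_in.
Qed.

End Cells.

End CellMeasurability.

(** * Tessellations, sections and faces *)

Section Regions.
Variables (R : realType) (d : nat).
Notation E := 'rV[R]_(d.+1).
Implicit Types (u v x y w : E).

Lemma small_perturb (I : finType) (a b : I -> R) : (forall i, 0 < a i) ->
  exists2 e : R, 0 < e & forall i, 0 < a i + e * b i.
Proof.
(* The sum dominates every ratio [|b i| / a i], so the step [1 / (1 + S)] is short enough for all
   indices at once. *)
move=> a0; pose S := \sum_i `|b i| / a i.
have t0 i : 0 <= `|b i| / a i by rewrite divr_ge0// ltW.
have S0 : 0 < 1 + S by rewrite ltr_wpDr// sumr_ge0.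
exists (1 + S)^-1; first by rewrite invr_gt0.
move=> i; have h : `|b i| / a i < 1 + S.
  rewrite /S (bigD1 i)//= addrCA ltrDl ltr_wpDr// sumr_ge0//.
have h2 : (1 + S)^-1 * `|b i| < a i.
  by rewrite ltr_pdivrMl// -ltr_pdivrMr.
have h3 : - ((1 + S)^-1 * b i) <= (1 + S)^-1 * `|b i|.
  rewrite -mulrN; apply: ler_wpM2l; first by rewrite invr_ge0; exact: ltW.
  by rewrite -normrN ler_norm.
by rewrite -ltrBlDr sub0r; exact: le_lt_trans h2.
Qed.

Lemma signed_dot_continuous (c : R) u : continuous ((fun y => c * dot u y) : E -> R^o).
Proof.
have -> : (fun y => c * dot u y) = dot (c *: u) by apply/funext => y; rewrite dotZl.
exact: dot_continuous.
Qed.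

Lemma curve_near x w (Q : set E) : sphere x -> nbhs x Q ->
  exists2 e0 : R, 0 < e0 & forall e, 0 <= e < e0 ->
    x + e *: w != 0 /\ Q (normalize (x + e *: w)).
Proof.
move=> sx nQ.
have x0 := sphere_neq0 sx.
have nQ' : nbhs x [set z | z != 0 /\ Q (normalize z)].
  apply: filterI; first exact: nbhs_neq0.
  by apply: normalize_continuous => //; rewrite /= normalize_id.
have /nbhs_ballP[r /= r0 rQ] := nQ'.
exists (r / (1 + `|w|)); first by rewrite divr_gt0// ltr_wpDr.
move=> e /andP[e0]; rewrite ltr_pdivlMr ?ltr_wpDr// => er.
apply: (rQ (x + e *: w)); rewrite -ball_normE /ball_ /= opprD addNKr normrN normrZ ger0_norm//.
apply: le_lt_trans er; rewrite ler_wpM2l// lerDr//.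
Qed.

(** The arc is the normalized chord, which misses the origin unless the endpoints are antipodal. Its
    points are nonnegative combinations of [x] and [y], hence stay in every open half-space that
    contains both. *)
Lemma sphere_arc x y : sphere x -> sphere y -> y != - x ->
  exists C : set E, [/\ connected C, C x, C y & C `<=` [set z | sphere z /\
    exists a b : R, [/\ 0 <= a, 0 <= b, 0 < a + b & z = a *: x + b *: y]]].
Proof.
move=> sx sy yx; pose p (t : R) := x + t *: (y - x).
have p0 t : 0 <= t <= 1 -> p t != 0.
  move=> /andP[t0 t1]; apply/eqP => pt0.
  (* If the chord met the origin, comparing lengths would force [t = 1 / 2], and then [y = - x]. *)
  have /(congr1 (fun z => dot z z)) : (1 - t) *: x = - (t *: y).
    apply/eqP; rewrite -subr_eq0 opprK -[X in _ == X]pt0 /p; apply/eqP/rowP => i.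
    by rewrite !mxE; ring.
  rewrite -scaleNr !dotZ sx sy !mulr1 => h.
  have th : t = 2^-1.
    move: h; rewrite sqrrN => h; nra.
  move: pt0; rewrite /p th => /(congr1 (fun z => 2 *: z)).
  rewrite scalerDr scalerA divff// scale1r scaler0 -[2]/(1 + 1) scalerDl scale1r.
  rewrite -addrA subrKC => /eqP; rewrite addrC addr_eq0 => /eqP yNx.
  by rewrite yNx eqxx in yx.
exists ((fun t => normalize (p t)) @` `[0, 1]); split.
- apply: connected_continuous_connected; first exact: segment_connected.
  apply: continuous_in_subspaceT => t /set_mem; rewrite /= in_itv /= => t01.
  apply: (@continuous_comp _ _ _ p (@normalize R d)); last first.
    by apply: normalize_continuous; exact: p0.
  apply: (@cvgD R E R^o (nbhs t) _ (fun=> x) (fun t => t *: (y - x)) _ _ (cvg_cst _)).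
  exact: (@cvgZr_tmp R E R^o (nbhs t) _ id t (y - x) cvg_id).
- exists 0; first by rewrite /= in_itv /= lexx ler01.
  by rewrite /p scale0r addr0 normalize_id.
- exists 1; first by rewrite /= in_itv /= lexx ler01.
  by rewrite /p scale1r subrKC normalize_id.
- move=> _ [t + <-]; rewrite /= in_itv /= => t01.
  have pt := p0 _ t01; split; first exact: normalize_sphere.
  have c0 := normalize_gt0 pt; set c := (X in 0 < X) in c0.
  move: t01 => /andP[t0 t1].
  exists (c * (1 - t)), (c * t); split.
  + by rewrite mulr_ge0 ?subr_ge0// ltW.
  + by rewrite mulr_ge0// ltW.
  + by rewrite -mulrDr subrK mulr1.
  + rewrite /normalize -/c /p -!scalerA -scalerDr; congr (_ *: _).
    by apply/rowP => i; rewrite !mxE; ring.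
Qed.

Lemma sphere_third x : (0 < d)%N -> sphere x ->
  exists z : E, [/\ sphere z, z != x & z != - x].
Proof.
move=> d0 sx; pose e (i : 'I_d.+1) : E := delta_mx 0 i.
have de i j : dot (e i) (e j) = (i == j)%:R.
  rewrite dotE (bigD1 i)//= !mxE !eqxx/= mul1r big1 ?addr0 ?[j == i]eq_sym 1?eq_sym//.
  by move=> k ki; rewrite !mxE (negbTE ki)/= mul0r.
have se i : sphere (e i) by rewrite /sphere /= de eqxx.
have [e0x|e0x] := boolP ((e ord0 == x) || (e ord0 == - x)); last first.
  by exists (e ord0); rewrite negb_or in e0x; case/andP: e0x; split.
have e01 : dot (e ord0) (e ord_max) = 0.
  by rewrite de -val_eqE /= eq_sym (gtn_eqF d0).
have d1x : dot x (e ord_max) = 0.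
  case/orP: e0x => /eqP e0; first by rewrite -e0.
  by rewrite -[x]opprK -e0 dotNl e01 oppr0.
exists (e ord_max); split => //; apply/eqP => ex; move: d1x; rewrite ex ?dotNr sx => /eqP.
  by rewrite oner_eq0.
by rewrite oppr_eq0 oner_eq0.
Qed.

Section Arrangement.
Variables (m : nat) (v : 'I_m -> E).
Implicit Types (s : {ffun 'I_m -> bool}).

Definition region s : set E := @sphere R d `&` open_halfspaces v s.

Lemma open_halfspaces_comb s x y (a b : R) : open_halfspaces v s x ->
  open_halfspaces v s y -> 0 <= a -> 0 <= b -> 0 < a + b ->
  open_halfspaces v s (a *: x + b *: y).
Proof.
move=> hx hy a0 b0 ab j; rewrite dotDr !dotZr mulrDr !(mulrCA ((-1) ^+ _)).
have := hx j; have := hy j; set p := _ * dot _ y; set q := _ * dot _ x => p0 q0.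
apply: (@lt_le_trans _ _ ((a + b) * Num.min q p)).
  by rewrite mulr_gt0// lt_min q0.
by rewrite mulrDl lerD// ler_wpM2l// ge_min lexx// orbT.
Qed.

Lemma region_sub_complement s :
  region s `<=` @sphere R d `\` \bigcup_j orth_sphere (v j).
Proof.
move=> x [sx hx]; split => //; case=> j _ [/= vx _].
by have := hx j; rewrite vx mulr0 ltxx.
Qed.

(** Non-antipodal points are joined by an arc. Antipodal points satisfy the same strict inequalities
    only if there are none; the region is then the whole sphere, and a third point serves as a
    relay. This is where [0 < d] enters, since the 0-sphere is disconnected. *)
Lemma region_connected s x y : (0 < d)%N -> region s x -> region s y ->
  exists C, [/\ connected C, C x, C y & C `<=` region s].
Proof.
move=> d0.
have near_ a b : region s a -> region s b -> b != - a ->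
    exists C, [/\ connected C, C a, C b & C `<=` region s].
  move=> [sa ha] [sb hb] ba.
  have [C [cC Ca Cb CS]] := sphere_arc sa sb ba.
  exists C; split => // z /CS[sz [p [q [p0 q0 pq zE]]]]; split => //.
  by rewrite zE; exact: open_halfspaces_comb.
move=> rx ry; have [yNx|] := eqVneq y (- x); last exact: near_.
have vac z : open_halfspaces v s z.
  move=> j; have := (rx.2 j); have := (ry.2 j).
  by rewrite yNx dotNr mulrN oppr_gt0 => /lt_trans h /h; rewrite ltxx.
have [z [sz zx zNx]] := sphere_third d0 rx.1.
have rz : region s z by split.
have [C [cC Cx Cz CS]] := near_ _ _ rx rz zNx.
have [|D [cD Dz Dy DS]] := near_ _ _ rz ry; first by rewrite yNx eqr_opp eq_sym.
exists (C `|` D); split; [|by left|by right|by move=> w [/CS|/DS]].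
by apply: connectedU => //; exists z.
Qed.

(** The component cannot leave the region: along a connected set a sign change of [dot (v j)]
    produces a zero, that is, a point of a hypersphere. *)
Lemma region_component s x : (0 < d)%N -> region s x ->
  connected_component (@sphere R d `\` \bigcup_j orth_sphere (v j)) x = region s.
Proof.
move=> d0 rx; apply/seteqP; split => y; last first.
  move=> ry; have [C [cC Cx Cy CS]] := region_connected d0 rx ry.
  exists C => //; split => //.
  by apply: subset_trans CS _; exact: region_sub_complement.
move=> cy; have cc := @component_connected _ (@sphere R d `\` \bigcup_j orth_sphere (v j)) x.
have cs := @connected_component_sub _ (@sphere R d `\` \bigcup_j orth_sphere (v j)) x.
have cx : connected_component (@sphere R d `\` \bigcup_j orth_sphere (v j)) x x.
  by apply: connected_component_refl; exact: region_sub_complement rx.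
set X := connected_component _ _ in cy cc cs cx.
have [sy ny] := cs _ cy; split => // j; rewrite ltNge; apply/negP => le0.
pose f z : R := (-1) ^+ s j * dot (v j) z.
have fc : continuous (f : E -> R^o) by exact: signed_dot_continuous.
have /connected_intervalP fi : connected (f @` X).
  by apply: connected_continuous_connected => //; apply: continuous_subspaceT.
have fy : (f @` X) (f y) by exists y.
have fx : (f @` X) (f x) by exists x.
have [|z Xz fz0] := fi _ _ fy fx 0; first by rewrite le0 ltW//; exact: rx.2.
have [sz] := cs _ Xz; apply; exists j => //; split => //=.
by move/eqP: fz0; rewrite /f mulf_eq0 signr_eq0/= => /eqP.
Qed.

Lemma cell_closed s : closed (cell (@sphere R d) v s).
Proof.
by apply: closedI; [exact: sphere_closed|case: (halfspaces_cone v s)].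
Qed.

Lemma region_sub_cell s : region s `<=` cell (@sphere R d) v s.
Proof. by move=> x [sx hx]; split => // j; exact: ltW. Qed.

(** A point [y] of the closed cell is approached by the normalized points [(1 - e) *: y + e *: x],
    which satisfy the inequalities strictly because [x] does. *)
Lemma region_closure s x : region s x ->
  closure (region s) = cell (@sphere R d) v s.
Proof.
move=> rx; apply/seteqP; split.
  rewrite [X in _ `<=` X](closure_id _).1; last exact: cell_closed.
  by apply: closureS; exact: region_sub_cell.
move=> y [sy hy] Q nQ.
have [e0 e00 hQ] := curve_near (x - y) sy nQ.
pose e := Num.min (e0 / 2) (1 / 2).
have e1 : 0 < e < 1.
  rewrite lt_min gt_min; apply/andP; split; first by rewrite !divr_gt0.
  by apply/orP; right; lra.
have ee0 : 0 <= e < e0.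
  case/andP: e1 => e1 _; rewrite ltW//= gt_min; apply/orP; left; lra.
have [z0 Qz] := hQ e ee0; exists (normalize (y + e *: (x - y))); split => //.
split; first exact: normalize_sphere.
case/andP: e1 => e10 e11 j; rewrite dotZr mulrCA mulr_gt0 ?normalize_gt0//.
have -> : y + e *: (x - y) = (1 - e) *: y + e *: x.
  by apply/rowP => i; rewrite !mxE; ring.
rewrite dotDr !dotZr mulrDr !(mulrCA ((-1) ^+ _)) ltr_wpDl//.
  by apply: mulr_ge0; [rewrite subr_ge0; exact: ltW|exact: hy].
by rewrite mulr_gt0//; exact: rx.2.
Qed.

Lemma tessellationE : (0 < d)%N ->
  tessellation (fun j => orth_sphere (v j)) =
    [set cell (@sphere R d) v s | s in [set s | realizable (@sphere R d) v s]].
Proof.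
move=> d0; apply/seteqP; split => P.
- move=> [x [sx nx] ->].
  pose s := [ffun j => dot (v j) x < 0].
  have rx : region s x.
    split => // j; rewrite ffunE; have [lt0|ge0] := boolP (dot (v j) x < 0).
      by rewrite expr1 mulN1r oppr_gt0.
    rewrite expr0 mul1r lt_neqAle leNgt ge0 andbT; apply/eqP => vx0.
    by apply: nx; exists j.
  exists s; first by exists x.
  by rewrite (region_component d0 rx) (region_closure rx).
- move=> [s [x rx] <-]; exists x; first exact: region_sub_complement rx.
  by rewrite (region_component d0 rx) (region_closure rx).
Qed.

Lemma open_halfspaces_nbhs s x : open_halfspaces v s x -> nbhs x (open_halfspaces v s).
Proof.
move=> hx; have h j : \forall y \near x, 0 < (-1) ^+ s j * dot (v j) y.
  have fc := @signed_dot_continuous ((-1) ^+ s j) (v j).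
  by apply: (fc x [set r : R | 0 < r]); apply: lt_nbhsr; exact: hx.
by have := filter_forall _ h; apply.
Qed.

(** From a point on the hyperplane of a nonzero [v j], a small step along [- ((-1) ^+ s j *: v j)]
    violates the [j]-th inequality, so such a point is not interior. *)
Lemma sph_interior_cell s : (forall j, v j != 0) ->
  sph_interior (cell (@sphere R d) v s) = region s.
Proof.
move=> v0; apply/seteqP; split => x.
- move=> [sx nx]; split => // j.
  have [_ hx] : cell (@sphere R d) v s x by exact: (nbhs_singleton nx sx).
  rewrite lt_neqAle hx andbT eq_sym; apply/eqP => vx0.
  have [e0 e00 hQ] := curve_near (- ((-1) ^+ s j *: v j)) sx nx.
  have e2 : 0 <= e0 / 2 < e0 by lra.
  have [z0 Qz] := hQ _ e2.
  have [_ /(_ j)] := Qz (normalize_sphere z0).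
  rewrite dotZr mulrCA pmulr_rge0 ?normalize_gt0//.
  move: vx0 => /eqP; rewrite mulf_eq0 signr_eq0/= => /eqP vx0.
  rewrite dotDr vx0 add0r dotZr dotNr dotZr; set S := (-1) ^+ s j; set D := dot _ _.
  have -> : S * (e0 / 2 * - (S * D)) = - (e0 / 2 * D) * (S * S) by ring.
  rewrite -expr2 sqrr_sign mulr1 oppr_ge0 leNgt mulr_gt0//; first by rewrite divr_gt0.
  exact: dot_gt0.
- move=> [sx hx]; split => //.
  have := open_halfspaces_nbhs hx; apply: filterS => y hy sy.
  by split => // j; exact: ltW.
Qed.

Lemma tess_sectionE (L : set E) : (0 < d)%N -> L `<=` @sphere R d ->
  (forall j, v j != 0) ->
  tess_section L (tessellation (fun j => orth_sphere (v j))) =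
    [set cell L v s | s in [set s | realizable L v s]].
Proof.
move=> d0 Ls v0; rewrite tessellationE//; apply/seteqP; split => K.
- move=> [_ [[s _ <-]]]; rewrite sph_interior_cell// => -[x [[sx hx] Lx]] ->.
  exists s; first by exists x.
  by rewrite /cell setIAC (setIidr Ls).
- move=> [s [x [Lx hx]] <-]; exists (cell (@sphere R d) v s); split.
  + by exists s => //; exists x; split => //; exact: Ls.
  + by rewrite sph_interior_cell//; exists x; split => //; split => //; exact: Ls.
  + by rewrite /cell setIAC (setIidr Ls).
Qed.

End Arrangement.
End Regions.

(** * General position *)

Section Orthogonals.
Variables (R : realType) (d : nat).
Notation E := 'rV[R]_(d.+1).
Implicit Types (u w x y : E) (V W : {vspace E}).

Definition orthv u : {vspace E} := lker (linfun (mulmxr u^T : E -> 'M[R]_1)).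

Lemma memv_orthv u x : (x \in orthv u) = (dot u x == 0).
Proof.
rewrite memv_ker lfunE /= dotC /dot; apply/eqP/eqP => [->|h]; first by rewrite mxE.
by apply/matrixP => i j; rewrite !ord1 h mxE.
Qed.

Lemma dim_orthv_cap u V y : y \in V -> dot u y != 0 ->
  \dim V = (\dim (V :&: orthv u)).+1.
Proof.
move=> yV uy; rewrite -(limg_ker_dim (linfun (mulmxr u^T : E -> 'M[R]_1)) V) -/(orthv u).
rewrite -[RHS]addn1; congr (_ + _)%N; apply/eqP; rewrite eqn_leq; apply/andP; split.
  by apply: leq_trans (dimvS (subvf _)) _; rewrite dimvf /dim /= mul1n.
rewrite lt0n dimv_eq0; apply: contraNneq uy => im0.
rewrite -memv_orthv; apply/subvP: yV.
by rewrite lkerE im0.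
Qed.

Section Families.
Variables (I : finType) (u : I -> E).
Implicit Types (J K : {set I}).

Definition orths V J : {vspace E} := (V :&: \bigcap_(i in J) orthv (u i))%VS.

Lemma memv_orths V J y :
  reflect (y \in V /\ forall i, i \in J -> dot (u i) y = 0) (y \in orths V J).
Proof.
apply: (iffP memv_capP) => -[yV h]; split => //.
  move=> i iJ; apply/eqP; rewrite -memv_orthv; apply/subvP: h.
  by apply: bigcapv_inf iJ _; exact: subvv.
rewrite memvE; apply/subv_bigcapP => i iJ; rewrite -memvE memv_orthv.
by rewrite h.
Qed.

(** General position relative to [V]: each further hyperplane cuts the current flat properly until
    the flat is 0. Unlike linear independence, this makes sense for families of more than [\dim V]
    vectors. *)
Definition generic V : Prop := forall J j, j \notin J -> orths V J != 0%VS ->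
  exists2 y, y \in orths V J & dot (u j) y != 0.

Lemma orthsU1 V J j : orths V (j |: J) = (orths V J :&: orthv (u j))%VS.
Proof.
apply/vspaceP => y; rewrite memv_cap memv_orthv; apply/memv_orths/andP.
  move=> [yV h]; split; last by rewrite h// finset.setU11.
  by apply/memv_orths; split => // i iJ; rewrite h// inE iJ orbT.
move=> [/memv_orths[yV h] /eqP hj]; split => // i.
by rewrite !inE => /predU1P[->|/h].
Qed.

Lemma orths0 V : orths V finset.set0 = V.
Proof. by rewrite /orths big_set0 capvf. Qed.

Lemma orths1 V j : orths V (finset.set1 j) = (V :&: orthv (u j))%VS.
Proof. by rewrite -(finset.setU0 (finset.set1 j)) orthsU1 orths0. Qed.

(** Each hyperplane lowers the dimension by one; once the flat is 0, truncated subtraction gives the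
    right value. *)
Lemma dim_orths V J : generic V -> \dim (orths V J) = (\dim V - #|J|)%N.
Proof.
move=> gV; elim: {J}#|J| {-2}J (erefl #|J|) => [|c IH] J cJ.
  by move/eqP: cJ; rewrite cards_eq0 => /eqP ->; rewrite orths0 cards0 subn0.
have [j jJ] : exists j, j \in J by apply/set0Pn; rewrite -cards_eq0 cJ.
have cJ' : #|J :\ j| = c by move: cJ; rewrite (cardsD1 j) jJ => -[].
have jN : j \notin J :\ j by rewrite !inE eqxx.
rewrite -{1}(finset.setD1K jJ) orthsU1 cJ subnS -cJ' -IH//.
have [W0|Wn0] := eqVneq (orths V (J :\ j)) 0%VS.
  by rewrite W0 cap0v dimv0.
have [y yW uy] := gV _ _ jN Wn0.
by rewrite (dim_orthv_cap yW uy).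
Qed.

End Families.

(** General position passes to the arrangement that the remaining hyperplanes induce on a flat. Both
    the deletion-restriction induction and the count inside a stratum rest on this. *)
Lemma generic_sub (I I' : finType) (u : I -> E) (f : I' -> I) (K : {set I}) V :
  injective f -> (forall i, f i \notin K) -> generic u V ->
  generic (u \o f) (orths u V K).
Proof.
move=> fi fK gV J j jJ.
have -> : orths (u \o f) (orths u V K) J = orths u V (K :|: f @: J).
  apply/vspaceP => y; apply/memv_orths/memv_orths.
    move=> [/memv_orths[yV hK] hJ]; split => // i; rewrite inE => /orP[/hK//|].
    by case/imsetP => k kJ ->; exact: hJ.
  move=> [yV h]; split; first by apply/memv_orths; split => // i iK; rewrite h// inE iK.
  by move=> i iJ; rewrite /= h// inE imset_f ?orbT.
apply: gV; rewrite inE negb_or fK; apply/negP => /imsetP[k kJ /fi jk].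
by rewrite jk kJ in jJ.
Qed.

End Orthogonals.

Section CountRegions.
Variables (R : realType) (d : nat).
Notation E := 'rV[R]_(d.+1).
Implicit Types (V : {vspace E}).

(* Deletion-restriction recursion for the number of regions into which [m]
   hyperplanes in general position cut a [p]-dimensional space. *)
Fixpoint nregions (m p : nat) {struct m} : nat :=
  match m, p with
  | 0, _ => 1
  | m'.+1, 0 => 0
  | m'.+1, p'.+1 => nregions m' p'.+1 + nregions m' p'
  end.

Lemma nregions_gt0 m p : (0 < nregions m p.+1)%N.
Proof. by elim: m p => // m IH p /=; rewrite addn_gt0 IH. Qed.

Definition scons m (b : bool) (s : {ffun 'I_m -> bool}) : {ffun 'I_m.+1 -> bool} :=
  [ffun i => if unlift ord0 i is Some j then s j else b].

Lemma scons0 m b (s : {ffun 'I_m -> bool}) : scons b s ord0 = b.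
Proof. by rewrite ffunE unlift_none. Qed.

Lemma sconsS m b (s : {ffun 'I_m -> bool}) j : scons b s (lift ord0 j) = s j.
Proof. by rewrite ffunE liftK. Qed.

Lemma sum_scons m (F : {ffun 'I_m.+1 -> bool} -> nat) :
  (\sum_s F s = \sum_s (F (scons true s) + F (scons false s)))%N.
Proof.
rewrite (reindex (fun p : {ffun 'I_m -> bool} * bool => scons p.2 p.1)) /=; last first.
  exists (fun s : {ffun 'I_m.+1 -> bool} => ([ffun j => s (lift ord0 j)], s ord0)).
    move=> [s b] _ /=; rewrite scons0; congr (_, _).
    by apply/ffunP => j; rewrite ffunE sconsS.
  move=> s _; apply/ffunP => i /=; case: (unliftP ord0 i) => [j|] ->.
    by rewrite sconsS ffunE.
  by rewrite scons0.
rewrite -(pair_bigA _ (fun s b => F (scons b s)))/=.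
by apply: eq_bigr => s _; rewrite big_bool.
Qed.

Lemma open_halfspaces_scons m (v : 'I_m.+1 -> E) b s y :
  open_halfspaces v (scons b s) y <->
  0 < (-1) ^+ b * dot (v ord0) y /\ open_halfspaces (v \o lift ord0) s y.
Proof.
split => [h|[h0 hS] i].
  split; first by have := h ord0; rewrite scons0.
  by move=> j; have := h (lift ord0 j); rewrite sconsS.
case: (unliftP ord0 i) => [j|] ->; last by rewrite scons0.
by rewrite sconsS; exact: hS.
Qed.

(* The hyperplane of [v ord0] cuts a region of the others in two exactly when it
   meets it; otherwise one of the two new sign vectors is realized. *)
Lemma realizable_scons m (v : 'I_m.+1 -> E) V y0 s :
  y0 \in V -> dot (v ord0) y0 != 0 ->
  (`[< realizable [set` V] v (scons true s) >] + `[< realizable [set` V] v (scons false s) >] =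
   `[< realizable [set` V] (v \o lift ord0) s >] +
   `[< realizable [set` (V :&: orthv (v ord0))%VS] (v \o lift ord0) s >])%N.
Proof.
move=> y0V vy0; set w := v ord0 in vy0 *.
have [r|nr] := pselect (realizable [set` (V :&: orthv w)%VS] (v \o lift ord0) s).
  have [x [/memv_capP[xV]]] := r; rewrite memv_orthv => /eqP xw hx.
  have rb b : realizable [set` V] v (scons b s).
    (* A small multiple of [z] pushes [x] off the hyperplane of [w] to side [b], since
       [(-1) ^+ b * dot w z] is the square of [dot w y0]. *)
    pose z := ((-1) ^+ b * dot w y0) *: y0.
    have [e e0 he] := small_perturb (fun j => (-1) ^+ s j * dot ((v \o lift ord0) j) z) hx.
    exists (x + e *: z); split; first by rewrite /= rpredD// !rpredZ.
    apply/open_halfspaces_scons; split.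
      rewrite dotDr !dotZr -/w xw add0r mulrCA mulr_gt0//.
      set S := (-1) ^+ b; set a := dot w y0.
      rewrite (_ : S * (S * a * a) = (S * S) * (a * a)); last by ring.
      rewrite -!expr2 sqrr_sign mul1r lt_neqAle sqr_ge0 andbT.
      by rewrite eq_sym sqrf_eq0.
    move=> j; rewrite dotDr dotZr mulrDr.
    by rewrite (mulrCA _ e); exact: he.
  have rV : realizable [set` V] (v \o lift ord0) s by exists x.
  by rewrite !asboolT.
rewrite (asboolF nr) addn0.
have [r|nrV] := pselect (realizable [set` V] (v \o lift ord0) s); last first.
  rewrite (asboolF nrV) !asboolF// => -[x [xV /open_halfspaces_scons[_ hx]]];
  by apply: nrV; exists x.
rewrite (asboolT r).
have both : realizable [set` V] v (scons true s) -> realizable [set` V] v (scons false s) -> False.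
  move=> [x1 [x1V /open_halfspaces_scons[]]]; rewrite expr1 mulN1r oppr_gt0 -/w => w1 h1.
  move=> [x2 [x2V /open_halfspaces_scons[]]]; rewrite expr0 mul1r -/w => w2 h2.
  apply: nr; exists (dot w x2 *: x1 + (- dot w x1) *: x2); split.
    apply/memv_capP; split; first by rewrite rpredD// rpredZ.
    by rewrite memv_orthv dotDr !dotZr mulNr mulrC subrr.
  apply: open_halfspaces_comb => //; [exact: ltW|by rewrite oppr_ge0 ltW|].
  by rewrite addr_gt0// oppr_gt0.
have [x [xV hx]] := r.
have rb (b : bool) : 0 < (-1) ^+ b * dot w x -> realizable [set` V] v (scons b s).
  by move=> h; exists x; split => //; apply/open_halfspaces_scons.
have [wx|wx|wx] := ltgtP (dot w x) 0.
- have rt : realizable [set` V] v (scons true s).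
    by apply: rb; rewrite expr1 mulN1r oppr_gt0.
  by rewrite (asboolT rt) asboolF//; exact: both.
- have rf : realizable [set` V] v (scons false s) by apply: rb; rewrite expr0 mul1r.
  by rewrite (asboolT rf) asboolF// => /both; apply.
- exfalso; apply: nr; exists x; split => //; apply/memv_capP; split => //.
  by rewrite memv_orthv wx.
Qed.

(** Summing [realizable_scons] over the remaining signs gives the recursion of [nregions]. The zero
    space counts as one region of the empty arrangement and has none as soon as there is a
    hyperplane. *)
Lemma card_realizable m (v : 'I_m -> E) V : generic v V ->
  #|[pred s | `[< realizable [set` V] v s >]]| = nregions m (\dim V).
Proof.
rewrite -sum1_card big_mkcond /=.
rewrite (eq_bigr (fun s => `[< realizable [set` V] v s >] : nat)); last first.
  by move=> s _; rewrite inE /=; case: asboolP.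
elim: m v V => [|m IH] v V gV.
  rewrite (big_pred1 [ffun=> false]) /=.
    by rewrite asboolT//; exists 0; split; [exact: mem0v|case].
  by move=> s /=; apply/esym/eqP/ffunP => -[].
rewrite sum_scons; have [V0|Vn0] := eqVneq V 0%VS.
  rewrite V0 dimv0 /= big1// => s _.
  have nr b : ~ realizable [set` 0%VS] v (scons b s).
    move=> [x [/=]]; rewrite memv0 => /eqP -> /open_halfspaces_scons[].
    by rewrite dot0r mulr0 ltxx.
  by rewrite !asboolF.
have [||y] := gV finset.set0 ord0; rewrite ?inE ?orths0//.
move=> yV vy.
under eq_bigr do rewrite (realizable_scons _ yV vy).
rewrite big_split /= !IH.
- by rewrite (dim_orthv_cap yV vy).
- have := @generic_sub _ _ _ _ v (lift ord0) (finset.set1 ord0) V.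
  rewrite orths1; apply => //.
    exact: lift_inj.
  by move=> i; rewrite inE eq_sym neq_lift.
- have := @generic_sub _ _ _ _ v (lift ord0) finset.set0 V.
  rewrite orths0; apply => //; first exact: lift_inj.
  by move=> i; rewrite inE.
Qed.

End CountRegions.

Section Hulls.
Variables (R : realType) (d : nat).
Notation E := 'rV[R]_(d.+1).
Implicit Types (V W : {vspace E}) (A : set E).

Definition vsphere V : set E := [set` V] `&` @sphere R d.

Lemma linear_hull_eq A V : A `<=` [set` V] ->
  (forall W, A `<=` [set` W] -> [set` V] `<=` [set` W]) -> linear_hull A = [set` V].
Proof.
move=> AV VW; apply/seteqP; split; first exact: linear_hull_sub.
by move=> x Vx B [[W ->] AW]; exact: (VW W AW x Vx).
Qed.

(** With a strictly interior point [x], the cone contains [x + e *: y] for every [y] of [V] and some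
    [e > 0]; the difference with [x] recovers [y]. *)
Lemma linear_hull_halfspaces m (v : 'I_m -> E) s V :
  realizable [set` V] v s -> linear_hull ([set` V] `&` halfspaces v s) = [set` V].
Proof.
move=> [x [xV hx]]; apply: linear_hull_eq => [y []//|W VW y yV] /=.
have [e e0 he] := small_perturb (fun j => (-1) ^+ s j * dot (v j) y) hx.
have xW : x \in W by apply: VW; split => // j; exact: ltW.
have eyW : x + e *: y \in W.
  apply: VW; split; first by rewrite /= rpredD// rpredZ.
  by move=> j; apply: ltW; rewrite dotDr dotZr mulrDr (mulrCA _ e); exact: he.
have := rpredB eyW xW; rewrite addrC addKr => /(rpredZ e^-1).
by rewrite scalerA mulVf ?scale1r// gt_eqF.
Qed.

Lemma realizable_vsphere m (v : 'I_m -> E) s V : (0 < \dim V)%N ->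
  realizable (vsphere V) v s <-> realizable [set` V] v s.
Proof.
move=> V0; split => [[x [[xV _] hx]]|[x [xV hx]]]; first by exists x.
have pos z : z != 0 -> z \in V -> open_halfspaces v s z -> realizable (vsphere V) v s.
  move=> z0 zV hz; exists (normalize z); split.
    by split; [rewrite /= rpredZ|exact: normalize_sphere].
  by move=> j; rewrite dotZr mulrCA mulr_gt0// normalize_gt0.
(* Only the empty arrangement has 0 in an open region, and then any nonzero vector of [V] serves. *)
have [x0|] := eqVneq x 0; last by move=> /pos; exact.
apply: (pos (vpick V)); rewrite ?memv_pick ?vpick0 -?dimv_eq0 -?lt0n//.
by move=> j; have := hx j; rewrite x0 dot0r mulr0 ltxx.
Qed.

Lemma linear_hull_cell m (v : 'I_m -> E) s V :
  realizable (vsphere V) v s -> linear_hull (cell (vsphere V) v s) = [set` V].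
Proof.
move=> [x [[xV sx] hx]].
have rV : realizable [set` V] v s by exists x.
apply: linear_hull_eq => [y [[]]//|W hW].
rewrite -(linear_hull_halfspaces rV); apply: linear_hull_sub => y [yV hy] /=.
have [->|y0] := eqVneq y 0; first exact: mem0v.
have := hW (normalize y); rewrite /= => h.
have /(rpredZ (Num.sqrt (dot y y))) : normalize y \in W.
  apply: h; split; first by split; [rewrite /= rpredZ|exact: normalize_sphere].
  by move=> j; rewrite dotZr mulrCA mulr_ge0// ltW// normalize_gt0.
rewrite scalerA divff ?scale1r//.
by have := normalize_gt0 y0; rewrite invr_gt0 => /gt_eqF ->.
Qed.

Lemma cell_inj (L : set E) m (v : 'I_m -> E) s s' :
  realizable L v s -> cell L v s = cell L v s' -> s = s'.
Proof.
move=> [x [Lx hx]] ss'; apply/ffunP => j.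
have [_ /(_ j)] : cell L v s' x by rewrite -ss'; split => // i; exact: ltW.
have := hx j; case: (s j); case: (s' j) => //=; rewrite ?expr0 ?expr1 ?mul1r ?mulN1r ?oppr_gt0 ?oppr_ge0;
by move=> h1 h2; have := lt_le_trans h1 h2; rewrite ltxx.
Qed.

Lemma cell_sph_convex V m (v : 'I_m -> E) s :
  realizable (vsphere V) v s -> sph_convex (cell (vsphere V) v s).
Proof.
move=> [x [Lx hx]].
have cV : closed_convex_cone [set` V].
  have := linear_hull_cone [set` V]; rewrite (@linear_hull_eq _ V)//.
have -> : cell (vsphere V) v s = ([set` V] `&` halfspaces v s) `&` @sphere R d.
  by rewrite /cell /vsphere setIAC.
have [//|h] := cone_section (closed_convex_coneI2 cV (halfspaces_cone v s)).
have : ([set` V] `&` halfspaces v s `&` @sphere R d) x.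
  by case: Lx => xV sx; split => //; split => // j; exact: ltW.
by rewrite h.
Qed.

Lemma numcells_total V m (v : 'I_m -> E) : (0 < \dim V)%N -> generic v V ->
  numcells (vsphere V) v setT = nregions m (\dim V).
Proof.
move=> V0 /card_realizable <-; apply: eq_card => s; rewrite !inE.
apply: asbool_equiv_eq; split => [[r _]|r]; first exact/realizable_vsphere.
have {}r : realizable (vsphere V) v s by exact/realizable_vsphere.
by split => //; exists (SConvex (cell_sph_convex r)).
Qed.

Lemma card_image_body (T : finType) (D : pred T) (f : T -> set E) (X : set (set E)) :
  {in D &, injective f} ->
  #|` fset_set ([set f t | t in [set` D]] `&` X)| = #|[pred t | D t && `[< X (f t) >]]|.
Proof.
move=> fI; pose D' := [pred t | D t && `[< X (f t) >]].
have -> : [set f t | t in [set` D]] `&` X = f @` [set` D'].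
  apply/seteqP; split => K /=.
    by move=> [[t Dt <-] Xt]; exists t => //=; apply/andP; split => //; apply/asboolP.
  by move=> [t /andP[Dt /asboolP Xt] <-]; split => //; exists t.
have -> : fset_set (f @` [set` D']) = [fset y | y in map f (enum D')]%fset.
  apply/fsetP => K; rewrite in_fset_set; last exact/finite_image/finite_finpred.
  rewrite !inE /=; apply/idP/mapP => [/set_mem[t Dt <-]|[t tD ->]].
    by exists t => //; rewrite mem_enum.
  by apply/mem_set; exists t => //; rewrite mem_enum in tD.
rewrite card_fseq undup_id ?size_map -?cardE// map_inj_in_uniq ?enum_uniq//.
move=> t t'; rewrite !mem_enum => /andP[Dt _] /andP[Dt' _]; exact: fI.
Qed.

End Hulls.

Section Nonorthogonal.
Variables (R : realType) (d : nat).
Notation E := 'rV[R]_(d.+1).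

(** A point of the moment curve: the product with [(1, t, ..., t ^+ d)] is a nonzero polynomial in
    [t] for each [i], so some [t] avoids the roots of all of them. *)
Lemma exists_nonorthogonal (I : finType) (v : I -> E) : (forall i, v i != 0) ->
  exists w, forall i, dot (v i) w != 0.
Proof.
move=> v0.
pose p i : {poly R} := \poly_(j < d.+1) v i 0 (inord j).
have p0 i : p i != 0.
  apply: contraNneq (v0 i) => pi0; apply/eqP/rowP => j.
  have := congr1 (fun q : {poly R} => q`_j) pi0; rewrite /p coef_poly ltn_ord coef0.
  by rewrite inord_val mxE.
have q0 : \prod_i p i != 0 by apply/prodf_neq0 => i _.
have [t qt] : exists t : R, (\prod_i p i).[t] != 0.
  apply: contrapT => nt.
  have rt : all (root (\prod_i p i)) [seq j%:R | j <- iota 0 (size (\prod_i p i)).+1].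
    apply/allP => t _; apply: contrapT => /negP rt; apply: nt; exists t.
    by move: rt; rewrite rootE.
  have := max_poly_roots q0 rt; rewrite size_map size_iota ltnNge leqnSn => h.
  have {}h := h _; suff : false by []; apply: h.
  rewrite map_inj_uniq ?iota_uniq//; exact: mulrIn (oner_neq0 R).
exists (\row_j t ^+ j) => i.
have -> : dot (v i) (\row_j t ^+ j) = (p i).[t].
  rewrite horner_poly dotE; apply: eq_bigr => j _.
  by rewrite mxE inord_val.
move: qt; rewrite horner_prod => /prodf_neq0; exact.
Qed.

End Nonorthogonal.

Lemma exists_complement_enum (n m : nat) (I : {set 'I_n}) : (m + #|I| = n)%N ->
  exists g : 'I_m -> 'I_n, injective g /\ forall i, i \notin I <-> exists j, i = g j.
Proof.
move=> mI; have cI : m = #|~: I|.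
  by apply: (@addIn #|I|); rewrite mI addnC cardsC card_ord.
exists (fun j => enum_val (cast_ord cI j)); split.
  by move=> i j /enum_val_inj /cast_ord_inj.
move=> i; split => [iI|[j ->]].
  have iI' : i \in ~: I by rewrite inE.
  by exists (cast_ord (esym cI) (enum_rank_in iI' i)); rewrite cast_ordKV enum_rankK_in.
by have := enum_valP (cast_ord cI j); rewrite inE.
Qed.

(** * Faces of the tessellation as cells of strata *)

Section Faces.
Variables (R : realType) (d n k m : nat).
Notation E := 'rV[R]_(d.+1).
Variable u : 'I_n -> E.
Hypothesis kd : (k < d)%N.
Hypothesis mn : (m + (d - k) = n)%N.
Hypothesis gen : generic u fullv.
Variable g : {set 'I_n} -> 'I_m -> 'I_n.
Hypothesis g_inj : forall I : {set 'I_n}, #|I| = (d - k)%N -> injective (g I).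
Hypothesis gP : forall I : {set 'I_n}, #|I| = (d - k)%N ->
  forall i, i \notin I <-> exists j, i = g I j.
Implicit Types (I : {set 'I_n}) (x y w : E).

Definition stratum I : set E := vsphere (orths u fullv I).

Lemma stratumE I : stratum I =
  [set y | sphere y /\ forall i, i \in I -> dot (u i) y = 0].
Proof.
apply/seteqP; split => y [].
  by move=> /memv_orths[_ h] sy; split.
by move=> sy h; split => //; apply/memv_orths; split => //; exact: memvf.
Qed.

Lemma dim_orths_full I : #|I| = (d - k)%N -> \dim (orths u fullv I) = k.+1.
Proof.
move=> cI; rewrite dim_orths// cI dimvf /dim /= mul1n.
by rewrite subSn ?leq_subr// subKn// ltnW.
Qed.

(** The definition of [sph_faces] allows any polyhedral cone over the cell; a cone is determined by
    its unit vectors, so only one occurs. *)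
Lemma polyhedral_cone_cell C s : polyhedral_cone C ->
  C `&` @sphere R d = cell (@sphere R d) u s -> C = halfspaces u s.
Proof.
move=> [p [v CE]] CP; apply/seteqP; split => y.
- have [-> _ j|y0 Cy j] := eqVneq y 0; first by rewrite dot0r mulr0.
  have : cell (@sphere R d) u s (normalize y).
    rewrite -CP; split; last exact: normalize_sphere.
    move: Cy; rewrite CE => Cy i; rewrite dotZr.
    by apply: mulr_ge0; [exact/ltW/normalize_gt0|exact: Cy].
  by move=> [_ /(_ j)]; rewrite dotZr mulrCA pmulr_rge0// normalize_gt0.
- have [-> _|y0 hy] := eqVneq y 0; first by rewrite CE => i; rewrite dot0r.
  have : (C `&` @sphere R d) (normalize y).
    rewrite CP; split; first exact: normalize_sphere.
    by move=> j; rewrite dotZr mulrCA mulr_ge0// ltW// normalize_gt0.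
  rewrite CE => -[h _] i; have := h i.
  by rewrite dotZr pmulr_rge0// normalize_gt0.
Qed.

Let zeros x : {set 'I_n} := [set i | dot (u i) x == 0]%SET.

(* A point of the face with as few vanishing coordinates as possible lies in
   its relative interior, so it determines the face. *)
Lemma cone_face_zeros s F : cone_face (halfspaces u s) F ->
  exists2 x, F x & F = [set` orths u fullv (zeros x)] `&` halfspaces u s.
Proof.
move=> [w [wC FE]].
have F0 : F 0 by rewrite FE; split; [move=> j; rewrite dot0r mulr0|rewrite /= dot0r].
pose P c := `[< exists x, F x /\ #|zeros x| = c >].
have exP : exists c, P c by exists #|zeros 0|; apply/asboolP; exists 0.
case: (ex_minnP exP) => c /asboolP[x [Fx cx]] cmin.
have FD y z : F y -> F z -> F (y + z).
  rewrite FE => -[hy /= wy] [hz /= wz]; split => [j|/=]; last by rewrite dotDr wy wz addr0.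
  by rewrite dotDr mulrDr addr_ge0.
have FC y : F y -> halfspaces u s y by rewrite FE => -[].
have zD y z : F y -> F z -> zeros (y + z) \subset zeros y.
  move=> Fy Fz; apply/fintype.subsetP => i; rewrite !inE dotDr => /eqP yz.
  have hy := FC _ Fy i; have hz := FC _ Fz i.
  have : (-1) ^+ s i * dot (u i) y + (-1) ^+ s i * dot (u i) z = 0.
    by rewrite -mulrDr yz mulr0.
  by move/eqP; rewrite paddr_eq0// mulf_eq0 signr_eq0/= => /andP[].
exists x => //; apply/seteqP; split => y.
- move=> Fy; split; last exact: FC.
  apply/memv_orths; split; first exact: memvf.
  move=> i ix.
  have le : (#|zeros x| <= #|zeros (x + y)|)%N.
    by rewrite cx; apply: cmin; apply/asboolP; exists (x + y); split => //; exact: FD.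
  have xE : zeros (x + y) = zeros x.
    by apply/eqP; rewrite eqEcard zD.
  have : i \in zeros y.
    by apply/(fintype.subsetP (zD y x Fy Fx)); rewrite addrC xE.
  by rewrite inE => /eqP.
- move=> [/memv_orths[_ hy] sy]; rewrite FE; split => //=.
  (* The value 1 is a placeholder at indices where [x] and [y] both vanish. The point [x - e *: y]
     stays in the cone, and [w], which vanishes at [x], is nonnegative there; hence
     [dot w y <= 0]. *)
  pose a i := if i \in zeros x then 1 else (-1) ^+ s i * dot (u i) x.
  have [e e0 he] : exists2 e, 0 < e & forall i, 0 < a i + e * (- ((-1) ^+ s i * dot (u i) y)).
    apply: small_perturb => i; rewrite /a; case: ifPn => //.
    rewrite inE => xi; rewrite lt_neqAle FC// andbT eq_sym mulf_eq0 signr_eq0/=.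
    exact: xi.
  have : 0 <= dot w (x - e *: y).
    apply: wC => i; rewrite dotBr dotZr mulrBr.
    have := he i; rewrite /a; case: ifPn => [ix _|_].
      move: (ix); rewrite inE => /eqP ->; rewrite hy//.
      by rewrite !mulr0 subr0.
    by rewrite mulrN mulrCA => /ltW.
  have -> : dot w (x - e *: y) = - (e * dot w y).
    by move: Fx; rewrite FE dotBr dotZr => -[_ /= ->]; rewrite sub0r.
  rewrite oppr_ge0 pmulr_rle0// => wy0.
  by apply/eqP; rewrite eq_le wy0; exact: wC.
Qed.

(** The relatively interior point [x] of the face satisfies strict inequalities off [zeros x], so
    the face spans the flat of [zeros x]. By general position, its dimension fixes the number of
    zeros. *)
Lemma sph_faces_sub s K : sph_faces k (cell (@sphere R d) u s) K ->
  exists I s', [/\ #|I| = (d - k)%N, realizable (stratum I) (u \o g I) s' &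
    K = cell (stratum I) (u \o g I) s'].
Proof.
move=> [C [F [[pC _ PE] [cF lF ->]]]].
have CE := polyhedral_cone_cell pC (esym PE); rewrite {C pC PE}CE in cF.
have [x Fx FE] := cone_face_zeros cF.
set I := zeros x in FE; set V := orths u fullv I in FE.
have [xV xs] : [set` V] x /\ halfspaces u s x by move: Fx; rewrite FE => -[].
have xpos i : i \notin I -> 0 < (-1) ^+ s i * dot (u i) x.
  by rewrite inE => xi; rewrite lt_neqAle xs andbT eq_sym mulf_eq0 signr_eq0.
have hullE : linear_hull F = [set` V].
  apply: linear_hull_eq => [y|W FW y yV]; first by rewrite FE => -[].
  pose a i := if i \in I then 1 else (-1) ^+ s i * dot (u i) x.
  have [e e0 he] : exists2 e, 0 < e & forall i, 0 < a i + e * ((-1) ^+ s i * dot (u i) y).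
    by apply: small_perturb => i; rewrite /a; case: ifPn => // /xpos.
  have xW : x \in W by exact: FW.
  have eyW : x + e *: y \in W.
    apply: FW; rewrite FE; split; first by rewrite /= rpredD// rpredZ.
    move=> i; rewrite dotDr dotZr mulrDr (mulrCA _ e).
    have := he i; rewrite /a; case: ifPn => [iI _|_ /ltW//].
    move/memv_orths: yV => [_ /(_ i iI) ->]; move/memv_orths: xV => [_ /(_ i iI) ->].
    by rewrite !mulr0 addr0.
  have := rpredB eyW xW; rewrite addrC addKr => /(rpredZ e^-1).
  by rewrite scalerA mulVf ?scale1r// gt_eqF.
have dV : \dim V = k.+1.
  have [U [UE <-]] := lF; congr (\dim _); apply/vspaceP => y.
  rewrite hullE in UE; apply/idP/idP => yU.
    by have : [set` U] y by rewrite -UE.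
  by have : [set` V] y by rewrite UE.
have cI : #|I| = (d - k)%N.
  have h : k.+1 = (d.+1 - #|I|)%N.
    by have := dim_orths I gen; rewrite -/V dV dimvf /dim /= mul1n.
  (* Beyond [d.+1] the truncated difference would be 0 and not [k.+1]. *)
  have le1 : (#|I| <= d.+1)%N by rewrite leqNgt; apply/negP => /ltnW; rewrite -subn_eq0 -h.
  by rewrite -[#|I|](subKn le1) -h subSS.
exists I, [ffun j => s (g I j)]; split => //.
  apply/realizable_vsphere; first by rewrite dV.
  exists x; split => // j; rewrite ffunE /=; apply: xpos.
  by apply/(gP cI); exists j.
rewrite FE /cell /stratum /vsphere; apply/seteqP; split => y.
  by move=> [[yV ys] sy]; split => // j; rewrite ffunE; exact: ys.
move=> [[yV sy] ys]; split => //; split => // i.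
have [iI|/(gP cI)[j ->]] := boolP (i \in I).
  by move/memv_orths: yV => [_ /(_ i iI) ->]; rewrite mulr0.
by have := ys j; rewrite ffunE.
Qed.

Lemma generic_neq0 i : u i != 0.
Proof.
have [||y _] := gen (J := finset.set0) (j := i); rewrite ?inE ?orths0//.
  by rewrite -dimv_eq0 dimvf.
by apply: contraNneq => ->; rewrite dot0l.
Qed.

(** A full-dimensional cell is built around the given cell of the stratum: off [I] its signs are
    those of [x], on [I] those of a vector [w] orthogonal to no normal. The point [x + e *: w] lies
    inside it. *)
Lemma sph_faces_sup I s : #|I| = (d - k)%N -> realizable (stratum I) (u \o g I) s ->
  exists2 s0, realizable (@sphere R d) u s0 &
    sph_faces k (cell (@sphere R d) u s0) (cell (stratum I) (u \o g I) s).
Proof.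
move=> cI r; have [x [[xV sx] xs]] := r.
have xI i : (i \in I) = (dot (u i) x == 0).
  apply/idP/idP => [iI|]; first by move/memv_orths: xV => [_ /(_ i iI) ->].
  apply: contraLR => /(gP cI)[j ->].
  by have := xs j; apply: contraTneq => /= ->; rewrite mulr0 ltxx.
have [w uw] := exists_nonorthogonal generic_neq0.
pose s0 : {ffun 'I_n -> bool} :=
  [ffun i => if i \in I then dot (u i) w < 0 else dot (u i) x < 0].
have sgn (a : R) : a != 0 -> 0 < (-1) ^+ (a < 0)%R * a.
  by move=> a0; case: (ltgtP a 0) a0 => //= a0 _; rewrite ?expr1 ?expr0 ?mulN1r ?mul1r ?oppr_gt0.
have s0I i : i \in I -> 0 < (-1) ^+ s0 i * dot (u i) w.
  by move=> iI; rewrite ffunE iI; exact: sgn.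
have s0x i : i \notin I -> 0 < (-1) ^+ s0 i * dot (u i) x.
  by move=> iI; rewrite ffunE (negbTE iI); apply: sgn; rewrite -xI.
have s0g j : s0 (g I j) = s j.
  have gN : g I j \notin I by apply/(gP cI); exists j.
  rewrite ffunE (negbTE gN); have := xs j => /=.
  case: (s j); rewrite ?expr1 ?expr0 ?mulN1r ?mul1r ?oppr_gt0 => h; first by rewrite h.
  by apply/negbTE; rewrite -leNgt ltW.
have x_half : halfspaces u s0 x.
  move=> i; have [|/s0x/ltW//] := boolP (i \in I).
  by rewrite xI => /eqP ->; rewrite mulr0.
exists s0.
  pose a i := if i \in I then 1 else (-1) ^+ s0 i * dot (u i) x.
  have [e e0 he] : exists2 e, 0 < e & forall i, 0 < a i + e * ((-1) ^+ s0 i * dot (u i) w).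
    by apply: small_perturb => i; rewrite /a; case: ifPn => // /s0x.
  have hz : open_halfspaces u s0 (x + e *: w).
    move=> i; rewrite dotDr dotZr mulrDr (mulrCA _ e).
    have := he i; rewrite /a; case: ifPn => // iI _.
    by move: (iI); rewrite xI => /eqP ->; rewrite mulr0 add0r mulr_gt0// s0I.
  have [i iI] : exists i, i \in I by apply/set0Pn; rewrite -card_gt0 cI subn_gt0.
  have z0 : x + e *: w != 0.
    by apply/eqP => z0; have := hz i; rewrite z0 dot0r mulr0 ltxx.
  exists (normalize (x + e *: w)); split; first exact: normalize_sphere.
  by move=> j; rewrite dotZr mulrCA mulr_gt0// normalize_gt0.
(* The supporting functional is a sum of terms that are nonnegative on the cone, so it vanishes
   exactly where all normals of [I] do. *)
pose c := \sum_(i in I) (-1) ^+ s0 i *: u i.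
have dc y : dot c y = \sum_(i in I) (-1) ^+ s0 i * dot (u i) y.
  by rewrite dot_suml; apply: eq_bigr => i _; rewrite dotZl.
have FE : halfspaces u s0 `&` [set y | dot c y = 0] =
    [set` orths u fullv I] `&` halfspaces u s0.
  apply/seteqP; split => y.
    move=> [hy /eqP]; rewrite dc psumr_eq0; last by move=> i _; exact: hy.
    move=> /allP h; split => //; apply/memv_orths; split; first exact: memvf.
    move=> i iI; have := h i (mem_index_enum _); rewrite iI /=.
    by rewrite mulf_eq0 signr_eq0 => /eqP.
  move=> [/memv_orths[_ h] hy]; split => //=.
  by rewrite dc big1// => i iI; rewrite h// mulr0.
have FE' : [set` orths u fullv I] `&` halfspaces u s0 =
    [set` orths u fullv I] `&` halfspaces (u \o g I) s.
  apply/seteqP; split => y [yV hy]; split => //.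
    by move=> j; rewrite -s0g; exact: hy.
  move=> i; have [iI|/(gP cI)[j ->]] := boolP (i \in I).
    by move/memv_orths: yV => [_ /(_ i iI) ->]; rewrite mulr0.
  by rewrite s0g; exact: hy.
exists (halfspaces u s0), (halfspaces u s0 `&` [set y | dot c y = 0]); split; split => //.
- exists n, (fun i => (-1) ^+ s0 i *: u i); apply/seteqP; split => y hy i.
    by rewrite dotZl; exact: hy.
  by rewrite -dotZl; exact: hy.
- move=> h0; have := sphere_neq0 sx.
  by move: x_half; rewrite h0 => ->; rewrite eqxx.
- by rewrite /cell setIC.
- exists c; split => // y hy; rewrite /= dc; apply: sumr_ge0 => i _; exact: hy.
- exists (orths u fullv I); split; last exact: dim_orths_full.
  rewrite FE FE'; apply: linear_hull_halfspaces.
  apply/realizable_vsphere => //; by rewrite dim_orths_full.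
- by rewrite FE FE' /cell /stratum /vsphere setIAC.
Qed.

(** Codes of [k]-faces: the hyperspheres that contain the face, and its side with respect to each of
    the others. *)
Definition flags : pred ({set 'I_n} * {ffun 'I_m -> bool}) :=
  [pred p : {set 'I_n} * {ffun 'I_m -> bool} | (#|p.1| == (d - k)%N) && `[< realizable (stratum p.1) (u \o g p.1) p.2 >]].

Definition flag_cell (p : {set 'I_n} * {ffun 'I_m -> bool}) : set E :=
  cell (stratum p.1) (u \o g p.1) p.2.

Lemma tess_facesE : tess_faces k (tessellation (fun i => orth_sphere (u i))) =
  [set flag_cell p | p in [set` flags]].
Proof.
have d0 : (0 < d)%N by exact: leq_ltn_trans kd.
rewrite /tess_faces tessellationE//; apply/seteqP; split => K.
  move=> [_ [s rs <-]] /sph_faces_sub[I [s' [cI rs' ->]]].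
  by exists (I, s') => //=; apply/andP; split; [exact/eqP|exact/asboolP].
move=> [[I s] /= /andP[/eqP cI /asboolP rs] <-].
have [s0 r0 h] := sph_faces_sup cI rs.
by exists (cell (@sphere R d) u s0) => //; exists s0.
Qed.

(** The linear hull of a face is its flat, and general position recovers [I] from the flat: a normal
    outside [I] is not orthogonal to it. The signs follow from [cell_inj]. *)
Lemma flag_cell_inj : {in flags &, injective flag_cell}.
Proof.
move=> [I s] [I' s'] /andP[/eqP/= cI /asboolP/= r] /andP[/eqP/= cI' /asboolP/= r'].
rewrite /flag_cell/= => eqK.
have II : I = I'.
  have : linear_hull (cell (stratum I) (u \o g I) s) =
         linear_hull (cell (stratum I') (u \o g I') s') by rewrite eqK.
  rewrite !linear_hull_cell// => VV.
  apply/eqP; rewrite eq_sym eqEcard cI cI' leqnn andbT; apply/fintype.subsetP => j jI'.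
  apply: contrapT => /negP jI.
  have V0 : orths u fullv I != 0%VS by rewrite -dimv_eq0 dim_orths_full.
  have [y yV] := gen jI V0.
  have : [set` orths u fullv I'] y by rewrite -VV.
  by move=> /memv_orths[_ /(_ j jI') ->]; rewrite eqxx.
by subst I'; congr (_, _); exact: cell_inj eqK.
Qed.

Lemma card_faces_in A :
  #|` fset_set (tess_faces k (tessellation (fun i => orth_sphere (u i))) `&` (@body R d @` A))| =
  (\sum_(I : {set 'I_n} | #|I| == (d - k)%N) numcells (stratum I) (u \o g I) A)%N.
Proof.
rewrite tess_facesE card_image_body; last exact: flag_cell_inj.
rewrite -sum1_card big_mkcond /=.
rewrite -(pair_bigA _ (fun I s => if (I, s) \in [pred t | flags t && `[< (@body R d @` A) (flag_cell t) >]] then 1 else 0)%N)/=.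
rewrite [RHS]big_mkcond; apply: eq_bigr => I _.
case: ifPn => cI; last by rewrite big1// => s _; rewrite inE /flags /= (negbTE cI).
rewrite /numcells -sum1_card [RHS]big_mkcond; apply: eq_bigr => s _.
by rewrite !inE /flags /= cI /= /flag_cell /= asbool_and.
Qed.

Lemma card_faces :
  #|` fset_set (tess_faces k (tessellation (fun i => orth_sphere (u i))))| =
  (#|[set I : {set 'I_n} | #|I| == (d - k)%N]%SET| * nregions m k.+1)%N.
Proof.
have := card_faces_in setT; set F := tess_faces _ _.
have -> : F `&` (@body R d @` setT) = F.
  rewrite setIidl// /F tess_facesE => _ [[I s] /andP[/eqP/= cI /asboolP/= r] <-].
  by exists (SConvex (cell_sph_convex r)).
move=> ->; rewrite -sum_nat_const.
rewrite [RHS](eq_bigl (fun I : {set 'I_n} => #|I| == (d - k)%N)); last by move=> I; rewrite inE.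
apply: eq_bigr => I /eqP cI.
rewrite numcells_total ?dim_orths_full//.
apply: generic_sub => //; first exact: g_inj.
by move=> j; apply/(gP cI); exists j.
Qed.

End Faces.

Section SectionCount.
Variables (R : realType) (d m : nat) (v : 'I_m -> 'rV[R]_(d.+1)) (V : {vspace 'rV[R]_(d.+1)}).
Hypotheses (d0 : (0 < d)%N) (V0 : (0 < \dim V)%N) (v0 : forall j, v j != 0).

Lemma card_section_in A :
  #|` fset_set (tess_section (vsphere V) (tessellation (fun j => orth_sphere (v j)))
        `&` (@body R d @` A))| = numcells (vsphere V) v A.
Proof.
rewrite tess_sectionE//; last by move=> x [].
have -> : [set cell (vsphere V) v s | s in [set s | realizable (vsphere V) v s]] =
    [set cell (vsphere V) v s | s in [set` [pred s | `[< realizable (vsphere V) v s >]]]].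
  by congr (_ @` _); apply/seteqP; split => s /asboolP.
rewrite card_image_body.
  by apply: eq_card => s; rewrite !inE /= asbool_and.
by move=> s s' /asboolP r _; exact: cell_inj.
Qed.

Lemma card_section : generic v V ->
  #|` fset_set (tess_section (vsphere V) (tessellation (fun j => orth_sphere (v j))))| =
  nregions m (\dim V).
Proof.
move=> gV; rewrite -(numcells_total V0 gV) -card_section_in setIidl//.
rewrite tess_sectionE//; last by move=> x [].
by move=> _ [s r <-]; exists (SConvex (cell_sph_convex r)).
Qed.

End SectionCount.

(** * Normals of the random hyperspheres *)

Section Normals.
Variables (R : realType) (d : nat).
Notation E := 'rV[R]_(d.+1).
Implicit Types (u w x y : E) (S : sconvex R d).
Hypothesis d0 : (0 < d)%N.

(** Singles out one of the two unit normals of a hypersphere by a rule that countably many closed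
    conditions express. *)
Definition lex_positive u : Prop :=
  exists i : 'I_d.+1, (forall l : 'I_d.+1, (l < i)%N -> u 0 l = 0) /\ 0 < u 0 i.

Lemma lex_positive_or u : u != 0 -> lex_positive u \/ lex_positive (- u).
Proof.
move=> u0; have /rV0Pn[i0 ui0] := u0.
have ex : exists i : nat, [exists l : 'I_d.+1, (l == i :> nat) && (u 0 l != 0)].
  by exists i0; apply/existsP; exists i0; rewrite eqxx.
case: (ex_minnP ex) => i /existsP[l /andP[/eqP li ul]] imin.
have lt0 (j : 'I_d.+1) : (j < l)%N -> u 0 j = 0.
  rewrite li => ji; apply/eqP; apply: contraTT ji => uj; rewrite -leqNgt.
  by apply: imin; apply/existsP; exists j; rewrite eqxx.
case: (ltgtP (u 0 l) 0) ul => // ul _; [right|left]; exists l; split => //.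
  by move=> j /lt0; rewrite mxE => ->; rewrite oppr0.
by rewrite mxE oppr_gt0.
Qed.

Lemma lex_positiveN u : lex_positive u -> ~ lex_positive (- u).
Proof.
move=> [i [i0 ui]] [j [j0]]; rewrite mxE oppr_gt0 => uj.
case: (ltngtP i j) => [/j0|/i0|/val_inj ij].
- by rewrite mxE => /eqP; rewrite oppr_eq0 => /eqP u0; rewrite u0 ltxx in ui.
- by move=> u0; rewrite u0 ltxx in uj.
- by rewrite ij in ui; have := lt_trans ui uj; rewrite ltxx.
Qed.

Lemma orth_sphere_orthv u : orth_sphere u = vsphere (orthv u).
Proof.
by rewrite /orth_sphere /vsphere; congr (_ `&` _); apply/seteqP; split => x /=;
  rewrite memv_orthv => /eqP.
Qed.

Lemma dim_orthv u : u != 0 -> \dim (orthv u) = d.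
Proof.
move=> u0; have : dot u u != 0 by rewrite dot_eq0.
move/(dim_orthv_cap (memvf u)); rewrite capfv dimvf /dim /= mul1n => /eq_add_S.
by move=> <-.
Qed.

(** The map [g] is the complementary projection with kernel [W]; a coordinate functional of [g] that
    is not zero vanishes on [W], and [u] is its coefficient vector. *)
Lemma exists_normal (W : {vspace E}) : (\dim W < d.+1)%N ->
  exists2 u : E, u != 0 & (W <= orthv u)%VS.
Proof.
move=> dW; pose g := (\1 - projv W)%VF : 'End(E).
have gE x : (x \in W) = (g x == 0).
  apply/idP/eqP => [xU|]; rewrite /g lfunE /= opp_lfunE id_lfunE.
    by rewrite projv_id// subrr.
  by move=> /eqP; rewrite subr_eq0 => /eqP ->; exact: memv_proj.
have [x xW] : exists x : E, x \notin W.
  apply: contrapT => nx; move: dW; rewrite (_ : W = fullv) ?dimvf /dim /= ?mul1n ?ltnn//.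
  apply/vspaceP => x; rewrite memvf; apply: contrapT => /negP xW; apply: nx.
  by exists x.
have /rV0Pn[j gxj] : g x != 0 by rewrite -gE.
pose u : E := \row_i g (delta_mx 0 i) 0 j.
have ug y : dot u y = g y 0 j.
  rewrite {2}(row_sum_delta y) linear_sum summxE dotE; apply: eq_bigr => i _.
  by rewrite linearZ /= !mxE mulrC.
exists u; first by apply: contraNneq gxj => u0; rewrite -ug u0 dot0l.
apply/subvP => y; rewrite gE memv_orthv ug => /eqP ->; rewrite mxE//.
Qed.

Lemma hypersphere_normal (H : set E) : great_subsphere d.-1 H ->
  exists u, [/\ sphere u, lex_positive u & H = orth_sphere u].
Proof.
move=> [W [dW ->]]; rewrite prednK// in dW.
have [|u u0 Wu] := @exists_normal W; first by rewrite dW.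
have WE : W = orthv u by apply/eqP; rewrite eqEdim Wu dim_orthv// dW leqnn.
have nE w : w != 0 -> orthv w = W -> [set` W] `&` @sphere R d = orth_sphere (normalize w).
  move=> w0 wW; rewrite orth_sphere_orthv /vsphere -wW; congr (_ `&` _).
  apply/seteqP; split => x /=; rewrite !memv_orthv dotZl mulf_eq0;
    by rewrite (gt_eqF (normalize_gt0 w0)).
have lexn w : w != 0 -> lex_positive w -> lex_positive (normalize w).
  move=> w0 [i [i0 wi]]; exists i; split => [l /i0|]; rewrite mxE.
    by move=> ->; rewrite mulr0.
  by rewrite mulr_gt0// normalize_gt0.
have [lu|lu] := lex_positive_or u0.
  by exists (normalize u); split; [exact: normalize_sphere|exact: lexn|exact: nE].
have u0' : - u != 0 by rewrite oppr_eq0.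
exists (normalize (- u)); split; [exact: normalize_sphere|exact: lexn|].
apply: nE => //; rewrite WE; apply/vspaceP => x.
by rewrite !memv_orthv dotNl oppr_eq0.
Qed.

(** The part of [w] orthogonal to [u], if nonzero, normalizes to a point of [orth_sphere u] and is
    thus orthogonal to [w], hence to itself. So [w] is a unit multiple of [u]. *)
Lemma orth_sphere_normal_unique u w : sphere u -> sphere w ->
  (forall x, orth_sphere u x -> dot w x = 0) -> w = u \/ w = - u.
Proof.
move=> su sw hw; pose z := w - dot u w *: u.
have uz : dot u z = 0 by rewrite dotBr dotZr su mulr1 subrr.
have z0 : z = 0.
  apply/eqP; apply: contrapT => /negP z0.
  have : dot w (normalize z) = 0.
    apply: hw; split; last exact: normalize_sphere.
    by rewrite /= dotZr uz mulr0.
  rewrite dotZr => /eqP; rewrite mulf_eq0 (gt_eqF (normalize_gt0 z0))/= => /eqP wz.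
  have : dot z z = 0 by rewrite {1}/z dotBl dotZl wz uz mulr0 subr0.
  by move/eqP; rewrite dot_eq0 (negbTE z0).
have wE : w = dot u w *: u by apply/eqP; rewrite -subr_eq0 -/z z0.
have : dot u w ^+ 2 = 1.
  by move: sw; rewrite /sphere /= {1 2}wE dotZ su mulr1.
move/eqP; rewrite sqrf_eq1 => /orP[] /eqP h; rewrite wE h ?scale1r ?scaleN1r; by [left|right].
Qed.

Definition normal S : E :=
  xget 0 [set u | [/\ sphere u, lex_positive u & body S = orth_sphere u]].

Lemma great_normalP S : great_subsphere d.-1 S ->
  [/\ sphere (normal S), lex_positive (normal S) & body S = orth_sphere (normal S)].
Proof.
move=> /hypersphere_normal[u hu]; rewrite /normal.
by case: xgetP => [w _ //|/(_ u)]; elim.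
Qed.

Lemma normal_unique S w : great_subsphere d.-1 S -> sphere w -> lex_positive w ->
  (forall z, body S z -> dot z w = 0) -> normal S = w.
Proof.
move=> /great_normalP[sn ln SE] sw lw h; apply/esym.
have [//|wn] : w = normal S \/ w = - normal S.
  by apply: orth_sphere_normal_unique => // x; rewrite -SE dotC; exact: h.
by move: lw; rewrite wn => /lex_positiveN; rewrite opprK => /(_ ln).
Qed.

Lemma coord_dotE (l : 'I_d.+1) : (fun u : E => u 0 l) = dot (delta_mx 0 l).
Proof.
apply/funext => u; rewrite dotE (bigD1 l)//= big1 ?addr0 ?mxE ?eqxx ?mul1r//.
by move=> i il; rewrite mxE (negbTE il) andbF mul0r.
Qed.

(* Off the great hyperspheres [normal] takes the junk value 0, hence the detour
   through the trace of the Borel sets. *)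
Lemma normal_trace (B : set (borel_euclid R d)) : measurable B ->
  exists B' : set (borel_sconvex R d), measurable B' /\
    forall S, great_subsphere d.-1 S -> B (normal S) <-> B' S.
Proof.
pose D := [set B : set (borel_euclid R d) | exists B' : set (borel_sconvex R d),
  measurable B' /\ forall S, great_subsphere d.-1 S -> B (normal S) <-> B' S].
suff : <<s @open E >> `<=` D by exact.
apply: smallest_sub.
  split.
  - by exists set0; split => //; exact: measurable0.
  - move=> A [B' [mB' h]]; exists (~` B'); split; first exact: measurableC.
    move=> S hS; split => [[_ nA] /(h S hS)//|nB']; split => //.
    by move/(h S hS).
  - move=> F hF; have [F' hF'] := choice (hF : forall i : nat, exists B' : set (borel_sconvex R d),
      measurable B' /\ forall S, great_subsphere d.-1 S -> F i (normal S) <-> B' S).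
    exists (\bigcup_i F' i); split; first by apply: bigcupT_measurable => i; case: (hF' i).
    move=> S hS; split => [[i _]|[i _]].
      by move=> Fi; exists i => //; exact: ((hF' i).2 S hS).1.
    by move=> Fi; exists i => //; exact: ((hF' i).2 S hS).2.
move=> O oO.
(* The pair [p] fixes the index of the leading coordinate and a lower bound for it, which makes
   [lex_positive] closed; the index [None] demands orthogonality to the body. *)
pose h (p : 'I_d.+1 * nat) (l : option 'I_d.+1) S u : R :=
  if l is Some l then
    if (l < p.1)%N then - `|u 0 l| else if l == p.1 then u 0 l - p.2.+1%:R^-1 else 0
  else - body_perp S u.
exists (\bigcup_p [set S | exists u, [/\ O u, sphere u & forall l, 0 <= h p l S u]]); split.
  apply: countable_bigcup_measurable => p _.
  apply: (@measurable_exists_sphere _ (borel_sconvex R d) R d (option 'I_d.+1) (h p)) => // -[l|].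
    have cl : continuous ((fun u : E => u 0 l) : E -> R^o).
      by rewrite coord_dotE; exact: dot_continuous.
    rewrite /h; case: (l < p.1)%N; last case: (l == p.1).
    + apply: (@caratheodory_comp _ _ _ _ _ (-%R)); first exact: opp_continuous.
      apply: (@caratheodory_comp _ _ _ _ _ (fun x : R => `|x|)).
        exact: norm_continuous.
      exact: caratheodory_cst.
    + apply: (@caratheodory_cst _ _ _ _ (fun u : E => u 0 l - p.2.+1%:R^-1)) => u.
      exact: (@cvgB R R^o E (nbhs u) _ (fun u : E => u 0 l) (fun=> _) _ _ (cl u) (cvg_cst _)).
    + apply: (@caratheodory_cst _ _ _ _ (fun u : E => 0)) => u.
      exact: cst_continuous.
  apply: (@caratheodory_comp _ _ _ _ _ (-%R)); first exact: opp_continuous.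
  exact: body_perp_caratheodory.
move=> S hS; have [sn [i [i0 ni]] SE] := great_normalP hS; split.
  move=> On; have [j hj] := small_ratio ni.
  exists (i, j) => //; exists (normal S); split => // -[l|] /=.
    case: ifPn => [/i0 ->|_]; first by rewrite normr0 oppr0.
    by case: ifPn => // /eqP ->; rewrite subr_ge0 ltW.
  rewrite oppr_ge0 le_eqVlt; apply/orP; left; apply/eqP/body_perp_eq0 => z.
  by rewrite SE dotC => -[].
move=> [[l j] _ [u [Ou su hu]]]; rewrite (@normal_unique S u)//.
  exists l; split => [p pl|].
    by have := hu (Some p); rewrite /= pl oppr_ge0 normr_le0 => /eqP.
  have := hu (Some l); rewrite /= ltnn eqxx subr_ge0; apply: lt_le_trans.
  by rewrite invr_gt0.
have /body_perp_eq0 : body_perp S u = 0; last by [].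
by apply/eqP; rewrite eq_le body_perp_ge0 -oppr_ge0 andbT; exact: (hu None).
Qed.

End Normals.

Section NullHyperplanes.
Variables (R : realType) (d : nat).
Notation E := 'rV[R]_(d.+1).
Implicit Types (u w x y : E) (S : sconvex R d).
Hypothesis d0 : (0 < d)%N.

Lemma great_subsphere_orth u : u != 0 -> great_subsphere d.-1 (orth_sphere u).
Proof.
move=> u0; exists (orthv u); split; first by rewrite dim_orthv// prednK.
exact: orth_sphere_orthv.
Qed.

Lemma measurable_orth_body (A : set (borel_sconvex R d)) : measurable A ->
  measurable [set u : borel_euclid R d | (@body R d @` A) (orth_sphere (u : E))].
Proof.
apply: measurable_body_in => [u|O oO].
  have := @perp_convex R d unit (fun=> u); rewrite (_ : perp_set _ = [set y | dot (u : E) y = 0])//.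
  by apply/seteqP; split => y; [move=> /(_ tt)|move=> h _].
rewrite (_ : [set t | _] = [set t | exists y : E, [/\ O y, sphere y &
     unit -> 0 <= - `|dot (t : E) y|]]); last first.
  apply/seteqP; split => u /= [y].
    by move=> [[/= uy sy] Oy]; exists y; split => // _; rewrite uy normr0 oppr0.
  move=> [Oy sy /(_ tt)]; rewrite oppr_ge0 normr_le0 => /eqP uy.
  by exists y.
apply: (@measurable_exists_sphere _ (borel_euclid R d) R d unit
  (fun _ u y => - `|dot (u : E) y|) O) => // _.
apply: (@caratheodory_comp _ _ _ _ _ (-%R)); first exact: opp_continuous.
apply: (@caratheodory_comp _ _ _ _ _ (fun x : R => `|x|)); first exact: norm_continuous.
exact: (dot_caratheodory (v := id)).
Qed.

Lemma measurable_closed (C : set E) : closed C -> measurable (C : set (borel_euclid R d)).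
Proof.
move=> cC; rewrite -[X in measurable X]setCK; apply: measurableC.
by apply: sub_sigma_algebra; exact: closed_openC.
Qed.

(** A unit vector [u] with [orth_sphere u] in [A] is plus or minus its normal, hence lies in
    [orth_sphere w], a null set of [kappa0]. Vectors off the unit sphere carry no mass. *)
Lemma null_hyperplane (kappa : probability (borel_sconvex R d) R) w
    (A : set (borel_sconvex R d)) : nondegenerate_directional kappa -> w != 0 ->
  measurable A ->
  (forall S, great_subsphere d.-1 S -> A S -> dot (normal S) w = 0) ->
  kappa A = 0%E.
Proof.
move=> [kappa0 [k1 _ kS kE]] w0 mA hA; rewrite kE//.
have mX := measurable_orth_body mA.
have mS : measurable (@sphere R d : set (borel_euclid R d)).
  by apply: measurable_closed; exact: sphere_closed.
have mW : measurable (orth_sphere w : set (borel_euclid R d)).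
  apply: measurable_closed; rewrite orth_sphere_orthv; apply: closedI.
    exact: vspace_closed.
  exact: sphere_closed.
apply/eqP; rewrite eq_le measure_ge0 andbT.
have XU : [set u | (@body R d @` A) (orth_sphere u)] `<=` ~` @sphere R d `|` orth_sphere w.
  move=> u [S AS SE]; have [su|nsu] := pselect (sphere u); last by left.
  right; split => //=.
  have gS : great_subsphere d.-1 S.
    by rewrite SE; apply: great_subsphere_orth; exact: sphere_neq0.
  have [sn ln Sn] := great_normalP d0 gS.
  have [uE|uE] : u = normal S \/ u = - normal S.
    by apply: orth_sphere_normal_unique => // x; rewrite -Sn SE => -[].
    by rewrite uE dotC hA.
  by rewrite uE dotNr dotC hA// oppr0.
apply: le_trans (le_measure kappa0 _ _ XU) _; rewrite ?inE//.
  by apply: measurableU => //; exact: measurableC.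
have k2 : kappa0 (~` @sphere R d) = 0%E.
  by rewrite probability_setC// k1 subee.
have k3 : kappa0 (orth_sphere w) = 0%E by apply: kS; exact: great_subsphere_orth.
have mSC : measurable (~` @sphere R d : set (borel_euclid R d)) by exact: measurableC.
have k4 : (kappa0 (~` @sphere R d) + kappa0 (orth_sphere w) <= 0)%E.
  by rewrite k2 k3 adde0.
exact: le_trans (measureU2 kappa0 mSC mW) k4.
Qed.

End NullHyperplanes.

(** * Comparison of laws across probability spaces, and gluing of families *)

Section LawUniqueness.
Context d1 d2 d3 (T1 : measurableType d1) (T2 : measurableType d2) (T : measurableType d3).
Variables (R : realType) (P1 : probability T1 R) (P2 : probability T2 R).
Variables (f1 : T1 -> T) (f2 : T2 -> T).
Hypotheses (mf1 : measurable_fun setT f1) (mf2 : measurable_fun setT f2).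

Lemma law_unique (G : set (set T)) : @measurable _ T = <<s G >> -> setI_closed G ->
  (forall A, G A -> P1 (f1 @^-1` A) = P2 (f2 @^-1` A)) ->
  forall A, measurable A -> P1 (f1 @^-1` A) = P2 (f2 @^-1` A).
Proof.
move=> GE GI GP A; rewrite GE.
have m1 B : measurable B -> measurable (f1 @^-1` B).
  by move=> mB; rewrite -[X in measurable X]setTI; exact: mf1.
have m2 B : measurable B -> measurable (f2 @^-1` B).
  by move=> mB; rewrite -[X in measurable X]setTI; exact: mf2.
apply: (dynkin_induction (P := [set A | P1 (f1 @^-1` A) = P2 (f2 @^-1` A)]) GE GI) => //=.
- by rewrite !preimage_setT !probability_setT.
- move=> B mB e.
  have -> : f1 @^-1` (~` B) = ~` (f1 @^-1` B) by [].
  have -> : f2 @^-1` (~` B) = ~` (f2 @^-1` B) by [].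
  rewrite probability_setC; last exact: m1.
  by rewrite probability_setC ?e//; exact: m2.
- move=> F mF tF e; rewrite !preimage_bigcup !measure_bigcup//.
  + by apply: eq_eseriesr => i _; exact: e.
  + by move=> i _; exact: m2.
  + by apply/trivIsetP => i j _ _ ij; move/trivIsetP : tF => /(_ i j Logic.I Logic.I ij) h;
      rewrite -preimage_setI h preimage_set0.
  + by move=> i _; exact: m1.
  + by apply/trivIsetP => i j _ _ ij; move/trivIsetP : tF => /(_ i j Logic.I Logic.I ij) h;
      rewrite -preimage_setI h preimage_set0.
Qed.

End LawUniqueness.

Section Rectangles.
Context d0 (T : measurableType d0) (n : nat).

Definition rectangles : set (set (n.-tuple T)) :=
  [set C | exists2 B : 'I_n -> set T, (forall i, measurable (B i)) &
     C = [set t | forall i, B i (tnth t i)]].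

Lemma rectanglesI : setI_closed rectangles.
Proof.
move=> _ _ [A mA ->] [B mB ->]; exists (fun i => A i `&` B i).
  by move=> i; exact: measurableI.
by apply/seteqP; split => [t [hA hB] i|t h]; split => // i; case: (h i).
Qed.

Lemma rectangles_measurable C : rectangles C -> measurable C.
Proof.
move=> [B mB ->]; rewrite (_ : [set t | _] = \bigcap_i (fun t => tnth t i) @^-1` B i).
  apply: countable_bigcap_measurable => i _.
  by rewrite -[X in measurable X]setTI; exact: measurable_tnth.
by apply/seteqP; split => [t h i _|t h i]; [exact: h|exact: (h i Logic.I)].
Qed.

Lemma measurable_tupleE : @measurable _ (n.-tuple T) = <<s rectangles >>.
Proof.
apply/seteqP; split; last first.
  apply: smallest_sub; first exact: sigma_algebra_measurable.
  exact: rectangles_measurable.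
apply: smallest_sub; first exact: smallest_sigma_algebra.
rewrite -bigcup_seq => A [i _ [B mB <-]].
apply: sub_sigma_algebra; exists (fun j => if j == i then B else setT).
  by move=> j; case: ifP => // _; exact: measurableT.
apply/seteqP; split => t.
  by move=> [_ Bt] j; case: eqP => // ->.
by move=> /(_ i); rewrite eqxx.
Qed.

End Rectangles.

Section Iid.
Variables (R : realType) (d : nat).
Notation E := 'rV[R]_(d.+1).
Hypothesis d_gt0 : (0 < d)%N.
Variable kappa : probability (borel_sconvex R d) R.

Definition normals d0 (Omega : measurableType d0) n
    (S : 'I_n -> Omega -> borel_sconvex R d) (w : Omega) : n.-tuple (borel_euclid R d) :=
  [tuple normal (S i w) | i < n].

Section OneFamily.
Context d0 (Omega : measurableType d0) (P : probability Omega R) (n : nat).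
Variable S : 'I_n -> Omega -> borel_sconvex R d.
Hypothesis hS : iid_great_hyperspheres P kappa S.

(** The values of [S i] are great hyperspheres for every outcome, so the trace [B'] determines the
    preimage exactly and not only up to a null set. *)
Lemma iid_preimage_normal i (B : set (borel_euclid R d)) : measurable B ->
  exists B' : set (borel_sconvex R d), [/\ measurable B',
    (forall K, great_subsphere d.-1 (body K) -> B (normal K) <-> B' K) &
    (fun w => normal (S i w)) @^-1` B = S i @^-1` B'].
Proof.
move=> /(normal_trace d_gt0)[B' [mB' h]]; exists B'; split => //.
by case: hS => gS _ _; apply/seteqP; split => w /= /(h (S i w) (gS i w)).
Qed.

Lemma measurable_normals : measurable_fun setT (normals S).
Proof.
apply/measurable_fun_tnthP => i _ B mB; rewrite setTI.
have [B' [mB' _ BE]] := iid_preimage_normal i mB.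
rewrite (_ : _ @^-1` _ = S i @^-1` B').
  by case: hS => _ /(_ i)[mS _] _; rewrite -[X in measurable X]setTI; exact: mS.
by rewrite -BE; apply/seteqP; split => w /=; rewrite tnth_mktuple.
Qed.

Lemma measurable_normal i : measurable_fun setT (fun w => normal (S i w) : borel_euclid R d).
Proof.
have := (measurable_fun_tnthP (normals S)).1 measurable_normals i.
by apply: eq_measurable_fun => w _ /=; rewrite tnth_mktuple.
Qed.

Lemma iid_rectangle (B : 'I_n -> set (borel_sconvex R d)) : (forall i, measurable (B i)) ->
  P [set w | forall i, B i (S i w)] = (\prod_(i < n) kappa (B i))%E.
Proof.
move=> mB; case: hS => _ law ind.
rewrite (_ : [set w | _] = \bigcap_i (S i @^-1` B i)).
  by rewrite ind//; apply: eq_bigr => i _; case: (law i) => _ ->.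
by apply/seteqP; split => [w h i _|w h i]; [exact: h|exact: (h i Logic.I)].
Qed.

Lemma normal_orth i w : body (S i w) = orth_sphere (normal (S i w)).
Proof. by case: hS => gS _ _; case: (great_normalP d_gt0 (gS i w)). Qed.

Lemma normal_neq0 i w : normal (S i w) != 0.
Proof.
by case: hS => gS _ _; case: (great_normalP d_gt0 (gS i w)) => /sphere_neq0.
Qed.

End OneFamily.

(** On a rectangle, each factor is traded for its trace on great hyperspheres; independence then
    yields the same product of [kappa]-values on both spaces. Rectangles form a generating
    pi-system. *)
Lemma normals_law d1 d2 (Omega1 : measurableType d1) (Omega2 : measurableType d2)
    (P1 : probability Omega1 R) (P2 : probability Omega2 R) n
    (S1 : 'I_n -> Omega1 -> borel_sconvex R d) (S2 : 'I_n -> Omega2 -> borel_sconvex R d) :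
  iid_great_hyperspheres P1 kappa S1 -> iid_great_hyperspheres P2 kappa S2 ->
  forall C, measurable C -> P1 (normals S1 @^-1` C) = P2 (normals S2 @^-1` C).
Proof.
move=> h1 h2; apply: law_unique (@measurable_tupleE _ _ _) (@rectanglesI _ _ _) _.
- exact: measurable_normals h1.
- exact: measurable_normals h2.
move=> _ [B mB ->].
have hB i : exists B' : set (borel_sconvex R d), measurable B' /\
    forall K : sconvex R d, great_subsphere d.-1 (body K) -> B i (normal K) <-> B' K.
  by have [B' ?] := normal_trace d_gt0 (mB i); exists B'.
have [B' hB'] := choice hB.
have law d0 (Omega : measurableType d0) (P : probability Omega R) S :
    iid_great_hyperspheres P kappa S ->
    P (normals S @^-1` [set t | forall i, B i (tnth t i)]) = (\prod_(i < n) kappa (B' i))%E.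
  move=> hS; rewrite -(iid_rectangle hS); last by move=> i; case: (hB' i).
  congr (P _); case: hS => gS _ _.
  apply/seteqP; split => w /= h i; have := h i.
    by rewrite tnth_mktuple => /((hB' i).2 (S i w) (gS i w)).
  by move=> /((hB' i).2 (S i w) (gS i w)); rewrite tnth_mktuple.
by rewrite (law _ _ _ _ h1) (law _ _ _ _ h2).
Qed.

Section Glue.
Context d1 d2 (Omega1 : measurableType d1) (Omega2 : measurableType d2).
Variables (P1 : probability Omega1 R) (P2 : probability Omega2 R).
Variables (n m N : nat).
Variables (S1 : 'I_n -> Omega1 -> borel_sconvex R d) (S2 : 'I_m -> Omega2 -> borel_sconvex R d).
Variable h : 'I_N -> 'I_n + 'I_m.
Hypothesis h_inj : injective h.
Hypothesis hS1 : iid_great_hyperspheres P1 kappa S1.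
Hypothesis hS2 : iid_great_hyperspheres P2 kappa S2.

(** The map [h] decides which of two independent families supplies index [i]; its injectivity
    prevents a hypersphere from being used twice. *)
Definition glue_families (i : 'I_N) (w : Omega1 * Omega2) : borel_sconvex R d :=
  match h i with inl a => S1 a w.1 | inr b => S2 b w.2 end.

Let glue_rectangle (A : 'I_N -> set (borel_sconvex R d)) : (forall i, measurable (A i)) ->
  (P1 \x P2)%E [set w | forall i, A i (glue_families i w)] = (\prod_(i < N) kappa (A i))%E.
Proof.
move=> mA.
(* Indices outside the image of [h] receive the whole space, so the event becomes a full rectangle
   over both families and the extra factors are 1. *)
pose A' (c : 'I_n + 'I_m) := if [pick i | h i == c] is Some i then A i else setT.
have A'h i : A' (h i) = A i.
  by rewrite /A'; case: pickP => [j /eqP/h_inj ->//|/(_ i)]; rewrite eqxx.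
have mA' c : measurable (A' c).
  by rewrite /A'; case: pickP => // _; exact: measurableT.
have -> : [set w | forall i, A i (glue_families i w)] =
    [set w | forall a, A' (inl a) (S1 a w)] `*` [set w | forall b, A' (inr b) (S2 b w)].
  apply/seteqP; split => -[w1 w2] /=.
    move=> hw; split => [a|b]; rewrite /A'; case: pickP => // i /eqP hi;
    by have := hw i; rewrite /glue_families hi.
  move=> [h1 h2] i; rewrite -A'h /glue_families; case: (h i) => [a|b]; [exact: h1|exact: h2].
have mpre d0 (Omega : measurableType d0) (P : probability Omega R) p
    (S : 'I_p -> Omega -> borel_sconvex R d) (B : 'I_p -> set (borel_sconvex R d)) :
    iid_great_hyperspheres P kappa S -> (forall i, measurable (B i)) ->
    measurable [set w | forall i, B i (S i w)].
  move=> [_ law _] mB; rewrite (_ : [set w | _] = \bigcap_i (S i @^-1` B i)).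
    apply: countable_bigcap_measurable => i _; rewrite -[X in measurable X]setTI.
    by case: (law i) => mS _; exact: mS.
  by apply/seteqP; split => [w hw i _|w hw i]; [exact: hw|exact: (hw i Logic.I)].
have m1 := mpre _ _ _ _ _ _ hS1 (fun a => mA' (inl a)).
have m2 := mpre _ _ _ _ _ _ hS2 (fun b => mA' (inr b)).
have e1 := iid_rectangle hS1 (fun a => mA' (inl a)).
have e2 := iid_rectangle hS2 (fun b => mA' (inr b)).
apply: (eq_trans (product_measure1E P1 P2 m1 m2)).
transitivity ((\prod_a kappa (A' (inl a))) * \prod_b kappa (A' (inr b)))%E.
  by congr (_ * _)%E; [exact: e1|exact: e2].
transitivity (\prod_(c : 'I_n + 'I_m) kappa (A' c))%E; first by rewrite big_sumType.
rewrite (bigID (fun c => c \in codom h))/=.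
rewrite [X in (_ * X)%E]big1 ?mule1; last first.
  move=> c hc; rewrite /A'; case: pickP => [i /eqP ci|_]; last exact: probability_setT.
  by rewrite -ci codom_f in hc.
have pickh i : [pick j | h j == h i] = Some i.
  by case: pickP => [j /eqP/h_inj ->//|/(_ i)]; rewrite eqxx.
rewrite (reindex_omap h (fun c => [pick i | h i == c])) /=.
  apply: eq_big => [i|i _]; last by rewrite A'h.
  by rewrite codom_f pickh eqxx.
by move=> c /codomP[i ->]; rewrite pickh.
Qed.

Lemma iid_glue : iid_great_hyperspheres (P1 \x P2)%E kappa glue_families.
Proof.
have gl i : has_law (P1 \x P2)%E (glue_families i) kappa.
  split.
    rewrite /glue_families; case: (h i) => [a|b].
      by case: hS1 => _ /(_ a)[mS _] _; exact: (measurableT_comp mS measurable_fst).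
    by case: hS2 => _ /(_ b)[mS _] _; exact: (measurableT_comp mS measurable_snd).
  move=> A mA; rewrite /glue_families; case: (h i) => [a|b].
    rewrite (_ : _ @^-1` A = (S1 a @^-1` A) `*` setT); last first.
      by apply/seteqP; split => -[x y] //= [].
    case: hS1 => _ /(_ a)[mS law] _.
    have mSA : measurable (S1 a @^-1` A) by rewrite -[X in measurable X]setTI; exact: mS.
    transitivity (P1 (S1 a @^-1` A) * P2 setT)%E; first exact: product_measure1E.
    by rewrite probability_setT mule1 law.
  rewrite (_ : _ @^-1` A = setT `*` (S2 b @^-1` A)); last first.
    by apply/seteqP; split => -[x y] //= [].
  case: hS2 => _ /(_ b)[mS law] _.
  have mSA : measurable (S2 b @^-1` A) by rewrite -[X in measurable X]setTI; exact: mS.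
  transitivity (P1 setT * P2 (S2 b @^-1` A))%E; first exact: product_measure1E.
  by rewrite probability_setT mul1e law.
split => //.
  move=> i w; rewrite /glue_families; case: (h i) => [a|b]; [by case: hS1|by case: hS2].
move=> A mA; rewrite (_ : \bigcap_i _ = [set w | forall i, A i (glue_families i w)]); last first.
  by apply/seteqP; split => [w hw i|w hw i _]; [exact: (hw i Logic.I)|exact: hw].
apply: (eq_trans (glue_rectangle mA)); apply: eq_bigr => i _.
by case: (gl i) => _ e; apply: esym; exact: e.
Qed.

End Glue.
End Iid.

(** * Almost sure general position *)

Section GenericTuples.
Variables (R : realType) (d n : nat).
Notation E := 'rV[R]_(d.+1).
Implicit Types (V : {vspace E}) (J : {set 'I_n}) (t : n.-tuple (borel_euclid R d)).

(** The sphere of [V] is the only cell of the empty arrangement. *)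
Lemma vsphere_convex V : (0 < \dim V)%N -> sph_convex (vsphere V).
Proof.
move=> V0; have := @cell_sph_convex R d V 0 (fun=> 0) [ffun=> false].
have -> : cell (vsphere V) (fun _ : 'I_0 => 0) [ffun=> false] = vsphere V.
  by apply/seteqP; split => [x []//|x sx]; split => // -[].
apply; apply/realizable_vsphere => //.
by exists 0; split; [exact: mem0v|case].
Qed.

Lemma orths_vsphere (u : 'I_n -> E) V J : orths u V J != 0%VS <->
  exists2 y, vsphere V y & forall i, i \in J -> dot (u i) y = 0.
Proof.
split => [W0|[y [yV sy] h]].
  have p0 : vpick (orths u V J) != 0 by rewrite vpick0.
  have /memv_orths[pV ph] := memv_pick (orths u V J).
  exists (normalize (vpick (orths u V J))).
    by split; [rewrite /= rpredZ|exact: normalize_sphere].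
  by move=> i iJ; rewrite dotZr ph// mulr0.
apply/eqP => W0; have : y \in orths u V J by apply/memv_orths.
by rewrite W0 memv0 (negbTE (sphere_neq0 sy)).
Qed.

Definition degenerate V J (j : 'I_n) : set (n.-tuple (borel_euclid R d)) :=
  [set t | (exists2 y, vsphere V y & forall i, i \in J -> dot (tnth t i : E) y = 0) /\
    forall y, vsphere V y -> (forall i, i \in J -> dot (tnth t i : E) y = 0) ->
      dot (tnth t j : E) y = 0].

Lemma not_genericP V t : ~ generic (fun i => tnth t i : E) V ->
  exists J j, j \notin J /\ degenerate V J j t.
Proof.
move=> ng; apply: contrapT => nd; apply: ng => J j jJ W0.
apply: contrapT => ny; apply: nd; exists J, j; split => //; split.
  exact/orths_vsphere.
move=> y [yV sy] h; apply: contrapT => /eqP uy; apply: ny; exists y => //.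
exact/memv_orths.
Qed.

Lemma measurable_degenerate V J j : measurable (degenerate V J j).
Proof.
have [V0|] := posnP (\dim V).
  rewrite (_ : degenerate V J j = set0)//; apply/seteqP; split => // t [[y [/= yV sy]] _] _.
  move/eqP: V0; rewrite dimv_eq0 => /eqP V0; rewrite V0 memv0 in yV.
  by rewrite (negbTE (sphere_neq0 sy)) in yV.
move=> V0; pose L : n.-tuple (borel_euclid R d) -> borel_sconvex R d :=
  fun=> SConvex (vsphere_convex V0).
pose c i (t : n.-tuple (borel_euclid R d)) (y : E) : R :=
  if i \in J then - `|dot (tnth t i : E) y| else 0.
have ndotC i : caratheodory (fun (t : n.-tuple (borel_euclid R d)) (y : E) => `|dot (tnth t i : E) y|).
  apply: (@caratheodory_comp _ _ _ _ _ (fun x : R => `|x|)); first exact: norm_continuous.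
  apply: (dot_caratheodory (v := fun t => tnth t i)); exact: measurable_tnth.
have cC i : caratheodory (c i).
  rewrite /c; case: (i \in J); last first.
    by apply: (@caratheodory_cst _ _ _ _ (fun=> 0)) => u; exact: cst_continuous.
  by apply: (@caratheodory_comp _ _ _ _ _ (-%R)); first exact: opp_continuous.
have c0 t y : (forall i, 0 <= c i t y) <-> forall i, i \in J -> dot (tnth t i : E) y = 0.
  rewrite /c; split => h i.
    by move=> iJ; have := h i; rewrite iJ oppr_ge0 normr_le0 => /eqP.
  by case: ifPn => // /h ->; rewrite normr0 oppr0.
(* [F1] says that the flat of [J] is nonzero. [F2] below says that [dot (tnth t j)] is nonzero
   somewhere on its unit sphere, with a margin [1 / (k + 1)] to keep the constraints closed. *)
pose F1 := [set t | exists y, [/\ setT y, body (L t) y & forall i, 0 <= c i t y]].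
pose e (k : nat) (o : option 'I_n) t (y : E) : R :=
  if o is Some i then c i t y else `|dot (tnth t j : E) y| - k.+1%:R^-1.
pose F2 := \bigcup_k [set t | exists y, [/\ setT y, body (L t) y & forall o, 0 <= e k o t y]].
have -> : degenerate V J j = F1 `\` F2.
  apply/seteqP; split => t.
    move=> [[y Vy hy] hj]; split; first by exists y; split => //; exact/c0.
    move=> [k _ [z [_ Vz hz]]].
    have z0 : forall i, i \in J -> dot (tnth t i : E) z = 0.
      by apply/c0 => i; exact: (hz (Some i)).
    by have := hz None; rewrite /= hj// normr0 sub0r oppr_ge0 leNgt invr_gt0 ltr0n.
  move=> [[y [_ Vy /c0 hy]] nF2]; split; first by exists y.
  move=> z Vz hz; apply: contrapT => /eqP; rewrite -normr_gt0 => jz; apply: nF2.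
  have [k hk] := small_ratio jz; exists k => //; exists z; split => // -[i|] /=.
    by move: i; apply/c0.
  by rewrite subr_ge0 ltW.
apply: measurableD.
  by apply: measurable_exists_body; [exact: measurable_cst|exact: cC|exact: openT].
apply: bigcupT_measurable => k.
apply: measurable_exists_body; [exact: measurable_cst| |exact: openT].
case => [i|]; first exact: cC.
apply: (@caratheodory_comp _ _ R d (fun t (y : E) => `|dot (tnth t j : E) y|)
  (fun x : R => x - k.+1%:R^-1)); last exact: ndotC.
move=> x; exact: (@cvgB R R^o R^o (nbhs x) _ id (fun=> _) _ _ cvg_id (cvg_cst _)).
Qed.

End GenericTuples.

Section AlmostSurelyGeneric.
Variables (R : realType) (d : nat).
Notation E := 'rV[R]_(d.+1).
Hypothesis d_gt0 : (0 < d)%N.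
Variable kappa : probability (borel_sconvex R d) R.
Hypothesis hkappa : nondegenerate_directional kappa.
Context d0 (Omega : measurableType d0) (P : probability Omega R) (n : nat).
Variable S : 'I_n -> Omega -> borel_sconvex R d.
Hypothesis hS : iid_great_hyperspheres P kappa S.

Lemma normal_orthogonal_null (j : 'I_n) (y : E) (D : set Omega) : y != 0 -> measurable D ->
  D `<=` [set w | dot (normal (S j w)) y = 0] -> P D = 0%E.
Proof.
move=> y0 mD DS; pose B : set (borel_euclid R d) := [set u | dot (u : E) y = 0].
have mB : measurable B.
  apply: measurable_closed; rewrite (_ : B = [set` orthv y]); first exact: vspace_closed.
  by apply/seteqP; split => u; rewrite /B /= memv_orthv dotC => /eqP.
have [B' [mB' hB' BE]] := iid_preimage_normal d_gt0 hS j mB.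
have k0 : kappa B' = 0%E.
  by apply: null_hyperplane hkappa y0 mB' _ => // K gK /(hB' K gK).
have [mSj law] : has_law P (S j) kappa by case: hS.
have mSB : measurable (S j @^-1` B') by rewrite -[X in measurable X]setTI; exact: mSj.
apply/eqP; rewrite eq_le measure_ge0 andbT -k0 -law//.
apply: le_measure; rewrite ?inE// -BE.
exact: DS.
Qed.

(* The [j]-th hypersphere is replaced by an independent copy; conditionally on
   the others, it has to contain a fixed point. *)
Lemma degenerate_null V (J : {set 'I_n}) j : j \notin J ->
  P (normals S @^-1` degenerate V J j) = 0%E.
Proof.
move=> jJ; pose h (i : 'I_n) : 'I_n + 'I_n := if i == j then inr i else inl i.
have hI : injective h.
  by move=> i i'; rewrite /h; do 2 case: ifPn => ?; move=> [].
have gl := iid_glue hI hS hS.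
have mD := @measurable_degenerate R d n V J j.
rewrite (normals_law d_gt0 hS gl mD).
have mG : measurable (normals (glue_families S S h) @^-1` degenerate V J j).
  by rewrite -[X in measurable X]setTI; exact: (measurable_normals d_gt0 gl).
change ((\int[P]_w P (xsection (normals (glue_families S S h) @^-1` degenerate V J j) w))%E = 0%E).
rewrite (eq_integral (fun=> 0%E)) ?integral0// => w _.
have [[y [yV sy] hy]|ny] := pselect (exists2 y, vsphere V y &
    forall i, i \in J -> dot (normal (S i w)) y = 0).
  apply: (@normal_orthogonal_null j y); first exact: sphere_neq0.
    exact: measurable_xsection.
  move=> w' /xsectionP /= [_ /(_ y (conj yV sy))].
  rewrite tnth_mktuple /glue_families /h eqxx /=; apply => i iJ.
  rewrite tnth_mktuple; case: ifPn => [/eqP ij|_]; last exact: hy.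
  by rewrite -ij iJ in jJ.
rewrite (_ : xsection _ w = set0) ?measure0//; apply/seteqP; split => // w' /xsectionP /=.
move=> [[y Vy hy] _]; apply: ny; exists y => // i iJ.
have := hy i iJ; rewrite tnth_mktuple /glue_families /h; case: ifPn => // /eqP ij.
by rewrite -ij iJ in jJ.
Qed.

Lemma generic_ae V : {ae P, forall w, generic (fun i => normal (S i w)) V}.
Proof.
pose Q (p : {set 'I_n} * 'I_n) := p.2 \notin p.1.
pose F (c : nat) : set Omega := if choice.unpickle c is Some p then
  if Q p then normals S @^-1` degenerate V p.1 p.2 else set0 else set0.
have : P.-negligible (\bigcup_c F c).
  apply: negligible_bigcup => c; rewrite /F; case: choice.unpickle => [p|]; last exact: negligible_set0.
  case: ifPn => [pQ|_]; last exact: negligible_set0.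
  apply/negligibleP; last exact: degenerate_null.
  rewrite -[X in measurable X]setTI.
  by apply: (measurable_normals d_gt0 hS) => //; exact: measurable_degenerate.
apply: negligibleS => w /= ng.
have ng' : ~ generic (fun i => tnth (normals S w) i : E) V.
  by under eq_fun do rewrite tnth_mktuple.
have [J [j [jJ dj]]] := not_genericP ng'.
by exists (choice.pickle (J, j)) => //; rewrite /F choice.pickleK /Q /= jJ.
Qed.

End AlmostSurelyGeneric.

(** * The laws of the typical face and of the typical cell *)

Section NonmeasurableIntegral.
Local Open Scope ereal_scope.
Context d0 (T : measurableType d0) (R : realType) (mu : {measure set T -> \bar R}).
Implicit Types f g : T -> \bar R.

(** For nonnegative functions the integral is a supremum over simple functions below, which is
    monotone without any measurability. *)
Lemma le_integral_nonmeasurable f g : (forall x, 0 <= f x) -> (forall x, f x <= g x) ->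
  \int[mu]_x f x <= \int[mu]_x g x.
Proof.
move=> f0 fg; have g0 x : 0 <= g x by exact: le_trans (fg x).
rewrite !ge0_integralTE//; apply: ge_ereal_sup => _ [h hf <-].
apply: ereal_sup_ubound; exists h => // x /=; exact: le_trans (hf x) (fg x).
Qed.

(* The proportions that define the typical objects are only known to agree almost
   surely with measurable functions. *)
Lemma ae_eq_integral_nonmeasurable f g : (forall x, 0 <= f x) -> (forall x, 0 <= g x) ->
  measurable_fun setT g -> {ae mu, forall x, f x = g x} ->
  \int[mu]_x f x = \int[mu]_x g x.
Proof.
move=> f0 g0 mg [N [mN N0 fgN]].
have off x : x \notin N -> f x = g x.
  by move=> xN; apply: contrapT => fg; move/negP: xN; apply; apply/mem_set/fgN.
(* With [c] equal to [+oo] and to 0, this squeezes [f] between two measurable functions that have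
   the integral of [g]. *)
pose patchN (c : \bar R) x := if x \in N then c else g x.
have mpatch c : measurable_fun setT (patchN c).
  apply: measurable_fun_ifT => //; apply: (measurable_fun_bool true).
  by rewrite setTI (_ : _ @^-1` _ = N)//; apply/seteqP; split => x /=;
    [move=> /set_mem|move=> /mem_set].
have eqpatch c : 0 <= c -> \int[mu]_x patchN c x = \int[mu]_x g x.
  move=> c0; apply: ge0_ae_eq_integral => //.
    by move=> x _; rewrite /patchN; case: ifP.
  exists N; split => // x /= /not_implyP[_]; rewrite /patchN.
  by case: ifPn => // /set_mem.
apply/eqP; rewrite eq_le; apply/andP; split.
  rewrite -(eqpatch +oo)//; apply: le_integral_nonmeasurable => // x.
  by rewrite /patchN; case: ifPn => [_|/off ->//]; exact: leey.
rewrite -(eqpatch 0)//; apply: le_integral_nonmeasurable => x.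
  by rewrite /patchN; case: ifP.
by rewrite /patchN; case: ifPn => [_|/off ->].
Qed.

End NonmeasurableIntegral.

Section Strata.
Variables (R : realType) (d n : nat).
Notation E := 'rV[R]_(d.+1).

(** A bound valid without general position. It makes the sphere of a stratum nonempty for every
    outcome, so that [stratum_body] is a total function. *)
Lemma dim_orths_ge (u : 'I_n -> E) V J : (\dim V <= \dim (orths u V J) + #|J|)%N.
Proof.
elim: {J}#|J| {-2}J (erefl #|J|) => [|c IH] J cJ.
  by move/eqP: cJ; rewrite cards_eq0 => /eqP ->; rewrite orths0 cards0 addn0.
have [j jJ] : exists j, j \in J by apply/set0Pn; rewrite -cards_eq0 cJ.
have cJ' : #|J :\ j| = c by move: cJ; rewrite (cardsD1 j) jJ => -[].
apply: leq_trans (IH _ cJ') _; rewrite cJ' cJ -{2}(finset.setD1K jJ) orthsU1 addnS -addSn leq_add2r.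
set W := orths u V _; rewrite -(limg_ker_dim (linfun (mulmxr (u j)^T : E -> 'M[R]_1)) W) -/(orthv (u j)).
rewrite -[leqRHS]addn1 leq_add2l.
by apply: leq_trans (dimvS (subvf _)) _; rewrite dimvf /dim /= mul1n.
Qed.

Variable I : {set 'I_n}.
Hypothesis cI : (#|I| <= d)%N.

Lemma stratum_dim (u : 'I_n -> E) : (0 < \dim (orths u fullv I))%N.
Proof.
have := dim_orths_ge u fullv I; rewrite dimvf /dim /= mul1n => h.
by rewrite -(ltn_add2r #|I|) add0n; apply: leq_trans h; rewrite ltnS.
Qed.

Definition stratum_body (t : n.-tuple (borel_euclid R d)) : borel_sconvex R d :=
  SConvex (vsphere_convex (stratum_dim (fun i => tnth t i : E))).

Lemma measurable_stratum_body : measurable_fun setT stratum_body.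
Proof.
apply: measurable_to_sconvex => // p; rewrite setTI.
rewrite (_ : [set t | _] = [set t | exists y : E, [/\ ratball p y, sphere y &
    forall i, 0 <= if i \in I then - `|dot (tnth t i : E) y| else 0]]).
  apply: (@measurable_exists_sphere _ (n.-tuple (borel_euclid R d)) R d 'I_n (fun i t y =>
    if i \in I then - `|dot (tnth t i : E) y| else 0) (ratball p)) => [i|].
    case: (i \in I); last first.
      by apply: (@caratheodory_cst _ _ _ _ (fun=> 0)) => u; exact: cst_continuous.
    apply: (@caratheodory_comp _ _ _ _ _ (-%R)); first exact: opp_continuous.
    apply: (@caratheodory_comp _ _ _ _ _ (fun x : R => `|x|)); first exact: norm_continuous.
    by apply: (dot_caratheodory (v := fun t => tnth t i)); exact: measurable_tnth.
  exact: ratball_open.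
apply/seteqP; split => t /= [y].
  move=> [[/memv_orths[_ hy] sy] py]; exists y; split => // i.
  by case: ifPn => // /hy ->; rewrite normr0 oppr0.
move=> [py sy hy]; exists y; split => //; split => //; apply/memv_orths.
split; first exact: memvf.
by move=> i iI; have := hy i; rewrite iI oppr_ge0 normr_le0 => /eqP.
Qed.

End Strata.

Section CellLaw.
Local Open Scope ereal_scope.
Variables (R : realType) (d k : nat).
Notation E := 'rV[R]_(d.+1).
Hypothesis d_gt0 : (0 < d)%N.
Variable kappa : probability (borel_sconvex R d) R.
Hypothesis hkappa : nondegenerate_directional kappa.
Context d2 (Omega2 : measurableType d2) (P2 : probability Omega2 R) (m : nat).
Variable S2 : 'I_m -> Omega2 -> borel_sconvex R d.
Hypothesis hS2 : iid_great_hyperspheres P2 kappa S2.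

(* [nregions m k.+1] is the number of cells of a generic section with a
   [k]-dimensional great subsphere. *)
Definition cell_ratio (A : set (borel_sconvex R d)) (L : borel_sconvex R d)
    (v : 'I_m -> borel_euclid R d) : R :=
  (numcells (body L) (v : 'I_m -> E) A)%:R / (nregions m k.+1)%:R.

(** The explicit candidate for the conditional law; for a [k]-dimensional great subsphere [L] it is
    the law of the typical cell of the section. *)
Definition cell_law (A : set (borel_sconvex R d)) (L : borel_sconvex R d) : \bar R :=
  \int[P2]_w (cell_ratio A L (fun j => normal (S2 j w)))%:E.

Lemma cell_ratio_ge0 A L v : (0 <= cell_ratio A L v)%R.
Proof. by rewrite divr_ge0. Qed.

Lemma measurable_cell_ratio d0 (T : measurableType d0) (A : set (borel_sconvex R d))
    (L : T -> borel_sconvex R d) (v : T -> 'I_m -> borel_euclid R d) :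
  measurable A -> measurable_fun setT L ->
  (forall j, measurable_fun setT (fun t => v t j)) ->
  measurable_fun setT (fun t => (cell_ratio A (L t) (v t))%:E).
Proof.
move=> mA mL mv; apply/measurable_EFinP.
have mN := @measurable_numcells _ _ R d L m v mL mv A mA.
have := @measurable_realfun.measurable_funM _ _ R setT _ (fun=> (nregions m k.+1)%:R^-1)%R mN.
by apply; exact: measurable_cst.
Qed.

Lemma cell_law_ge0 A L : 0 <= cell_law A L.
Proof. by apply: integral_ge0 => w _; rewrite lee_fin cell_ratio_ge0. Qed.

Lemma measurable_cell_law A : measurable A -> measurable_fun setT (cell_law A).
Proof.
move=> mA; apply: (measurable_fun_fubini_tonelli_F (m2 := P2)
  (fun z : borel_sconvex R d * Omega2 => (cell_ratio A z.1 (fun j => normal (S2 j z.2)))%:E)).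
  apply: (measurable_cell_ratio (L := fst) (v := fun z j => normal (S2 j z.2))) => //.
  move=> j; apply: (measurableT_comp (f := fun w => normal (S2 j w) : borel_euclid R d)).
    exact: (measurable_normal d_gt0 hS2).
  exact: measurable_snd.
by move=> z; rewrite lee_fin cell_ratio_ge0.
Qed.

Lemma great_subsphereE (L : sconvex R d) : great_subsphere k L ->
  exists2 V : {vspace E}, \dim V = k.+1 & body L = vsphere V.
Proof. by move=> [V [dV LE]]; exists V. Qed.

Lemma great_vsphere (V : {vspace E}) : \dim V = k.+1 -> great_subsphere k (vsphere V).
Proof. by move=> dV; exists V. Qed.

(** For fixed [L] the normals are almost surely generic relative to the span of [L], which makes the
    denominator the constant [nregions m k.+1]. *)
Lemma section_proportion_ae (L : sconvex R d) A : great_subsphere k L ->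
  {ae P2, forall w, proportion (tess_section L (random_tessellation S2 w)) A =
    cell_ratio A L (fun j => normal (S2 j w))}.
Proof.
move=> /great_subsphereE[V dV LE].
have := generic_ae d_gt0 hkappa hS2 V; apply: filterS => w gV.
rewrite /proportion /cell_ratio LE.
have -> : random_tessellation S2 w = tessellation (fun j => orth_sphere (normal (S2 j w))).
  by rewrite /random_tessellation; congr tessellation; apply/funext => j;
    exact: (normal_orth d_gt0 hS2).
have n0 j : normal (S2 j w) != 0%R by exact: (normal_neq0 d_gt0 hS2).
by rewrite card_section_in ?card_section ?dV.
Qed.

Lemma typical_section_cell_law (L : sconvex R d) (Zcell : Omega2 -> borel_sconvex R d) A :
  great_subsphere k L -> typical_section_cell P2 L S2 Zcell -> measurable A ->
  P2 (Zcell @^-1` A) = cell_law A L.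
Proof.
move=> gL [mZ hZ] mA.
have := hZ A setT mA; rewrite preimage_setT setIT => ->//.
apply: ae_eq_integral_nonmeasurable.
- by move=> w; rewrite lee_fin divr_ge0.
- by move=> w; rewrite lee_fin cell_ratio_ge0.
- apply: (measurable_cell_ratio (L := fun=> L)) => // j.
  exact: (measurable_normal d_gt0 hS2).
- by have := section_proportion_ae A gL; apply: filterS => w ->.
Qed.

Lemma cell_law_setT (L : sconvex R d) : great_subsphere k L -> cell_law setT L = 1.
Proof.
move=> /great_subsphereE[V dV LE]; rewrite /cell_law.
rewrite (@ae_eq_integral_nonmeasurable _ _ _ _ _ (cst 1)) ?integral_cst//=.
- by rewrite mul1e probability_setT.
- by move=> w; rewrite lee_fin cell_ratio_ge0.
have := generic_ae d_gt0 hkappa hS2 V; apply: filterS => w gV.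
rewrite /cell_ratio LE numcells_total ?dV//.
by rewrite divff// pnatr_eq0 -lt0n nregions_gt0.
Qed.

(** Every cell of the section spans the same space as [L], so its direction is [L], and the
    condition on the direction is all or nothing. *)
Lemma cell_law_direction (L : sconvex R d) A B : great_subsphere k L ->
  cell_law (A `&` (@direction R d) @^-1` B) L = (\1_B L)%:E * cell_law A L.
Proof.
move=> /great_subsphereE[V dV LE].
have dir (K : sconvex R d) v (s : {ffun 'I_m -> bool}) : realizable (body L) v s ->
    body K = cell (body L) v s -> direction K = L.
  move=> r KE; apply: sconvexP; rewrite /direction /= KE LE linear_hull_cell//.
  by rewrite -LE.
rewrite /cell_law indicE; case: (boolP (L \in B)) => LB; last first.
  rewrite mul0e (eq_integral (fun=> 0)) ?integral0// => w _.
  rewrite /cell_ratio (_ : numcells _ _ _ = 0%N) ?mul0r//.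
  apply: eq_card0 => s; rewrite inE /=; apply/asboolPn => -[r [K [AK BK] KE]].
  by move/negP: LB; apply; apply/mem_set; move: BK; rewrite /= (dir _ _ _ r KE).
rewrite mul1e; apply: eq_integral => w _; rewrite /cell_ratio; congr ((_%:R / _)%:E).
apply: eq_card => s; rewrite !inE; apply: asbool_equiv_eq; split => -[r [K]].
  by move=> [AK _] KE; split => //; exists K.
move=> AK KE; split => //; exists K => //; split => //=.
by rewrite (dir _ _ _ r KE); exact/set_mem.
Qed.

End CellLaw.

Section FaceLaw.
Local Open Scope ereal_scope.
Variables (R : realType) (d k n m : nat).
Notation E := 'rV[R]_(d.+1).
Hypothesis kd : (k < d)%N.
Hypothesis mn : (m + (d - k) = n)%N.
Variable kappa : probability (borel_sconvex R d) R.
Hypothesis hkappa : nondegenerate_directional kappa.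

Let d_gt0 : (0 < d)%N := leq_ltn_trans (leq0n k) kd.

Context d2 (Omega2 : measurableType d2) (P2 : probability Omega2 R).
Variable S2 : 'I_m -> Omega2 -> borel_sconvex R d.
Hypothesis hS2 : iid_great_hyperspheres P2 kappa S2.

Context d3 (Omega3 : measurableType d3) (P3 : probability Omega3 R).
Variable S3 : 'I_(d - k) -> Omega3 -> borel_sconvex R d.
Hypothesis hS3 : iid_great_hyperspheres P3 kappa S3.

Let cT : (#|[set: 'I_(d - k)]%SET| <= d)%N.
Proof. by rewrite cardsT card_ord leq_subr. Qed.

(** The intersection whose law is [kappak], built from the normals so as to be a body for every
    outcome; it has dimension [k] only almost surely. *)
Definition common_sphere (w : Omega3) : borel_sconvex R d := stratum_body cT (normals S3 w).

Lemma common_sphereE w : body (common_sphere w) = \bigcap_i (body (S3 i w)).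
Proof.
rewrite /= -/(stratum _ _) stratumE; apply/seteqP; split => y.
  move=> [sy hy] i _; rewrite (normal_orth d_gt0 hS3); split => //=.
  by have := hy i; rewrite inE tnth_mktuple; apply.
move=> hy; have i0 : 'I_(d - k) by apply: (Ordinal (m := 0)); rewrite subn_gt0.
split; first by have := hy i0 Logic.I; rewrite (normal_orth d_gt0 hS3) => -[].
move=> i _; rewrite tnth_mktuple.
by have := hy i Logic.I; rewrite (normal_orth d_gt0 hS3) => -[].
Qed.

Lemma measurable_common_sphere : measurable_fun setT common_sphere.
Proof.
exact: measurableT_comp (@measurable_stratum_body R d _ _ cT) (measurable_normals d_gt0 hS3).
Qed.

Lemma common_sphere_great : {ae P3, forall w, great_subsphere k (body (common_sphere w))}.
Proof.
have := generic_ae d_gt0 hkappa hS3 fullv; apply: filterS => w gV.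
apply: great_vsphere.
have -> : orths (fun i => tnth (normals S3 w) i : E) fullv [set: 'I_(d - k)]%SET =
    orths (fun i => normal (S3 i w)) fullv [set: 'I_(d - k)]%SET.
  by congr orths; apply/funext => i; rewrite tnth_mktuple.
rewrite dim_orths// cardsT card_ord dimvf /dim /= mul1n.
by rewrite subSn ?leq_subr// subKn// ltnW.
Qed.

Section SplitIndices.
Variable I : {set 'I_n}.
Hypothesis cI : #|I| = (d - k)%N.
Variable g : 'I_m -> 'I_n.
Hypothesis g_inj : injective g.
Hypothesis gP : forall i, i \notin I <-> exists j, i = g j.

(** The splitting along which two families are glued: [I] goes to the hyperspheres that cut out the
    flat, and its complement is numbered as [g] does. *)
Lemma exists_split : exists h : 'I_n -> 'I_(d - k) + 'I_m, [/\ injective h,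
  forall j, h (g j) = inr j,
  forall i, i \in I -> exists a, h i = inl a &
  forall a, exists2 i, i \in I & h i = inl a].
Proof.
have [f [f_inj fP]] : exists f : 'I_(d - k) -> 'I_n, injective f /\
    forall i, i \notin ~: I <-> exists a, i = f a.
  apply: exists_complement_enum; rewrite -cI cardsC card_ord//.
have fI a : f a \in I.
  by have := (fP (f a)).2 (ex_intro _ a erefl); rewrite inE negbK.
have gI j : g j \notin I by apply/gP; exists j.
have ex i : exists c : 'I_(d - k) + 'I_m, i = match c with inl a => f a | inr j => g j end.
  have [iI|/gP[j ij]] := boolP (i \in I); last by exists (inr j).
  have /fP[a ia] : i \notin ~: I by rewrite inE iI.
  by exists (inl a).
have [h hh] := choice ex; exists h; split.
- by move=> i i' hi; rewrite (hh i) (hh i') hi.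
- move=> j; have := hh (g j); case: (h (g j)) => [a gf|j' /g_inj ->//].
  by have := gI j; rewrite gf fI.
- move=> i iI; have := hh i; case: (h i) => [a _|j ij]; first by exists a.
  by have := gI j; rewrite -ij iI.
- move=> a; exists (f a) => //; have := hh (f a); case: (h (f a)) => [a' /f_inj ->//|j fg].
  by have := gI j; rewrite -fg fI.
Qed.

Let cI' : (#|I| <= d)%N.
Proof. by rewrite cI leq_subr. Qed.

Context d1 (Omega1 : measurableType d1) (P1 : probability Omega1 R).
Variable S1 : 'I_n -> Omega1 -> borel_sconvex R d.
Hypothesis hS1 : iid_great_hyperspheres P1 kappa S1.

(* [S1] has the law of [S3] and [S2] glued along the splitting of the indices
   into [I] and its complement; the identity is then Fubini's theorem. *)
Lemma flag_integral (A : set (borel_sconvex R d)) : measurable A ->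
  \int[P1]_w (cell_ratio k A (stratum_body cI' (normals S1 w))
     (fun j => normal (S1 (g j) w)))%:E =
  \int[P3]_w cell_law k P2 S2 A (common_sphere w).
Proof.
move=> mA; have [h [h_inj hg hI hs]] := exists_split.
have gl := iid_glue h_inj hS3 hS2.
set X := glue_families S3 S2 h in gl.
pose F (t : n.-tuple (borel_euclid R d)) : \bar R :=
  (cell_ratio k A (stratum_body cI' t) (fun j => tnth t (g j)))%:E.
have mF : measurable_fun setT F.
  apply: (measurable_cell_ratio k (L := stratum_body cI') (v := fun t j => tnth t (g j))) => //.
    exact: measurable_stratum_body.
  by move=> j; exact: measurable_tnth.
have F0 t : 0 <= F t by rewrite lee_fin cell_ratio_ge0.
transitivity (\int[P1]_w F (normals S1 w)).
  apply: eq_integral => w _; congr (cell_ratio _ _ _ _)%:E.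
  by apply/funext => j; rewrite tnth_mktuple.
have m1 := measurable_normals d_gt0 hS1.
have m2 := measurable_normals d_gt0 gl.
transitivity (\int[pushforward P1 (normals S1)]_t F t).
  by rewrite (ge0_integral_pushforward m1)// preimage_setT.
transitivity (\int[pushforward (P3 \x P2) (normals X)]_t F t).
  by apply: eq_measure_integral => C mC _; exact: (normals_law d_gt0 hS1 gl mC).
rewrite (ge0_integral_pushforward m2)// preimage_setT.
have mFX : measurable_fun setT (F \o normals X) by exact: measurableT_comp.
have FX0 z : 0 <= (F \o normals X) z by exact: F0.
transitivity (\int[P3]_x \int[P2]_y (F \o normals X) (x, y)).
  exact: (@fubini_tonelli1 _ _ _ _ _ P3 P2 (F \o normals X) mFX FX0).
apply: eq_integral => w3 _; apply: eq_integral => w2 _.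
rewrite /F /=; congr (cell_ratio _ _ _ _)%:E.
  apply: sconvexP; rewrite /= -!/(stratum _ _) !stratumE.
  apply/seteqP; split => y [sy hy]; split => //.
    move=> a _; have [i iI hi] := hs a.
    by have := hy i iI; rewrite !tnth_mktuple /X /glue_families hi.
  move=> i iI; have [a hi] := hI i iI; rewrite tnth_mktuple /X /glue_families hi /=.
  by have := hy a (finset.in_setT _); rewrite tnth_mktuple.
by apply/funext => j; rewrite tnth_mktuple /X /glue_families hg.
Qed.

End SplitIndices.
Section TypicalFace.
Context d1 (Omega1 : measurableType d1) (P1 : probability Omega1 R).
Variable S1 : 'I_n -> Omega1 -> borel_sconvex R d.
Hypothesis hS1 : iid_great_hyperspheres P1 kappa S1.
Variable g : {set 'I_n} -> 'I_m -> 'I_n.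
Hypothesis gP : forall I : {set 'I_n}, #|I| = (d - k)%N -> injective (g I) /\
  forall i, i \notin I <-> exists j, i = g I j.

Let u (w : Omega1) (i : 'I_n) : E := normal (S1 i w).
Let nflats := #|[set I : {set 'I_n} | #|I| == (d - k)%N]%SET|.

Definition flat_ratio (A : set (borel_sconvex R d)) (I : {set 'I_n}) (w : Omega1) : R :=
  (numcells (stratum (u w) I) (u w \o g I) A)%:R / (nregions m k.+1)%:R.

Lemma flat_ratio_ge0 A I w : (0 <= flat_ratio A I w)%R.
Proof. by rewrite divr_ge0. Qed.

Lemma flat_ratioE A (I : {set 'I_n}) w (cI : (#|I| <= d)%N) :
  flat_ratio A I w = cell_ratio k A (stratum_body cI (normals S1 w))
     (fun j => normal (S1 (g I j) w)).
Proof.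
rewrite /flat_ratio /cell_ratio /= (_ : (fun i => tnth (normals S1 w) i : E) = u w)//.
by apply/funext => i; rewrite tnth_mktuple.
Qed.

Lemma nflats_gt0 : (0 < nflats)%N.
Proof.
by rewrite /nflats card_draws card_ord bin_gt0 -mn leq_addl.
Qed.

Lemma face_proportion_ae A :
  {ae P1, forall w, proportion (tess_faces k (random_tessellation S1 w)) A =
    \sum_(I : {set 'I_n} | #|I| == (d - k)%N) (nflats%:R^-1 * flat_ratio A I w)}%R.
Proof.
have := generic_ae d_gt0 hkappa hS1 fullv; apply: filterS => w gV.
have -> : random_tessellation S1 w = tessellation (fun i => orth_sphere (u w i)).
  by rewrite /random_tessellation; congr tessellation; apply/funext => i;
    exact: (normal_orth d_gt0 hS1).
have g_inj (I : {set 'I_n}) : #|I| = (d - k)%N -> injective (g I) by move=> /gP[].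
have g_range (I : {set 'I_n}) : #|I| = (d - k)%N ->
    forall i, i \notin I <-> exists j, i = g I j by move=> /gP[].
rewrite /proportion (card_faces_in kd gV g_range).
rewrite (card_faces kd gV g_inj g_range) -/nflats natr_sum mulr_suml.
by apply: eq_bigr => I _; rewrite /flat_ratio natrM invfM mulrCA mulrA.
Qed.

(** Almost surely the proportion of faces in [A] is the average of [flat_ratio] over the index sets.
    By [flag_integral] all of them contribute the same integral, and their number cancels the
    weight. *)
Lemma typical_face_law Z A : typical_face P1 k S1 Z -> measurable A ->
  P1 (Z @^-1` A) = \int[P3]_w cell_law k P2 S2 A (common_sphere w).
Proof.
move=> [mZ hZ] mA.
have := hZ A setT mA; rewrite preimage_setT setIT => ->//.
have le_d (I : {set 'I_n}) : #|I| == (d - k)%N -> (#|I| <= d)%N.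
  by move=> /eqP ->; rewrite leq_subr.
have mf (I : {set 'I_n}) : #|I| == (d - k)%N ->
    measurable_fun setT (fun w => (flat_ratio A I w)%:E).
  move=> cI; under eq_fun do rewrite (flat_ratioE A _ (le_d I cI)).
  apply: (measurable_cell_ratio k (L := fun w => stratum_body (le_d I cI) (normals S1 w))
    (v := fun w j => normal (S1 (g I j) w))) => //.
    exact: measurableT_comp (@measurable_stratum_body R d _ _ _) (measurable_normals d_gt0 hS1).
  by move=> j; exact: (measurable_normal d_gt0 hS1).
pose c : \bar R := (nflats%:R^-1)%:E.
have c0 : 0 <= c by rewrite lee_fin invr_ge0.
pose h (I : {set 'I_n}) w := c * (flat_ratio A I w)%:E.
have h0 I w : 0 <= h I w by rewrite mule_ge0// lee_fin flat_ratio_ge0.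
have mh (I : {set 'I_n}) : #|I| == (d - k)%N -> measurable_fun setT (h I).
  by move=> cI; apply: emeasurable_funM; [exact: measurable_cst|exact: mf].
transitivity (\int[P1]_w \sum_(I : {set 'I_n} | #|I| == (d - k)%N) h I w).
  apply: ae_eq_integral_nonmeasurable.
  - by move=> w; rewrite lee_fin divr_ge0.
  - by move=> w; apply: sume_ge0.
  - under eq_fun do rewrite big_mkcond.
    by apply: emeasurable_sum => I; case: (boolP (#|I| == (d - k)%N)) => // cI; exact: mh.
  - have := face_proportion_ae A; apply: filterS => w ->.
    by rewrite -sumEFin; apply: eq_bigr => I _; rewrite EFinM.
under eq_integral do rewrite big_mkcond.
rewrite ge0_integral_sum//; last 2 first.
- by move=> I; case: (boolP (#|I| == (d - k)%N)) => // cI; exact: mh.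
- by move=> I w _; case: ifP.
rewrite (eq_bigr (fun I : {set 'I_n} => if #|I| == (d - k)%N then
    c * \int[P3]_w cell_law k P2 S2 A (common_sphere w) else 0)); last first.
  move=> I _; case: (boolP (#|I| == (d - k)%N)) => [cI|_]; last by rewrite integral0.
  have [gI gr] := gP (eqP cI).
  rewrite /h ge0_integralZl//; [|exact: mf|by move=> w _; rewrite lee_fin flat_ratio_ge0].
  congr (_ * _); rewrite -(flag_integral (eqP cI) gI gr hS1 mA).
  by apply: eq_integral => w _; congr (_%:E); exact: flat_ratioE.
rewrite -big_mkcond -ge0_sume_distrl//.
rewrite [X in X * _](_ : _ = 1) ?mul1e// sumEFin sumr_const.
rewrite (_ : #|_| = nflats); last by rewrite /nflats cardsE.
by rewrite -[(_ *+ _)%R]mulr_natr mulVf// pnatr_eq0 -lt0n nflats_gt0.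
Qed.

End TypicalFace.
End FaceLaw.

(** * A countable generating pi-system, and the conclusion *)

Section HitsPiSystem.
Variables (R : realType) (d : nat).

(** Hitting events alone are not stable under intersection; finite lists of balls repair this and
    remain countable. The empty list gives the whole space. *)
Definition hits_all (s : seq ('rV[rat]_(d.+1) * nat)) : set (sconvex R d) :=
  [set K | forall p, p \in s -> hits_ball p K].

Lemma hits_allI : setI_closed (range hits_all).
Proof.
move=> _ _ [s _ <-] [t _ <-]; exists (s ++ t) => //; apply/seteqP; split => K.
  by move=> h; split => p ps; apply: h; rewrite mem_cat ps ?orbT.
by move=> [hs ht] p; rewrite mem_cat => /orP[/hs|/ht].
Qed.

Lemma measurable_hits_all s : measurable (hits_all s : set (borel_sconvex R d)).
Proof.
rewrite (_ : hits_all s = \bigcap_(p in [set` s]) hits_ball p).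
  by apply: countable_bigcap_measurable => p _; apply: measurable_hits; exact: ratball_open.
by apply/seteqP; split => K h p ps; exact: h.
Qed.

Lemma borel_sconvex_hits_all :
  @measurable _ (borel_sconvex R d) = <<s range hits_all >>.
Proof.
apply/seteqP; split; last first.
  apply: smallest_sub; first exact: (@sigma_algebra_measurable _ (borel_sconvex R d)).
  by move=> _ [s _ <-]; exact: measurable_hits_all.
rewrite [X in X `<=` _](@borel_sconvexE R d).
apply: smallest_sub; first exact: smallest_sigma_algebra.
move=> _ [p _ <-]; apply: sub_sigma_algebra; exists [:: p] => //.
apply/seteqP; split => K; first by apply; rewrite inE.
by move=> h q; rewrite inE => /eqP ->.
Qed.

Lemma hits_all_nil : hits_all [::] = setT.
Proof. by apply/seteqP; split. Qed.

End HitsPiSystem.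

Local Open Scope ereal_scope.

Theorem corollary4p3 (R : realType) (d k n : nat)
  (hd : (1 <= d)%N) (hk : (k <= d - 1)%N) (hn : (d - k <= n)%N)
  (kappa : probability (borel_sconvex R d) R)
  (hkappa : nondegenerate_directional kappa)
  (kappak : probability (borel_sconvex R d) R)
  (hkappak : intersection_distribution kappa k kappak)
  (* the tessellation of intensity n and its typical spherical k-face *)
  (d1 : measure_display) (Omega1 : measurableType d1) (P1 : probability Omega1 R)
  (S1 : 'I_n -> Omega1 -> borel_sconvex R d)
  (hS1 : iid_great_hyperspheres P1 kappa S1)
  (Z : Omega1 -> borel_sconvex R d)
  (hZ : typical_face P1 k S1 Z)
  (* a version of the conditional distribution of Z given its direction *)
  (Q : R.-pker (borel_sconvex R d) ~> (borel_sconvex R d))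
  (hQ : regular_conditional_distribution P1 Z
          (fun w => direction (Z w) : borel_sconvex R d) Q)
  (* the tessellation of intensity n - d + k and, for every k-dimensional great
     subsphere L, the typical cell of its section with L *)
  (d2 : measure_display) (Omega2 : measurableType d2) (P2 : probability Omega2 R)
  (S2 : 'I_(n + k - d) -> Omega2 -> borel_sconvex R d)
  (hS2 : iid_great_hyperspheres P2 kappa S2)
  (Zcell : sconvex R d -> Omega2 -> borel_sconvex R d)
  (hZcell : forall L : sconvex R d, great_subsphere k L ->
     typical_section_cell P2 L S2 (Zcell L)) :
  {ae kappak, forall L : sconvex R d, great_subsphere k L ->
     forall A : set (borel_sconvex R d), measurable A ->
       Q L A = P2 (Zcell L @^-1` A)}.
Proof.
have kd : (k < d)%N by rewrite -(subnK hd) addn1 ltnS.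
have d_gt0 : (0 < d)%N by [].
have mn : (n + k - d + (d - k) = n)%N.
  have kn : (d <= n + k)%N by rewrite addnC -leq_subLR.
  by apply/eqP; rewrite -(eqn_add2r k) -addnA (subnK (ltnW kd)) subnK.
case: hkappak => dd [T3 [P3 [S3 [hS3 kappakE]]]].
pose common := common_sphere S3.
have mcommon : measurable_fun setT common := measurable_common_sphere kd hS3.
have great := common_sphere_great kd hkappa hS3.
have commonE (B : set (borel_sconvex R d)) : measurable B -> kappak B = P3 (common @^-1` B).
  move=> mB; rewrite kappakE//; congr (P3 _); apply/seteqP; split => w /=.
    move=> [K BK KE]; rewrite (_ : common w = K)//.
    by apply: sconvexP; rewrite KE; exact: (common_sphereE kd hS3).
  by move=> Bw; exists (common w) => //; exact: (common_sphereE kd hS3).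
have int_common f : measurable_fun setT f -> (forall L, 0 <= f L) ->
    \int[kappak]_L f L = \int[P3]_w f (common w).
  move=> mf f0; transitivity (\int[pushforward P3 common]_L f L).
    by apply: eq_measure_integral => B mB _; exact: commonE.
  by rewrite (ge0_integral_pushforward mcommon)// preimage_setT.
have [g gP] : exists g : {set 'I_n} -> 'I_(n + k - d) -> 'I_n,
    forall I : {set 'I_n}, #|I| = (d - k)%N -> injective (g I) /\
      forall i, i \notin I <-> exists j, i = g I j.
  (* Choice needs a map for every [I]; index sets of the wrong size get the inclusion of the first
     indices. *)
  have ex (I : {set 'I_n}) : exists g : 'I_(n + k - d) -> 'I_n, #|I| = (d - k)%N ->
      injective g /\ forall i, i \notin I <-> exists j, i = g j.
    have [cI|cI] := eqVneq #|I| (d - k)%N.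
      have [|g hg] := @exists_complement_enum n (n + k - d) I; first by rewrite cI.
      by exists g.
    have le : (n + k - d <= n)%N by rewrite -{2}mn leq_addr.
    by exists (widen_ord le) => /eqP; rewrite (negbTE cI).
  by have [g hg] := choice ex; exists g.
pose law := cell_law k P2 S2.
have mlaw A : measurable A -> measurable_fun setT (law A).
  by move=> mA; exact: (measurable_cell_law k d_gt0 hS2).
have law0 A L : 0 <= law A L by exact: cell_law_ge0.
have Zlaw A : measurable A -> P1 (Z @^-1` A) = \int[P3]_w law A (common w).
  by move=> mA; exact: (typical_face_law kd mn hkappa hS2 hS3 hS1 gP hZ mA).
have mdir (B : set (borel_sconvex R d)) : measurable B -> measurable (@direction R d @^-1` B : set (borel_sconvex R d)).
  by move=> mB; rewrite -[X in measurable X]setTI; exact: measurable_direction.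
(* The joint law of the face and its direction: the constraint on the direction is absorbed into the
   set of faces, and [cell_law_direction] releases it as an indicator of [B]. *)
have joint (A B : set (borel_sconvex R d)) : measurable A -> measurable B ->
    P1 (Z @^-1` A `&` (fun w => direction (Z w)) @^-1` B) = \int[kappak]_(L in B) law A L.
  move=> mA mB; rewrite integral_mkcond.
  have mres : measurable_fun setT (law A \_ B).
    apply: (measurable_restrictT _ mB).1; exact: measurable_funTS (mlaw _ _).
  have res0 L : 0 <= (law A \_ B) L by rewrite patchE; case: ifP.
  rewrite int_common//.
  have mAB : measurable (A `&` @direction R d @^-1` B : set (borel_sconvex R d)).
    by apply: measurableI => //; exact: mdir.
  rewrite -[LHS]/(P1 (Z @^-1` (A `&` @direction R d @^-1` B))) Zlaw//.
  apply: ge0_ae_eq_integral => //.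
  - exact: measurableT_comp (mlaw _ mAB) mcommon.
  - exact: measurableT_comp mres mcommon.
  - have := great; apply: filterS => w gw _ /=.
    by rewrite /law cell_law_direction// patchE indicE; case: ifP => _; rewrite ?mul1e ?mul0e.
have dirlaw (B : set (borel_sconvex R d)) : measurable B ->
    P1 ((fun w => direction (Z w)) @^-1` B) = kappak B.
  move=> mB; rewrite -[X in P1 X]setTI -(preimage_setT Z) joint// integral_mkcond.
  have mres : measurable_fun setT (law setT \_ B).
    by apply: (measurable_restrictT _ mB).1; exact: measurable_funTS (mlaw _ _).
  have res0 L : 0 <= (law setT \_ B) L by rewrite patchE; case: ifP.
  rewrite int_common// commonE//.
  have mcB : measurable (common @^-1` B).
    by rewrite -[X in measurable X]setTI; exact: mcommon.
  have -> : P3 (common @^-1` B) = \int[P3]_w (\1_(common @^-1` B) w)%:E.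
    by rewrite integral_indic// setIT.
  apply: ge0_ae_eq_integral => //.
  - exact: measurableT_comp mres mcommon.
  - by apply/measurable_EFinP; exact: measurable_indic.
  - have := great; apply: filterS => w gw _ /=.
    rewrite patchE indicE; case: ifPn => cB.
      by rewrite /law (cell_law_setT d_gt0 hkappa hS2)// mem_set//; exact/set_mem.
    by rewrite memNset//; move: cB => /negP cB Bw; apply: cB; exact/mem_set.
have [mZ mD hQ'] := hQ.
have mQ A : measurable A -> measurable_fun setT (fun L => Q L A).
  by move=> mA; exact: measurable_kernel.
(* The direction has law [kappak] by [dirlaw], so the defining identity of [Q] becomes an integral
   against [kappak], comparable with [joint]. *)
have jointQ (A B : set (borel_sconvex R d)) : measurable A -> measurable B ->
    P1 (Z @^-1` A `&` (fun w => direction (Z w)) @^-1` B) = \int[kappak]_(L in B) Q L A.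
  move=> mA mB; rewrite hQ'//.
  transitivity (\int[pushforward P1 (fun w => direction (Z w) : borel_sconvex R d)]_(L in B) Q L A).
    by rewrite (ge0_integral_pushforward mD)//; apply: measurable_funTS; exact: mQ.
  by apply: eq_measure_integral => C mC _; exact: dirlaw.
(* Two functions with the same integral over every Borel set agree almost everywhere; integrability
   holds because [Q] has values at most 1. The null set still depends on [A]. *)
have aeQ A : measurable A -> {ae kappak, forall L, Q L A = law A L}.
  move=> mA.
  have iQ : kappak.-integrable setT (fun L => Q L A).
    apply/integrableP; split; first exact: mQ.
    apply: (@le_lt_trans _ _ (\int[kappak]_L (cst 1 L))).
      apply: ge0_le_integral => //.
      - by apply: measurableT_comp => //; exact: mQ.
      - move=> L _ /=; rewrite gee0_abs// -(prob_kernel (s := Q) L).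
        by apply: le_measure; rewrite ?inE.
    rewrite integral_cst// mul1e [X in X < _](_ : _ = 1) ?ltry//.
    exact: probability_setT.
  have := integral_ae_eq measurableT iQ (mlaw _ mA).
  move=> h; have {}h : ae_eq kappak setT (fun L => Q L A) (law A).
    by apply: h => B _ mB; rewrite -joint// jointQ.
  by apply: filterS h => L; apply.
(* The finite lists of balls are enumerated by natural numbers, and numbers that code no list impose
   no condition. *)
pose good (c : nat) (L : borel_sconvex R d) :=
  if choice.unpickle c is Some s then Q L (hits_all s) = law (hits_all s) L else True.
have : {ae kappak, forall L, forall c, good c L}.
  apply: ae_foralln => c; rewrite /good; case: choice.unpickle => [s|]; last exact: aeW.
  by apply: aeQ; exact: measurable_hits_all.
apply: filterS => L hL gL A mA.
have ZE B : measurable B -> P2 (Zcell L @^-1` B) = law B L.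
  by move=> mB; exact: (typical_section_cell_law d_gt0 hkappa hS2 gL (hZcell L gL) mB).
have [mZL _] := hZcell L gL.
rewrite -[RHS]/(pushforward P2 (Zcell L) A).
have cover : \bigcup_(_ : nat) [set: borel_sconvex R d] = setT.
  by apply/seteqP; split => // K _; exists 0%N.
have full (i : nat) : range (@hits_all R d) [set: borel_sconvex R d].
  by exists [::] => //; exact: hits_all_nil.
have agree B : range (@hits_all R d) B -> Q L B = pushforward P2 (Zcell L) B.
  move=> [s _ <-]; rewrite [RHS](ZE _ (@measurable_hits_all R d s)).
  by have := hL (choice.pickle s); rewrite /good choice.pickleK.
have fin (i : nat) : Q L setT < +oo by rewrite prob_kernel ltry.
(* For a good [L] both sides are measures in [A] that agree on the pi-system, which contains the
   whole space; hence they agree on all Borel sets. *)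
exact: (measure_unique _ _ (@borel_sconvex_hits_all R d) (@hits_allI R d) full cover _ _ agree fin).
Qed.
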